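(* Let $k\geq 2$ be an even integer. Then the function $\mathbb{R}\ni\alpha\mapsto \lambda_{1,\mathfrak{Q}^{(k)}(\alpha)}$ attains a unique minimum at $\alpha=0$ (that is, $\lambda_{1,\mathfrak{Q}^{(k)}(\alpha)}>\lambda_{1,\mathfrak{Q}^{(k)}(0)}$ for every real $\alpha\neq 0$). Moreover, this minimum is non-degenerate, i.e. $\frac{\partial^2}{\partial\alpha^2}\lambda_{1,\mathfrak{Q}^{(k)}(\alpha)}\big|_{\alpha=0}>0$.
   Context: For an integer $k\geq 1$ and $\alpha\in\mathbb{R}$, $\mathfrak{Q}^{(k)}(\alpha)$ denotes the self-adjoint operator $-\frac{d^2}{dt^2}+\bigl(\frac{t^{k+1}}{k+1}-\alpha\bigr)^2$ in $L^2(\mathbb{R})$. Its spectrum is discrete, and $\lambda_{1,\mathfrak{Q}^{(k)}(\alpha)}$ denotes its lowest eigenvalue. *)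

(* Defs.v *)
From mathcomp Require Import all_boot all_order all_algebra.
From mathcomp Require Import all_classical all_reals all_analysis.
From mathcomp Require Import complex.

Set Implicit Arguments.
Unset Strict Implicit.
Unset Printing Implicit Defensive.

Import Order.TTheory GRing.Theory Num.Theory.
Import numFieldNormedType.Exports.

Local Open Scope classical_set_scope.
Local Open Scope complex_scope.
Local Open Scope ring_scope.

(* u represents an element of the complex Hilbert space L^2(R). *)
Definition square_integrable (R : realType) (u : R -> R[i]) : Prop :=
  (fun t => complex.Re (u t)) \in Lfun (@lebesgue_measure R) 2%:E /\
  (fun t => complex.Im (u t)) \in Lfun (@lebesgue_measure R) 2%:E.

(* g is locally absolutely continuous, with g' = f almost everywhere; by the
   Lebesgue fundamental theorem of calculus this means that f is locally
   integrable and that g is one of its indefinite integrals. *)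
Definition real_ac_derivative (R : realType) (g f : R -> R) : Prop :=
  forall a b : R, a <= b ->
    (@lebesgue_measure R).-integrable `[a, b] (EFin \o f) /\
    g b - g a = \int[@lebesgue_measure R]_(x in `[a, b]) f x.

Definition ac_derivative (R : realType) (g f : R -> R[i]) : Prop :=
  real_ac_derivative (fun t => complex.Re (g t)) (fun t => complex.Re (f t)) /\
  real_ac_derivative (fun t => complex.Im (g t)) (fun t => complex.Im (f t)).

(* Graph of the operator - d^2/dt^2 + V in L^2(R) on its maximal domain
     { u in L^2 | u, u' locally absolutely continuous, - u'' + V u in L^2 }.
   For V continuous and bounded below the endpoints -oo and +oo are in the
   limit-point case, so this is the only self-adjoint realization.  An element
   of the domain is given by its continuous representative; the image f is
   determined up to a null set. *)
Definition schrodinger (R : realType) (V : R -> R) (u f : R -> R[i]) : Prop :=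
  [/\ square_integrable u, square_integrable f
    & exists u1 u2 : R -> R[i],
        [/\ ac_derivative u u1, ac_derivative u1 u2
          & {ae @lebesgue_measure R, forall t, f t = - u2 t + (V t)%:C * u t}]].

Definition frakQ (R : realType) (k : nat) (alpha : R) :
    (R -> R[i]) -> (R -> R[i]) -> Prop :=
  schrodinger (fun t => (t ^+ k.+1 / k.+1%:R - alpha) ^+ 2).

(* Restricted to real l, since the eigenvalues of a self-adjoint operator are
   real. *)
Definition is_eigenvalue (R : realType)
    (A : (R -> R[i]) -> (R -> R[i]) -> Prop) (l : R) : Prop :=
  exists2 u : R -> R[i],
    ~ {ae @lebesgue_measure R, forall t, u t = 0} & A u (fun t => l%:C * u t).

Definition is_lowest_eigenvalue (R : realType)
    (A : (R -> R[i]) -> (R -> R[i]) -> Prop) (l : R) : Prop :=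
  is_eigenvalue A l /\ forall m : R, is_eigenvalue A m -> l <= m.

(* The default value 0 is irrelevant for frakQ k alpha (k >= 1), which has a
   discrete spectrum bounded below. *)
Definition lambda1 (R : realType) (k : nat) (alpha : R) : R :=
  xget 0 [set l | is_lowest_eigenvalue (frakQ k alpha) l].

(* Main.v *)
(* Write [r t = t^(k+1)/(k+1)], [V_a = (r - a)^2], [l a] for the lowest
   eigenvalue and [u_a] for the positive ground state with [u_a 0 = 1].
   Among all pairs (energy, slope at 0) whose solution is nonnegative on the
   whole line, one with the largest energy decays at both ends; this is the
   ground state, and a Sturm argument excludes lower eigenvalues.

   Put [u = u_0], which is even, and let [sigma t] be [2 / (u t)^2] times the
   integral of [r u^2] over [t, +oo[. Since [- u' > r u] on ]0, +oo[, one has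
   [0 <= sigma < 1]. With [omega = - u'/u - a sigma],
     [omega' - omega^2 + V_a = l 0 + a^2 (1 - sigma^2)],
   so Jacobi's substitution turns the quadratic form at [a] into
   [l 0 + a^2 (1 - sigma^2)] plus a square, whence [l a > l 0].

   The Wronskian identity for [u_a], [u_b] gives the difference quotients of
   [l] as ratios of integrals, hence [l' a = 2 a - 2 <r u_a, u_a> / <u_a, u_a>].
   The moment [<r u_z, u_z>] is [z] times the integral of
   [sigma (u_z / u) W_z / z], [W_z] the Wronskian of [u] and [u_z]; as
   [W_z / z -> sigma u^2], [l'' 0 = 2 - 2 <sigma^2 u, u> / <u, u> > 0]. *)
Require Import Defs.
From mathcomp Require Import all_boot all_order all_algebra.
From mathcomp Require Import all_classical all_reals all_analysis.
From mathcomp Require Import complex zify ring lra measurable_realfun.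
Import Order.TTheory GRing.Theory Num.Theory.
Import numFieldNormedType.Exports.
Local Open Scope classical_set_scope.
Local Open Scope ring_scope.

Set Implicit Arguments.
Unset Strict Implicit.
Unset Printing Implicit Defensive.

(** * Derivatives of real functions *)

Section Calculus.
Context {R : realType}.
Implicit Types (f g : R -> R) (t x a b : R).

(** Spectral theory is replaced by conditions on solutions of an ordinary differential equation:
    positivity and monotone tails, both of which can be tested pointwise. The potential is a
    polynomial, so solutions are entire power series, and the normalisation at 0 leaves only the
    energy and the slope as parameters, which stay in a compact box. Compactness serves twice: it
    yields the largest energy and, together with uniqueness of the ground state, the continuity in
    [a] of energy and slope. No perturbation theory is used: derivatives of the eigenvalue come from
    exact identities between integrals followed by dominated convergence, which is why decay bounds
    are made uniform for [a] in bounded sets. For [k] even the reflection [t -> - t] exchanges [a]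
    and [- a], so most estimates are made on the right half-line only. The delicate point of the
    second derivative is the factor [u_z / u], whose denominator decays: the quotient [W_z / z] must
    be bounded by a multiple of [u] itself. *)

Definition is_deriv f f1 := forall t, is_derive t (1 : R) f (f1 t).

Lemma fderiv_cst c t : is_derive t (1 : R) (fun=> c : R) (0 : R).
Proof. exact: is_derive_cst. Qed.

Lemma fderiv_id t : is_derive t (1 : R) (fun x : R => x) (1 : R).
Proof. exact: is_derive_id. Qed.

Lemma fderiv_add f g t (df dg : R) : is_derive t (1 : R) f df ->
  is_derive t (1 : R) g dg -> is_derive t (1 : R) (fun x => f x + g x) (df + dg : R).
Proof. by move=> hf hg; exact: is_deriveD. Qed.

Lemma fderiv_opp f t (df : R) : is_derive t (1 : R) f df ->
  is_derive t (1 : R) (fun x => - f x) (- df : R).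
Proof. by move=> hf; exact: is_deriveN. Qed.

Lemma fderiv_mul f g t (df dg : R) : is_derive t (1 : R) f df ->
  is_derive t (1 : R) g dg ->
  is_derive t (1 : R) (fun x => f x * g x) (df * g t + f t * dg : R).
Proof.
move=> hf hg; apply: (@is_derive_eq _ _ _ (f * g)).
by rewrite /GRing.scale /= addrC [g t * _]mulrC.
Qed.

Lemma fderiv_exp f n t (df : R) : is_derive t (1 : R) f df ->
  is_derive t (1 : R) (fun x => f x ^+ n) (n%:R * f t ^+ n.-1 * df : R).
Proof.
move=> hf; rewrite (_ : (fun x => f x ^+ n) = f ^+ n); last first.
  by apply/funext => x; rewrite exprfctE.
exact: is_deriveX.
Qed.

Lemma fderiv_inv f t (df : R) : f t != 0 -> is_derive t (1 : R) f df ->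
  is_derive t (1 : R) (fun x => (f x)^-1) (- (f t) ^- 2 * df : R).
Proof. by move=> f0 hf; exact: is_deriveV. Qed.

Lemma fderiv_expR f t (df : R) : is_derive t (1 : R) f df ->
  is_derive t (1 : R) (fun x => expR (f x)) (expR (f t) * df : R).
Proof.
by move=> hf; exact: (is_derive1_comp (is_derive_expR (f t)) hf).
Qed.

Lemma fderiv_comp f g t (df dg : R) : is_derive (g t) (1 : R) f df ->
  is_derive t (1 : R) g dg -> is_derive t (1 : R) (fun x => f (g x)) (df * dg : R).
Proof. by move=> hf hg; exact: is_derive1_comp. Qed.

Lemma fderiv_eq f t (df dg : R) : is_derive t (1 : R) f df -> df = dg ->
  is_derive t (1 : R) f dg.
Proof. by move=> + <-. Qed.

End Calculus.

(** The derivative is read off the shape of the function, with the [is_deriv] facts of the context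
    for its atoms. [der] leaves the nonvanishing of inverted functions, then the equation with the
    announced value. *)
Ltac der_rec :=
  lazymatch goal with
  | |- is_derive ?t _ (fun _ => ?c) _ => exact (fderiv_cst c t)
  | |- is_derive ?t _ (fun x => @?f x + @?g x) _ => notypeclasses refine (@fderiv_add _ f g t _ _ _ _); der_rec
  | |- is_derive ?t _ (fun x => - @?f x) _ => notypeclasses refine (@fderiv_opp _ f t _ _); der_rec
  | |- is_derive ?t _ (fun x => @?f x * @?g x) _ => notypeclasses refine (@fderiv_mul _ f g t _ _ _ _); der_rec
  | |- is_derive ?t _ (fun x => @?f x ^+ ?n) _ => notypeclasses refine (@fderiv_exp _ f n t _ _); der_rec
  | |- is_derive ?t _ (fun x => expR (@?f x)) _ => notypeclasses refine (@fderiv_expR _ f t _ _); der_rec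
  | |- is_derive ?t _ (fun x => (@?f x)^-1) _ => notypeclasses refine (@fderiv_inv _ f t _ _ _); [ | der_rec]
  | |- is_derive ?t _ (fun x => x) _ => exact (fderiv_id t)
  | H : is_deriv ?f _ |- is_derive ?t _ ?f _ => exact (H t)
  | H : is_deriv ?f _ |- is_derive ?t _ (fun x => ?f x) _ => exact (H t)
  | H : is_deriv ?f _ |- is_derive ?t _ (fun x => ?f (@?g x)) _ => notypeclasses refine (@fderiv_comp _ f g t _ _ (H _) _); der_rec
  end.
Ltac der := notypeclasses refine (@fderiv_eq _ _ _ _ _ _ _); [der_rec | cbv beta].

(** * Monotonicity and bounds from derivatives *)

Section Monotonicity.
Context {R : realType}.
Implicit Types (f g : R -> R) (t x a b : R).

Lemma is_deriv_continuous f f1 : is_deriv f f1 -> continuous f.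
Proof.
move=> df t; apply/differentiable_continuous/derivable1_diffP.
by have := df t => -[].
Qed.

Lemma is_deriv_within f f1 A : is_deriv f f1 -> {within A, continuous f}.
Proof. by move=> /is_deriv_continuous cf; exact: continuous_subspaceT. Qed.

Lemma mean_value f f1 a b : is_deriv f f1 -> a < b ->
  exists2 c : R, a < c < b & f b - f a = f1 c * (b - a).
Proof.
move=> df ab.
have [c cab e] := MVT ab (fun x _ => df x) (is_deriv_within df).
by exists c => //; move: cab; rewrite in_itv.
Qed.

Lemma is_deriv_ge0_le f f1 a b : is_deriv f f1 -> a <= b ->
  (forall t, a < t < b -> 0 <= f1 t) -> f a <= f b.
Proof.
move=> df; rewrite le_eqVlt => /predU1P[->//|ab] f0.
have [c cab] := mean_value df ab; rewrite -subr_ge0 => ->.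
by rewrite mulr_ge0 ?f0// subr_ge0 ltW.
Qed.

Lemma is_deriv_gt0_lt f f1 a b : is_deriv f f1 -> a < b ->
  (forall t, a < t < b -> 0 < f1 t) -> f a < f b.
Proof.
move=> df ab f0.
have [c cab] := mean_value df ab; rewrite -subr_gt0 => ->.
by rewrite mulr_gt0 ?f0// subr_gt0.
Qed.

Lemma is_deriv_opp f f1 : is_deriv f f1 -> is_deriv (fun t => - f t) (fun t => - f1 t).
Proof. by move=> df t; der. Qed.

Lemma is_deriv_le0_le f f1 a b : is_deriv f f1 -> a <= b ->
  (forall t, a < t < b -> f1 t <= 0) -> f b <= f a.
Proof.
move=> df ab f0; rewrite -lerN2; apply: (is_deriv_ge0_le (is_deriv_opp df) ab).
by move=> t /f0; rewrite oppr_ge0.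
Qed.

Lemma is_deriv_lt0_lt f f1 a b : is_deriv f f1 -> a < b ->
  (forall t, a < t < b -> f1 t < 0) -> f b < f a.
Proof.
move=> df ab f0; rewrite -ltrN2; apply: (is_deriv_gt0_lt (is_deriv_opp df) ab).
by move=> t /f0; rewrite oppr_gt0.
Qed.

Lemma is_deriv_reflect f f1 : is_deriv f f1 ->
  is_deriv (fun t => f (- t)) (fun t => - f1 (- t)).
Proof. by move=> df t; der; ring. Qed.

Lemma is_deriv_ext f g f1 g1 : (forall t, f t = g t) -> (forall t, f1 t = g1 t) ->
  is_deriv f f1 -> is_deriv g g1.
Proof. by move=> /funext -> /funext ->. Qed.

Lemma is_deriv0_cst f f1 a b : is_deriv f f1 -> (forall t, f1 t = 0) -> f a = f b.
Proof.
move=> df f0; wlog ab : a b / a <= b.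
  by move=> h; have [/h//|/ltW/h] := leP a b.
apply/eqP; rewrite eq_le (is_deriv_ge0_le df)//=; last by move=> t _; rewrite f0.
by rewrite (is_deriv_le0_le df)// => t _; rewrite f0.
Qed.

Lemma continuous_bounded_itv f a b : continuous f ->
  exists2 M : R, 0 < M & forall t, a <= t <= b -> `|f t| <= M.
Proof.
move=> cf; have [ab|ba] := leP a b; last first.
  by exists 1 => // t /andP[h1 h2]; have := le_trans h1 h2; rewrite leNgt ba.
have cn : {within `[a, b], continuous (fun t => `|f t|)}.
  apply: continuous_subspaceT => t; apply: continuous_comp; first exact: cf.
  exact: norm_continuous.
have [c _ hc] := EVT_max ab cn.
exists (`|f c| + 1); first by rewrite ltr_wpDl.
move=> t tab; rewrite (le_trans (hc t _)) ?in_itv// lerDl ler01 //.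
Qed.

Lemma continuous_pos_lower f a b : continuous f -> a <= b ->
  (forall t, a <= t <= b -> 0 < f t) ->
  exists2 m : R, 0 < m & forall t, a <= t <= b -> m <= f t.
Proof.
move=> cf ab f0.
have [c cab hc] := EVT_min ab (continuous_subspaceT cf : {within `[a, b], continuous f}).
exists (f c); first by apply: f0; move: cab; rewrite in_itv.
by move=> t tab; apply: hc; rewrite in_itv.
Qed.

End Monotonicity.

(** * Entire solutions of second-order linear equations *)

Section PowerSeries.
Context {R : realType}.
Implicit Types (c : nat -> R) (Q : {poly R}).

(** Infinite radius of convergence in the form of Cauchy estimates: a bound at a doubled radius
    gives geometric decay with ratio 1/2. *)
Definition entire c := forall r : R, 0 < r ->
  exists C, forall n, `|c n| * r ^+ n <= C.

Lemma entire_cvg c x : entire c -> cvgn (pseries c x).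
Proof.
move=> hc; have r0 : 0 < 2 * (`|x| + 1) by rewrite mulr_gt0// ltr_wpDl.
have [C hC] := hc _ r0.
apply: normed_cvg; apply: (@series_le_cvg _ _ (geometric C 2^-1)) => //=.
- move=> n; rewrite mulr_ge0 ?exprn_ge0 ?invr_ge0//.
  by rewrite (le_trans _ (hC 0%N))// mulr_ge0.
- move=> n; rewrite normrM normrX exprVn ler_pdivlMr ?exprn_gt0//.
  rewrite (le_trans _ (hC n))// -mulrA ler_wpM2l// -exprMn lerXn2r ?nnegrE//.
  by rewrite mulrC ler_wpM2l// lerDl.
- apply: is_cvg_geometric_series.
  by rewrite ger0_norm ?invr_ge0// invf_lt1// ltr1n.
Qed.

Lemma entire_diffs c : entire c -> entire (pseries_diffs c).
Proof.
move=> hc r r0; have r20 : 0 < 2 * r by rewrite mulr_gt0.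
have [C hC] := hc _ r20; exists (C / r) => n.
rewrite ler_pdivlMr// (le_trans _ (hC n.+1))// /pseries_diffs.
rewrite normrM normr_nat [leLHS](_ : _ = `|c n.+1| * (n.+1%:R * r ^+ n.+1)); last first.
  by rewrite exprS; ring.
(* The factor [n + 1] of differentiation is absorbed by the doubled radius, since it is at most
   [2 ^ (n + 1)]. *)
rewrite ler_wpM2l// exprMn ler_wpM2r ?exprn_ge0 ?ltW//.
by rewrite -natrX ltr_nat ltn_expl.
Qed.

Lemma entire_derive c : entire c ->
  is_deriv (fun x => limn (pseries c x)) (fun x => limn (pseries (pseries_diffs c) x)).
Proof.
move=> hc x; apply: (@pseries_snd_diffs _ _ (`|x| + 1)).
- exact: entire_cvg.
- exact/entire_cvg/entire_diffs.
- exact/entire_cvg/entire_diffs/entire_diffs.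
- by rewrite [ltRHS]ger0_norm ?ltrDl// addr_ge0.
Qed.

Lemma pseries_lim0 c : limn (pseries c 0) = c 0%N.
Proof.
apply: cvg_lim => //; rewrite -cvg_shiftS.
apply: cvg_near_cst; near=> n; rewrite /pseries /series /= big_nat_recl//=.
by rewrite expr0 mulr1 big1 ?addr0// => i _; rewrite exprS mul0r mulr0.
Unshelve. all: by end_near. Qed.

Lemma pseries_limD c1 c2 x : entire c1 -> entire c2 ->
  limn (pseries (fun n => c1 n + c2 n) x) = limn (pseries c1 x) + limn (pseries c2 x).
Proof.
move=> h1 h2; rewrite -lim_seriesD; [|exact: entire_cvg|exact: entire_cvg].
congr (limn (series _)); apply/funext => n /=; rewrite fctE; ring.
Qed.

Lemma pseries_limZ k c x : entire c ->
  limn (pseries (fun n => k * c n) x) = k * limn (pseries c x).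
Proof.
move=> h1; rewrite -[RHS]/(k *: _) -lim_seriesZ; last exact: entire_cvg.
congr (limn (series _)); apply/funext => n /=; rewrite fctE /GRing.scale /=; ring.
Qed.

Definition shift c n := if n is m.+1 then c m else 0.

Lemma pseries_lim_shift c x : entire c ->
  limn (pseries (shift c) x) = x * limn (pseries c x).
Proof.
move=> h; apply: cvg_lim => //; rewrite -cvg_shiftS.
rewrite (_ : [sequence _]_n = (fun n => x * pseries c x n)); last first.
  apply/funext => n /=; rewrite /pseries /series /= big_nat_recl//= mul0r add0r.
  by rewrite mulr_sumr; apply: eq_bigr => i _; rewrite exprS; ring.
by apply: cvgMr; exact: entire_cvg.
Qed.

(** Coefficients of the product of [Q] with the series of [c]. Horner's scheme reduces every
    statement about it to shifts, multiples and sums. *)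
Definition poly_conv Q c n := \sum_(j < n.+1) Q`_j * c (n - j)%N.

Lemma poly_convMXD Q q c n :
  poly_conv (Q * 'X + q%:P) c n = shift (poly_conv Q c) n + q * c n.
Proof.
rewrite /poly_conv big_ord_recl /= coefD coefMX coefC /= add0r subn0 addrC.
congr (_ + _); case: n => [|n] /=; first by rewrite big_ord0.
apply: eq_bigr => i _.
by rewrite /bump /= add1n coefD coefMX coefC /= addr0 subSS.
Qed.

Lemma entireD c1 c2 : entire c1 -> entire c2 -> entire (fun n => c1 n + c2 n).
Proof.
move=> h1 h2 r r0; have [C1 hC1] := h1 r r0; have [C2 hC2] := h2 r r0.
exists (C1 + C2) => n; rewrite (le_trans _ (lerD (hC1 n) (hC2 n)))//.
by rewrite -mulrDl ler_wpM2r ?ler_normD// exprn_ge0// ltW.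
Qed.

Lemma entireZ k c : entire c -> entire (fun n => k * c n).
Proof.
move=> h1 r r0; have [C1 hC1] := h1 r r0.
by exists (`|k| * C1) => n; rewrite normrM -mulrA ler_wpM2l.
Qed.

Lemma entire_shift c : entire c -> entire (shift c).
Proof.
move=> h1 r r0; have [C1 hC1] := h1 r r0.
have C0 : 0 <= C1 by rewrite (le_trans _ (hC1 0%N))// mulr_ge0 ?expr0.
exists (r * C1) => -[|n] /=; first by rewrite normr0 mul0r mulr_ge0// ltW.
by rewrite exprS mulrCA ler_wpM2l// ltW.
Qed.

Lemma entire_conv Q c : entire c -> entire (poly_conv Q c).
Proof.
move=> h; elim/poly_ind: Q => [|Q q IH].
  by move=> r r0; exists 0 => n; rewrite /poly_conv big1 ?normr0 ?mul0r// => i _; rewrite coef0 mul0r.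
rewrite (_ : poly_conv _ c = (fun n => shift (poly_conv Q c) n + q * c n)).
  apply: entireD; [exact: entire_shift|exact: entireZ].
by apply/funext => n; exact: poly_convMXD.
Qed.

Lemma pseries_lim_conv Q c x : entire c ->
  limn (pseries (poly_conv Q c) x) = Q.[x] * limn (pseries c x).
Proof.
move=> h; elim/poly_ind: Q => [|Q q IH].
  rewrite horner0 mul0r (_ : poly_conv 0 c = (fun n => 0 * c n)) ?pseries_limZ ?mul0r//.
  by apply/funext => n; rewrite mul0r /poly_conv big1// => i _; rewrite coef0 mul0r.
rewrite (_ : poly_conv _ c = (fun n => shift (poly_conv Q c) n + q * c n)); last first.
  by apply/funext => n; exact: poly_convMXD.
rewrite pseries_limD; [|exact/entire_shift/entire_conv|exact: entireZ].
rewrite pseries_lim_shift; last exact: entire_conv.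
by rewrite pseries_limZ// IH hornerMXaddC; ring.
Qed.

(** The recurrence for [y'' = Q y] looks back at many coefficients, so stage [n] builds the whole
    list of those of index 0 to [n + 1]. *)
Fixpoint ivp_seq Q (a b : R) n : seq R :=
  if n is m.+1 then
    let s := ivp_seq Q a b m in
    rcons s (poly_conv Q (nth 0 s) m / (m.+1%:R * m.+2%:R))
  else [:: a; b].

Definition ivp_coef Q a b n := (ivp_seq Q a b n)`_n.

Lemma size_ivp_seq Q a b n : size (ivp_seq Q a b n) = n.+2.
Proof. by elim: n => //= n IH; rewrite size_rcons IH. Qed.

Lemma ivp_seqE Q a b m n : (n <= m.+1)%N -> (ivp_seq Q a b m)`_n = ivp_coef Q a b n.
Proof.
elim: m => [|m IH]; first by case: n => [|[|]].
rewrite leq_eqVlt => /predU1P[->|]; last first.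
  by rewrite ltnS => nm; rewrite /= nth_rcons size_ivp_seq ltnS nm IH.
by rewrite /ivp_coef /= !nth_rcons ?size_rcons !size_ivp_seq ltnSn eqxx ltnn.
Qed.

Lemma ivp_coefSS Q a b n : (n.+1%:R * n.+2%:R) * ivp_coef Q a b n.+2 =
  poly_conv Q (ivp_coef Q a b) n.
Proof.
rewrite -(@ivp_seqE _ _ _ n.+1)//= nth_rcons size_ivp_seq ltnn eqxx.
rewrite mulrC divfK ?mulf_neq0 ?pnatr_eq0//.
by apply: eq_bigr => i _; rewrite ivp_seqE// (leq_trans (leq_subr _ _)).
Qed.

(** With [K] the sum of the [|Q_j| r^(j+2)], the recurrence bounds [(n+1)(n+2) |c_(n+2)| r^(n+2)] by
    [K] times the largest earlier [|c_m| r^m]. Once [(n+1)(n+2)] exceeds [K] no new maximum can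
    occur, so the first [N + 2] terms bound all the others. *)
Lemma entire_ivp_coef Q a b : entire (ivp_coef Q a b).
Proof.
move=> r r0; set c := ivp_coef Q a b.
pose K := \sum_(j < size Q) `|Q`_j| * r ^+ j.+2.
have K0 : 0 <= K by apply: sumr_ge0 => i _; rewrite mulr_ge0// exprn_ge0// ltW.
have convK n D : 0 <= D -> (forall m, (m <= n)%N -> `|c m| * r ^+ m <= D) ->
    `|poly_conv Q c n| * r ^+ n.+2 <= K * D.
  move=> D0 hD; have Kn : \sum_(j < n.+1) `|Q`_j| * r ^+ j.+2 <= K.
    have [nQ|Qn] := leqP n.+1 (size Q).
      rewrite /K (big_ord_widen _ (fun j => `|Q`_j| * r ^+ j.+2) nQ) [leRHS](bigID (fun i : 'I__ => (i < n.+1)%N)) /=.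
      by rewrite lerDl; apply: sumr_ge0 => i _; rewrite mulr_ge0// exprn_ge0// ltW.
    rewrite /K [leRHS](big_ord_widen _ (fun j => `|Q`_j| * r ^+ j.+2) (ltnW Qn)) [leLHS](bigID (fun i : 'I__ => (i < size Q)%N)) /=.
    rewrite [X in _ + X]big1 ?addr0// => i; rewrite -leqNgt => iQ.
    by rewrite nth_default// normr0 mul0r.
  apply: le_trans (ler_wpM2r D0 Kn); rewrite mulr_suml.
  apply: le_trans (ler_wpM2r _ (ler_norm_sum _ _ _)) _; first by rewrite exprn_ge0// ltW.
  rewrite mulr_suml; apply: ler_sum => i _.
  rewrite normrM -[leLHS]mulrA -[leRHS]mulrA ler_wpM2l//.
  have -> : r ^+ n.+2 = r ^+ (n - i) * r ^+ i.+2.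
    by rewrite -exprD; congr (r ^+ _); have := ltn_ord i; lia.
  set rp := r ^+ i.+2.
  by rewrite mulrA [leRHS]mulrC ler_wpM2r ?hD ?leq_subr// exprn_ge0// ltW//.
pose N := (Num.truncn K).+1.
pose D := \sum_(j < N.+2) `|c j| * r ^+ j.
exists D; elim/ltn_ind => n IH.
have D0 : 0 <= D by apply: sumr_ge0 => i _; rewrite mulr_ge0// exprn_ge0// ltW.
have [nN|Nn] := ltnP n N.+2.
  rewrite /D (bigD1 (Ordinal nN)) //= lerDl; apply: sumr_ge0 => i _.
  by rewrite mulr_ge0// exprn_ge0// ltW.
case: n Nn IH => [//|[//|n]] Nn IH.
have n0 : 0 < n.+1%:R * n.+2%:R :> R by rewrite mulr_gt0.
rewrite -(ler_pM2l n0) mulrA -[X in X * `|_|]ger0_norm ?(ltW n0)// -normrM.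
rewrite ivp_coefSS (le_trans (convK _ _ D0 _))//.
  by move=> m mn; apply: IH; lia.
rewrite ler_wpM2r// (@le_trans _ _ N%:R)//.
  by rewrite ltW// /N truncnS_gt.
rewrite -natrM ler_nat; nia.
Qed.

(* Locked: comparing two solutions up to conversion would unfold the series. *)
Fact ivp_key : unit. Proof. exact: tt. Qed.
Definition ivp := locked_with ivp_key
  (fun Q a b x => limn (pseries (ivp_coef Q a b) x)).
Definition ivp' := locked_with ivp_key
  (fun Q a b x => limn (pseries (pseries_diffs (ivp_coef Q a b)) x)).

Lemma ivpE : ivp = fun Q a b x => limn (pseries (ivp_coef Q a b) x).
Proof. by rewrite /ivp unlock. Qed.

Lemma ivp'E : ivp' = fun Q a b x => limn (pseries (pseries_diffs (ivp_coef Q a b)) x).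
Proof. by rewrite /ivp' unlock. Qed.

Lemma ivp0 Q a b : ivp Q a b 0 = a.
Proof. by rewrite ivpE pseries_lim0. Qed.

Lemma ivp'0 Q a b : ivp' Q a b 0 = b.
Proof. by rewrite ivp'E pseries_lim0 /pseries_diffs mul1r. Qed.

Lemma ivp_deriv Q a b : is_deriv (ivp Q a b) (ivp' Q a b).
Proof. by rewrite ivpE ivp'E; exact/entire_derive/entire_ivp_coef. Qed.

Lemma ivp'_deriv Q a b : is_deriv (ivp' Q a b) (fun x => Q.[x] * ivp Q a b x).
Proof.
rewrite ivpE ivp'E.
have := entire_derive (entire_diffs (entire_ivp_coef Q a b)).
apply: is_deriv_ext => // x; rewrite -pseries_lim_conv; last exact: entire_ivp_coef.
congr (limn (series _)); apply/funext => n; congr (_ * _).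
by rewrite -ivp_coefSS /pseries_diffs mulrA.
Qed.

End PowerSeries.

(** * Comparison and oscillation *)

Section SecondOrder.
Context {R : realType}.
Implicit Types (Q f y z v : R -> R) (a b c d e t M : R).

Definition solves Q y y1 := is_deriv y y1 /\ is_deriv y1 (fun t => Q t * y t).

Lemma solves_reflect Q y y1 : solves Q y y1 ->
  solves (fun t => Q (- t)) (fun t => y (- t)) (fun t => - y1 (- t)).
Proof.
move=> [dy dy1]; split; first exact: is_deriv_reflect.
by move=> t; der; ring.
Qed.

Lemma wronskian_deriv Q1 Q2 y y1 z z1 : solves Q1 y y1 -> solves Q2 z z1 ->
  is_deriv (fun t => y t * z1 t - z t * y1 t) (fun t => (Q2 t - Q1 t) * (y t * z t)).
Proof. by move=> [dy dy1] [dz dz1] t; der; ring. Qed.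

(** The energy [z^2 + z1^2] has derivative at most [(M + 2)] times itself plus [d^2]: the three
    parts of [M + 2] pay for [2 z z1], [2 z1 Q z] and [2 z1 f]. The source [f] is there for
    differences of solutions with different parameters. *)
Lemma gronwall z z1 Q f a b M d : is_deriv z z1 ->
  is_deriv z1 (fun t => Q t * z t + f t) ->
  (forall t, a <= t <= b -> `|Q t| <= M /\ `|f t| <= d) ->
  forall t, a <= t <= b ->
  z t ^+ 2 + z1 t ^+ 2 <= (z a ^+ 2 + z1 a ^+ 2 + d ^+ 2 * (t - a)) * expR ((M + 2) * (t - a)).
Proof.
move=> dz dz1 hQf t /andP[at_ tb].
pose h x := (z x ^+ 2 + z1 x ^+ 2) * expR (- (M + 2) * (x - a)) - d ^+ 2 * (x - a).
pose h1 x := (2 * z x * z1 x + 2 * z1 x * (Q x * z x + f x) - (M + 2) * (z x ^+ 2 + z1 x ^+ 2))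
  * expR (- (M + 2) * (x - a)) - d ^+ 2.
have dh : is_deriv h h1 by move=> x; rewrite /h; der; rewrite /h1 /=; ring.
have : h t <= h a.
  apply: (is_deriv_le0_le dh at_) => x /andP[ax xt].
  have xab : a <= x <= b by rewrite (ltW ax) (le_trans (ltW xt)).
  have [hQ hf] := hQf _ xab.
  have M0 : 0 <= M by rewrite (le_trans _ hQ).
  have d0 : 0 <= d by rewrite (le_trans _ hf).
  have f2 : f x ^+ 2 <= d ^+ 2 by rewrite -(real_normK (num_real (f x))) lerXn2r ?nnegrE.
  have Qz : 2 * z1 x * (Q x * z x) <= M * (z x ^+ 2 + z1 x ^+ 2).
    have : 2 * z1 x * (Q x * z x) <= `|Q x| * (z x ^+ 2 + z1 x ^+ 2).
      have [q0|q0] := ger0P (Q x).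
        have := mulr_ge0 q0 (sqr_ge0 (z x - z1 x)); rewrite sqrrB; lra.
      have := mulr_ge0 (ltW (_ : 0 < - Q x)) (sqr_ge0 (z x + z1 x)); rewrite sqrrD oppr_gt0 => /(_ q0); lra.
    move/le_trans; apply; rewrite ler_wpM2r// addr_ge0 ?sqr_ge0//.
  have E1 : expR (- (M + 2) * (x - a)) <= 1.
    by rewrite -expR0 ler_expR mulNr oppr_le0 mulr_ge0 ?subr_ge0 ?addr_ge0// ltW.
  have E0 := expR_ge0 (- (M + 2) * (x - a)).
  have key : 2 * z x * z1 x + 2 * z1 x * (Q x * z x + f x) - (M + 2) * (z x ^+ 2 + z1 x ^+ 2) <= d ^+ 2.
    have := sqr_ge0 (z x - z1 x); have := sqr_ge0 (z1 x - f x); rewrite !sqrrB.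
    have := sqr_ge0 (z x); lra.
  rewrite /h1 subr_le0 (le_trans (ler_wpM2r E0 key))//.
  by rewrite ler_piMr ?sqr_ge0.
rewrite /h subrr !mulr0 expR0 mulr1 subr0 lerBlDr mulNr expRN.
by rewrite ler_pdivrMr ?expR_gt0// mulrC.
Qed.

Lemma solves_zero_right Q y y1 a : continuous Q -> solves Q y y1 ->
  y a = 0 -> y1 a = 0 -> forall t, a <= t -> y t = 0.
Proof.
move=> cQ [dy dy1] ya y1a t at_.
have [M M0 hM] := continuous_bounded_itv a t cQ.
have dy1' : is_deriv y1 (fun t => Q t * y t + 0) by move=> x; der; ring.
have := @gronwall y y1 Q (fun=> 0) a t M 0 dy dy1' _ t.
rewrite ya y1a normr0 !expr0n /= mul0r !addr0 mul0r => H.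
have : y t ^+ 2 + y1 t ^+ 2 <= 0.
  by apply: H; rewrite ?at_ ?lexx// => x /hM ->.
have := sqr_ge0 (y t); have := sqr_ge0 (y1 t) => h1 h2 h3.
by apply/eqP; rewrite -sqrf_eq0 eq_le h2 andbT; lra.
Qed.

Lemma solves_zero Q y y1 a : continuous Q -> solves Q y y1 ->
  y a = 0 -> y1 a = 0 -> forall t, y t = 0.
Proof.
move=> cQ sy ya y1a t; have [at_|/ltW ta] := leP a t.
  exact: (solves_zero_right cQ sy ya y1a).
rewrite -[t]opprK; apply: (@solves_zero_right (fun t => Q (- t)) (fun t => y (- t)) (fun t => - y1 (- t)) (- a)).
- by move=> x; apply: continuous_comp; [exact: oppr_continuous|exact: cQ].
- exact: solves_reflect.
- by rewrite opprK.
- by rewrite opprK y1a oppr0.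
- by rewrite lerN2.
Qed.

Lemma solvesB Q y y1 z z1 : solves Q y y1 -> solves Q z z1 ->
  solves Q (fun t => y t - z t) (fun t => y1 t - z1 t).
Proof. by move=> [dy dy1] [dz dz1]; split=> t; der; ring. Qed.

Lemma solves_ext Q Q' y y1 : (forall t, Q t = Q' t) -> solves Q y y1 -> solves Q' y y1.
Proof. by move=> /funext ->. Qed.

Lemma solves_unique Q y y1 z z1 a : continuous Q -> solves Q y y1 -> solves Q z z1 ->
  y a = z a -> y1 a = z1 a -> forall t, y t = z t /\ y1 t = z1 t.
Proof.
move=> cQ sy sz ya y1a.
have H := solves_zero cQ (solvesB sy sz) (a := a); move: H.
rewrite ya y1a !subrr => /(_ erefl erefl) H.
have yz : y = z by apply/funext => t; apply/eqP; rewrite -subr_eq0 H.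
move=> t; split; first by rewrite yz.
have [d1 _] := sy; have [d2 _] := sz; move: (d1 t) (d2 t); rewrite yz.
by move=> [_ <-] [_ <-].
Qed.

Lemma near_left_increasing y y1 a : is_deriv y y1 -> continuous y1 ->
  0 < y1 a -> exists2 e : R, 0 < e & forall t, a - e < t < a -> y t < y a.
Proof.
move=> dy cy1 y1a.
have /cvgrPdist_lt /(_ _ y1a) := cy1 a.
rewrite near_simpl -nbhs_nearE => /nbhs_ballP[e /= e0 he].
exists e => // t /andP[et ta].
apply: (is_deriv_gt0_lt dy ta) => x /andP[tx xa].
have : ball a e x.
  by rewrite /ball /= gtr0_norm ?subr_gt0// ltrBlDr -ltrBlDl (lt_trans et).
move=> /he /=; have := ler_norm (y1 a - y1 x); lra.
Qed.

Lemma near_right_increasing y y1 a : is_deriv y y1 -> continuous y1 ->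
  0 < y1 a -> exists2 e : R, 0 < e & forall t, a < t < a + e -> y a < y t.
Proof.
move=> dy cy1 y1a.
have d2 : is_deriv (fun t => - y (- t)) (fun t => y1 (- t)).
  by move=> t; der; ring.
have c2 : continuous (fun t => y1 (- t)).
  by move=> x; apply: continuous_comp; [exact: oppr_continuous|exact: cy1].
have := near_left_increasing (a := - a) d2 c2; rewrite !opprK => /(_ y1a)[e e0 he].
exists e => // t /andP[h1 h2].
by have := he (- t) ltac:(lra); rewrite opprK; lra.
Qed.

(* A nonnegative solution has a double zero wherever it vanishes. *)
Lemma solves_ge0_gt0 Q y y1 a : continuous Q -> solves Q y y1 ->
  (forall t, 0 <= y t) -> 0 < y a -> forall t, 0 < y t.
Proof.
move=> cQ sy y0 ya t; rewrite lt_def y0 andbT; apply/negP => /eqP yt.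
have [dy dy1] := sy; have cy1 := is_deriv_continuous dy1.
have y1t : y1 t = 0.
  apply/eqP; rewrite eq_le !leNgt; apply/andP; split; apply/negP => h.
    have [e e0 /(_ (t - e / 2))] := near_left_increasing dy cy1 h.
    rewrite yt; have := y0 (t - e / 2); lra.
  have dN := is_deriv_opp dy.
  have cN : continuous (fun t => - y1 t) by move=> x; apply: cvgN; exact: cy1.
  have hN : 0 < - y1 t by lra.
  have [e e0 /(_ (t + e / 2))] := near_right_increasing dN cN hN.
  rewrite yt; have := y0 (t + e / 2); lra.
by move: ya; rewrite (solves_zero cQ sy yt y1t a) ltxx.
Qed.

Lemma product_deriv Q y y1 : solves Q y y1 ->
  is_deriv (fun t => y t * y1 t) (fun t => y1 t ^+ 2 + Q t * y t ^+ 2).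
Proof. by move=> [dy dy1] t; der; ring. Qed.

Lemma square_deriv y y1 : is_deriv y y1 -> is_deriv (fun t => y t ^+ 2) (fun t => 2 * (y t * y1 t)).
Proof. by move=> dy t; der; rewrite /=; ring. Qed.

(** Where [Q >= 0] the product [y y1] is nondecreasing, so it stays positive and [y] cannot reach
    0. *)
Lemma growing_solution Q y y1 a : solves Q y y1 -> (forall t, a <= t -> 0 <= Q t) ->
  0 < y a -> 0 < y1 a -> forall t, a <= t -> 0 < y t /\ 0 < y1 t.
Proof.
move=> sy Q0 ya y1a; have [dy dy1] := sy.
have yy1 t : a <= t -> 0 < y t * y1 t.
  move=> at_; apply: (@lt_le_trans _ _ (y a * y1 a)); first exact: mulr_gt0.
  apply: (is_deriv_ge0_le (product_deriv sy) at_) => x /andP[ax _].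
  apply: addr_ge0; first exact: sqr_ge0.
  by apply: mulr_ge0; [exact/Q0/ltW|exact: sqr_ge0].
suff ypos t : a <= t -> 0 < y t.
  by move=> t at_; have := yy1 _ at_; rewrite pmulr_rgt0 ?ypos.
move=> at_; rewrite ltNge; apply/negP => yt.
have := IVT at_ (is_deriv_within dy) (v := 0).
case.
  by rewrite ge_min le_max yt (ltW ya) orbT.
move=> c; rewrite in_itv /= => /andP[ac _] yc.
by have := yy1 _ ac; rewrite yc mul0r ltxx.
Qed.

(** The function [(y1 + c y) exp (- c t)] is nondecreasing. A positive value at [t0] would make
    [y1 + c y] grow exponentially, whereas it is at most [c y t0]. *)
Lemma decaying_slope Q y y1 a c : 0 < c -> solves Q y y1 ->
  (forall t, a <= t -> [/\ c ^+ 2 <= Q t, 0 <= y t & y1 t <= 0]) ->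
  forall t, a <= t -> y1 t + c * y t <= 0.
Proof.
move=> c0 [dy dy1] H t0 at0; rewrite leNgt; apply/negP => h0.
have ydec t : t0 <= t -> y t <= y t0.
  move=> tt; apply: (is_deriv_le0_le dy tt) => x /andP[t0x _].
  by have [] := H x (le_trans at0 (ltW t0x)).
pose h t := (y1 t + c * y t) * expR (- c * (t - t0)).
have dh : is_deriv h (fun t => (Q t - c ^+ 2) * y t * expR (- c * (t - t0))).
  by move=> t; rewrite /h; der; ring.
set d := y1 t0 + c * y t0 in h0.
have hd t : t0 <= t -> d * expR (c * (t - t0)) <= y1 t + c * y t.
  move=> tt; have : h t0 <= h t.
    apply: (is_deriv_ge0_le dh tt) => x /andP[t0x _].
    have [h1 h2 h3] := H x (le_trans at0 (ltW t0x)).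
    by rewrite !mulr_ge0 ?expR_ge0 ?subr_ge0.
  by rewrite /h subrr mulr0 expR0 mulr1 mulNr expRN ler_pdivlMr ?expR_gt0.
have [h1 h2 h3] := H t0 at0.
(* Chosen so that [d (1 + c (t - t0))], a lower bound for the exponential growth, equals
   [d + c y t0]. *)
pose t := t0 + y t0 / d.
have tt : t0 <= t by rewrite lerDl divr_ge0// ltW.
have := hd _ tt; rewrite leNgt => /negP; apply.
have [_ _ h4] := H t (le_trans at0 tt).
apply: (@le_lt_trans _ _ (c * y t0)).
  by rewrite -[leRHS]add0r lerD// ler_wpM2l ?ydec// ltW.
apply: (@lt_le_trans _ _ (d * (1 + c * (t - t0)))).
  have -> : d * (1 + c * (t - t0)) = d + c * y t0 by rewrite /t; field; rewrite gt_eqF.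
  by rewrite ltrDr.
by rewrite ler_wpM2l ?expR_ge1Dx// ltW.
Qed.

Lemma decaying_bound Q y y1 a c : 0 < c -> solves Q y y1 ->
  (forall t, a <= t -> [/\ c ^+ 2 <= Q t, 0 <= y t & y1 t <= 0]) ->
  forall t, a <= t -> y t <= y a * expR (- c * (t - a)).
Proof.
move=> c0 sy H t at_; have [dy dy1] := sy.
pose h t := y t * expR (c * (t - a)).
have dh : is_deriv h (fun t => (y1 t + c * y t) * expR (c * (t - a))).
  by move=> x; rewrite /h; der; ring.
have : h t <= h a.
  apply: (is_deriv_le0_le dh at_) => x /andP[ax _].
  by rewrite mulr_le0_ge0 ?expR_ge0// (decaying_slope c0 sy H)// ltW.
by rewrite /h subrr mulr0 expR0 mulr1 mulNr expRN ler_pdivlMr ?expR_gt0.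
Qed.

(** By convexity the slope at [t] is at least the mean slope over [[t - 1, t]], which is at least
    [- y (t - 1)]. *)
Lemma decaying_deriv_bound Q y y1 a : solves Q y y1 ->
  (forall t, a <= t -> [/\ 0 <= Q t, 0 <= y t & y1 t <= 0]) ->
  forall t, a + 1 <= t -> `|y1 t| <= y (t - 1).
Proof.
move=> [dy dy1] H t at_.
have t1 : t - 1 < t by lra.
have [c /andP[c1 c2]] := mean_value dy t1.
have -> : t - (t - 1) = 1 by ring.
rewrite mulr1 => yc.
have y1ct : y1 c <= y1 t.
  apply: (is_deriv_ge0_le dy1 (ltW c2)) => x /andP[cx _].
  have ax : a <= x by lra.
  by have [h1 h2 _] := H _ ax; rewrite mulr_ge0.
have ax : a <= t by lra.
have [h1 h2 h3] := H _ ax; rewrite ler0_norm//; lra.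
Qed.

Lemma decaying_to0 Q y y1 a : solves Q y y1 ->
  (forall t, a <= t -> [/\ 1 <= Q t, 0 <= y t & y1 t <= 0]) ->
  forall e, 0 < e -> exists2 b : R, a <= b & forall t, b <= t -> y t <= e /\ `|y1 t| <= e.
Proof.
move=> sy H e e0.
have H1 t : a <= t -> [/\ 1 ^+ 2 <= Q t, 0 <= y t & y1 t <= 0].
  by rewrite expr1n; exact: H.
have H0 t : a <= t -> [/\ 0 <= Q t, 0 <= y t & y1 t <= 0].
  by move=> /H[h1 h2 h3]; split => //; rewrite (le_trans _ h1).
have ya0 : 0 <= y a by have [] := H a (lexx _).
have small t : a + y a / e <= t -> y t <= e.
  move=> tt; have at_ : a <= t by rewrite (le_trans _ tt)// lerDl divr_ge0// ltW.
  apply: le_trans (decaying_bound ltr01 sy H1 at_) _.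
  rewrite mulN1r expRN ler_pdivrMr ?expR_gt0//.
  apply: (@le_trans _ _ (e * (1 + (t - a)))); last by rewrite ler_wpM2l ?expR_ge1Dx// ltW.
  have : y a / e <= 1 + (t - a) by lra.
  by rewrite ler_pdivrMr// mulrC.
have q0 : 0 <= y a / e by rewrite divr_ge0// ltW.
exists (a + y a / e + 1); first by lra.
move=> t tt; split; first by apply: small; lra.
apply: le_trans (decaying_deriv_bound sy H0 _) _; first lra.
by apply: small; lra.
Qed.

(** A Wronskian comparison with [phi t = exp (c (a + 1 - t)) - 1], which vanishes at [a + 1]:
    [W = y1 phi - y phi'] is nonincreasing and ends at [c y (a + 1) >= 0]. At [a] this gives
    [- y1 <= c e^c / (e^c - 1) y], and [c <= e^c - 1] turns the factor into [c + 1]. *)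
Lemma harnack Q y y1 a c : 0 < c -> solves Q y y1 ->
  (forall t, a <= t <= a + 1 -> Q t <= c ^+ 2 /\ 0 <= y t) ->
  - y1 a <= (c + 1) * y a.
Proof.
move=> c0 [dy dy1] H.
pose E t := expR (c * (a + 1 - t)).
pose W t := y1 t * (E t - 1) + y t * (c * E t).
have dE : is_deriv E (fun t => - c * E t) by move=> t; rewrite /E; der; ring.
have dW : is_deriv W (fun t => y t * (Q t * (E t - 1) - c ^+ 2 * E t)).
  by move=> t; rewrite /W; der; ring.
have a1 : a <= a + 1 by lra.
have : W (a + 1) <= W a.
  apply: (is_deriv_le0_le dW a1) => t /andP[at_ ta].
  have tab : a <= t <= a + 1 by rewrite !ltW.
  have [h1 h2] := H t tab.
  have E1 : 0 <= E t - 1.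
    by rewrite subr_ge0 -expR0 ler_expR mulr_ge0 ?ltW// subr_gt0.
  rewrite mulr_ge0_le0//; have := ler_wpM2r E1 h1; have := sqr_ge0 c; nra.
rewrite {1}/W {1 2}/E subrr mulr0 expR0 subrr mulr0 add0r mulr1.
have aa : a <= a + 1 <= a + 1 by rewrite a1 lexx.
have [_ h2] := H _ aa.
move=> h3.
have : 0 <= W a by rewrite (le_trans _ h3)// mulr_ge0// ltW.
rewrite /W; set e := E a.
have ec : c <= e - 1.
  have := expR_ge1Dx c; rewrite /e /E; have -> : c * (a + 1 - a) = c by ring.
  by lra.
have [|_ ya] := H a; first by rewrite lexx.
move=> h4; have e0 : 0 < e - 1 by rewrite (lt_le_trans c0).
rewrite -(ler_pM2r e0); have := ler_wpM2l ya ec; nra.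
Qed.

(* A nonnegative concave function on [[-1, 2]] satisfies [|y1| <= y] on
   [[0, 1]], so [y1] cannot drop by much more than [4 y] across [[0, 1]]. *)
Lemma oscillation_bound Q y y1 c : solves Q y y1 -> 0 <= c ->
  (forall t, -1 <= t <= 2 -> Q t <= - c /\ 0 <= y t) -> 0 < y 0 -> c <= 4.
Proof.
move=> [dy dy1] c0 H y00.
have y1dec s t : -1 <= s -> s <= t -> t <= 2 -> y1 t <= y1 s.
  move=> s1 st t2; apply: (is_deriv_le0_le dy1 st) => x /andP[sx xt].
  have xx : -1 <= x <= 2 by lra.
  have [h1 h2] := H x xx; rewrite mulr_le0_ge0//; lra.
have y1up t : 0 <= t <= 1 -> y1 t <= y t.
  move=> tt; have t1 : t - 1 < t by lra.
  have [x /andP[x1 x2]] := mean_value dy t1.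
  have -> : t - (t - 1) = 1 by ring.
  rewrite mulr1 => e.
  have tt' : -1 <= t - 1 <= 2 by lra.
  have [_ h] := H _ tt'; have := y1dec x t; lra.
have y1lo t : 0 <= t <= 1 -> - y t <= y1 t.
  move=> tt; have t1 : t < t + 1 by lra.
  have [x /andP[x1 x2]] := mean_value dy t1.
  have -> : t + 1 - t = 1 by ring.
  rewrite mulr1 => e.
  have tt' : -1 <= t + 1 <= 2 by lra.
  have [_ h] := H _ tt'; have := y1dec t x; lra.
have [x /andP[x0 x1]] := mean_value dy1 ltr01; rewrite subr0 mulr1 => ex.
have xx : -1 <= x <= 2 by lra.
have xx' : 0 <= x <= 1 by lra.
have [hQ hy] := H x xx.
have ly : y1 1 - y1 0 <= - c * y x by rewrite ex ler_wpM2r.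
have u0 := y1up 0; have l1 := y1lo 1; have ux := y1up _ xx'; have lx := y1lo _ xx'.
have y0x : y 0 <= 2 * y x.
  have [s /andP[s0 s1]] := mean_value dy x0; rewrite subr0 => es.
  have : y1 x <= y1 s by apply: y1dec; lra.
  nra.
have y1x : y 1 <= 2 * y x.
  have [s /andP[s0 s1]] := mean_value dy x1 => es.
  have : y1 s <= y1 x by apply: y1dec; lra.
  nra.
have yx0 : 0 < y x by lra.
rewrite -(ler_pM2r yx0); lra.
Qed.

Lemma first_zero f a b : continuous f -> a <= b -> 0 < f a -> f b <= 0 ->
  exists2 x : R, a < x <= b & f x = 0 /\ forall t, a <= t < x -> 0 < f t.
Proof.
move=> cf ab fa fb.
pose S := [set t | a <= t <= b] `&` [set t | f t <= 0].
have cS : compact S.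
  apply: (@subclosed_compact _ _ `[a, b]); last 2 first.
  - exact: segment_compact.
  - by move=> t [/= h _]; rewrite in_itv.
  apply: closedI.
    have -> : [set t | a <= t <= b] = `[a, b]%classic by apply/seteqP; split => t /=; rewrite in_itv.
    exact: itv_closed.
  exact: (closed_comp (f := f) (D := [set x | x <= 0]) (fun x _ => cf x) (@closed_le _ _)).
have S0 : S !=set0 by exists b; split => //=; rewrite ab lexx.
have [x /set_mem[/= /andP[ax xb] fx] xmin] :=
  compact_EVT_min S0 cS (@continuous_subspaceT _ _ S (fun t : R => t) (fun _ => cvg_id)).
have pos t : a <= t < x -> 0 < f t.
  move=> /andP[at_ tx]; rewrite ltNge; apply/negP => ft.
  have : t \in S by apply/mem_set; split => //=; rewrite at_ (le_trans (ltW tx)).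
  by move=> /xmin; rewrite leNgt tx.
have ax' : a < x.
  rewrite lt_neqAle ax andbT; apply/negP => /eqP axe.
  by move: fa; rewrite axe ltNge fx.
exists x; first by rewrite ax' xb.
split => //; apply/eqP; rewrite eq_le fx /=; rewrite leNgt; apply/negP => fx0.
have := IVT ax (continuous_subspaceT cf : {within `[a, x], continuous f}) (v := f x / 2).
case.
  rewrite ge_min le_max; apply/andP; split; apply/orP; [right|left]; lra.
move=> s; rewrite in_itv /= => /andP[as_ sx] fs.
have sx' : s < x by rewrite lt_neqAle sx andbT; apply/negP => /eqP e; move: fs; rewrite e; lra.
by have := pos s; rewrite as_ sx' fs => /(_ isT); lra.
Qed.

(** Sturm comparison up to infinity. The Wronskian [W] increases while [v > 0]. If [W t0 >= 0], then
    [v1 > 0] at a first zero of [v], which cannot be reached from positive values. Without a zero,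
    [W] stays above a positive constant, although [v] is eventually nonincreasing, so that
    [W <= v |y1|] tends to 0. *)
Lemma sturm_right Q1 Q2 y y1 v v1 t0 a : solves Q1 y y1 -> solves Q2 v v1 ->
  (forall t, Q1 t < Q2 t) -> (forall t, 0 < y t) ->
  (forall e, 0 < e -> exists2 b : R, a <= b & forall t, b <= t -> `|y1 t| <= e) ->
  (forall t, a <= t -> v t * v1 t <= 0) -> 0 < v t0 ->
  y t0 * v1 t0 - v t0 * y1 t0 < 0.
Proof.
move=> sy sv Q12 y0 y1to0 vv1 vt0.
have dW := wronskian_deriv sy sv; set W := (fun t => _) in dW.
have [dv dv1] := sv.
rewrite -/(W t0) ltNge; apply/negP => W0.
have [vpos|] := pselect (forall t, t0 <= t -> 0 < v t); last first.
  move=> /existsNP[b /not_implyP[t0b /negP]]; rewrite -leNgt => vb.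
  have [x /andP[t0x xb] [vx vpos]] := first_zero (is_deriv_continuous dv) t0b vt0 vb.
  have : W t0 < W x.
    apply: (is_deriv_gt0_lt dW t0x) => t /andP[h1 h2].
    by rewrite mulr_gt0 ?subr_gt0 ?mulr_gt0 ?vpos// (ltW h1).
  move=> /(le_lt_trans W0); rewrite /W vx mul0r subr0 pmulr_rgt0// => v1x.
  have [e e0 he] := near_left_increasing dv (is_deriv_continuous dv1) v1x.
  have [xe|xe] := ltP t0 (x - e / 2).
    have := he (x - e / 2); have := vpos (x - e / 2); rewrite vx; lra.
  have := he ((t0 + x) / 2); have := vpos ((t0 + x) / 2); rewrite vx; lra.
have Winc s t : t0 <= s -> s < t -> W s < W t.
  move=> h0 h1; apply: (is_deriv_gt0_lt dW h1) => x /andP[h2 h3].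
  have t0x : t0 <= x by lra.
  by rewrite mulr_gt0 ?subr_gt0 ?mulr_gt0 ?vpos.
have W1 : 0 < W (t0 + 1) by apply: le_lt_trans W0 (Winc _ _ _ _); lra.
pose T := Num.max a (t0 + 1).
have aT : a <= T by rewrite le_max lexx.
have tT : t0 + 1 <= T by rewrite le_max lexx orbT.
have t0T : t0 <= T by lra.
have vT := vpos _ t0T.
have e0 : 0 < W (t0 + 1) / (2 * v T) by rewrite divr_gt0// mulr_gt0.
have [b ab hb] := y1to0 _ e0.
pose t := Num.max b (T + 1).
have bt : b <= t by rewrite le_max lexx.
have Tt : T + 1 <= t by rewrite le_max lexx orbT.
have v1neg x : T <= x -> v1 x <= 0.
  move=> Tx; have x0 : t0 <= x by lra.
  have := vv1 x (le_trans aT Tx); rewrite pmulr_rle0//; exact: vpos.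
have t0t : t0 <= t by lra.
have TT : T <= t by lra.
have vtT : v t <= v T.
  by apply: (is_deriv_le0_le dv TT) => x /andP[h1 h2]; apply: v1neg; exact: ltW.
have Wt : W (t0 + 1) < W t by apply: Winc; lra.
have : W t <= v t * `|y1 t|.
  rewrite /W -[leRHS]add0r lerD//.
    by rewrite mulr_ge0_le0 ?v1neg// ltW.
  by rewrite -mulrN ler_wpM2l ?(ltW (vpos _ t0t))// -normrN ler_norm.
have := hb _ bt => h1.
have h2 : v t * `|y1 t| <= v T * (W (t0 + 1) / (2 * v T)).
  by apply: ler_pM => //; rewrite ltW// vpos.
have h3 : v T * (W (t0 + 1) / (2 * v T)) = W (t0 + 1) / 2.
  by field; rewrite gt_eqF.
rewrite h3 in h2; lra.
Qed.

(* The solution with the larger slope has no room to decay: the Wronskian is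
   a positive constant. *)
Lemma larger_slope_grows Q y y1 z z1 a : solves Q y y1 -> solves Q z z1 ->
  (forall t, a <= t -> 1 <= Q t) -> (forall t, 0 < y t) ->
  (forall t, a <= t -> y1 t <= 0) -> y 0 = 1 -> z 0 = 1 -> y1 0 < z1 0 -> 0 <= a ->
  (forall t, 0 <= t -> 0 < z t) /\ exists2 t : R, a <= t & 0 < z1 t.
Proof.
move=> sy sz Q1 ypos y1neg y01 z01 slope a0.
have [dy dy1] := sy; have [dz dz1] := sz.
have dW := wronskian_deriv sy sz; set W := (fun t => _) in dW.
have WE t : W t = z1 0 - y1 0.
  rewrite (is_deriv0_cst t 0 dW); last by move=> x; rewrite subrr mul0r.
  by rewrite /W y01 z01 !mul1r.
have W0 : 0 < z1 0 - y1 0 by rewrite subr_gt0.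
have zpos t : 0 <= t -> 0 < z t.
  move=> t0.
  have dr : is_deriv (fun t => z t * (y t)^-1) (fun t => W t * (y t) ^- 2).
    move=> x; der; first by rewrite gt_eqF.
    by rewrite /W; field; rewrite gt_eqF.
  have : z 0 * (y 0)^-1 <= z t * (y t)^-1.
    apply: (is_deriv_ge0_le dr t0) => x _.
    by rewrite WE mulr_ge0// ?invr_ge0 ?exprn_ge0// ltW.
  rewrite y01 z01 invr1 mulr1 ler_pdivlMr// mul1r.
  exact: lt_le_trans.
split=> //; apply: contrapT => nz.
have z1neg t : a <= t -> z1 t <= 0.
  by move=> at_; rewrite leNgt; apply/negP => h; apply: nz; exists t.
have Hy t : a <= t -> [/\ 1 <= Q t, 0 <= y t & y1 t <= 0].
  by move=> at_; split; [exact: Q1|exact: ltW|exact: y1neg].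
have Hz t : a <= t -> [/\ 1 <= Q t, 0 <= z t & z1 t <= 0].
  by move=> at_; split; [exact: Q1|apply/ltW/zpos/(le_trans a0)|exact: z1neg].
pose e := Num.min 1 ((z1 0 - y1 0) / 4).
have e0 : 0 < e by rewrite lt_min ltr01 divr_gt0.
have e1 : e <= 1 by rewrite ge_min lexx.
have e2 : e <= (z1 0 - y1 0) / 4 by rewrite ge_min lexx orbT.
have [b ab hb] := decaying_to0 sy Hy e0.
have [b' ab' hb'] := decaying_to0 sz Hz e0.
pose t := Num.max b b'.
have bt : b <= t by rewrite le_max lexx.
have [yt y1t] := hb t bt.
have bt' : b' <= t by rewrite le_max lexx orbT.
have [zt z1t] := hb' t bt'.
have at_ : a <= t by rewrite le_max ab.
have [_ yt0 _] := Hy _ at_; have [_ zt0 _] := Hz _ at_.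
have := WE t; rewrite /W => Wt.
have h1 : `|y t * z1 t| <= 1 * e by rewrite normrM; apply: ler_pM => //; rewrite ger0_norm// (le_trans yt).
have h2 : `|z t * y1 t| <= 1 * e by rewrite normrM; apply: ler_pM => //; rewrite ger0_norm// (le_trans zt).
have := ler_norm (y t * z1 t); have := ler_norm (- (z t * y1 t)); rewrite normrN; lra.
Qed.

End SecondOrder.

(** * Ground states by shooting *)

Section Family.
Context {R : realType} (k : nat).
Implicit Types (a b c d e l s t x A : R).

Definition ramp t : R := t ^+ k.+1 / k.+1%:R.

Definition potential a t : R := (ramp t - a) ^+ 2.

Definition potential_poly a l : {poly R} :=
  (k.+1%:R^-1 *: 'X^(k.+1) - a%:P) ^+ 2 - l%:P.

(* The solution of [y'' = (potential a - l) y] with [y 0 = 1] and [y' 0 = s]. *)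
Definition sol a l s := ivp (potential_poly a l) 1 s.
Definition sol' a l s := ivp' (potential_poly a l) 1 s.

Lemma sol_solves a l s : solves (fun t => potential a t - l) (sol a l s) (sol' a l s).
Proof.
have e t : (potential_poly a l).[t] = potential a t - l.
  by rewrite /potential_poly /potential /ramp !hornerE; congr ((_ - _) ^+ 2 - _); rewrite mulrC.
split; first exact: ivp_deriv.
by apply: is_deriv_ext (@ivp'_deriv _ _ _ _) => // t; rewrite e.
Qed.

Lemma sol0 a l s : sol a l s 0 = 1. Proof. exact: ivp0. Qed.
Lemma sol'0 a l s : sol' a l s 0 = s. Proof. exact: ivp'0. Qed.

Lemma sol_deriv a l s : is_deriv (sol a l s) (sol' a l s).
Proof. by have [] := sol_solves a l s. Qed.

Lemma sol'_deriv a l s : is_deriv (sol' a l s) (fun t => (potential a t - l) * sol a l s t).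
Proof. by have [] := sol_solves a l s. Qed.

Lemma ramp_deriv : is_deriv ramp (fun t => t ^+ k).
Proof. move=> t; rewrite /ramp; der.
by rewrite mulr0 addr0 mulr1 mulrAC divff ?pnatr_eq0// mul1r. Qed.

Lemma ramp_continuous : continuous ramp.
Proof. exact: is_deriv_continuous ramp_deriv. Qed.

Lemma potential_deriv a : is_deriv (potential a) (fun t => 2 * (ramp t - a) * t ^+ k).
Proof. by have := ramp_deriv => dr t; rewrite /potential; der; rewrite /=; ring. Qed.

Lemma potential_sub_continuous a l : continuous (fun t => potential a t - l).
Proof.
have dV := potential_deriv a.
have : is_deriv (fun t => potential a t - l) (fun t => 2 * (ramp t - a) * t ^+ k).
  by move=> t; der; ring.
exact: is_deriv_continuous.
Qed.

Lemma ramp_ge0 t : 0 <= t -> 0 <= ramp t.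
Proof. by move=> t0; rewrite /ramp divr_ge0// exprn_ge0. Qed.

Lemma ramp_le t b : 0 <= t -> t <= b -> ramp t <= ramp b.
Proof.
move=> t0 tb; rewrite /ramp ler_pM2r ?invr_gt0// lerXn2r ?nnegrE//.
exact: le_trans tb.
Qed.

(** For [t >= 1] one has [ramp t >= t / (k + 1)], so the threshold makes [ramp t - a] at least
    [c + 1]. It depends on [a] only through [A], as the compactness arguments require. *)
Lemma potential_large A c : 0 <= A -> 0 <= c -> exists2 x : R, 0 <= x &
  forall a t, `|a| <= A -> x <= t -> c <= potential a t.
Proof.
move=> A0 c0; exists (k.+1%:R * (A + c + 1)).
  by rewrite mulr_ge0// !addr_ge0.
move=> a t aA xt.
have t1 : 1 <= t.
  apply: le_trans xt; rewrite -[leLHS]mulr1; apply: ler_pM => //; first by rewrite ler1n.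
  by rewrite lerDr addr_ge0.
have Tt : A + c + 1 <= ramp t.
  rewrite /ramp ler_pdivlMr// mulrC (le_trans xt)// exprS ler_peMr//.
    exact: le_trans t1.
  exact: exprn_ege1.
have : a <= A by rewrite (le_trans _ aA)// ler_norm.
rewrite /potential; nra.
Qed.

Lemma potential_bound a t b : `|t| <= b -> potential a t <= (ramp b + `|a|) ^+ 2.
Proof.
move=> tb; have b0 : 0 <= b by rewrite (le_trans _ tb).
have Tt : `|ramp t| <= ramp b.
  rewrite /ramp normrM [`|k.+1%:R^-1|]ger0_norm ?invr_ge0// ler_pM2r ?invr_gt0//.
  by rewrite normrX lerXn2r ?nnegrE.
rewrite /potential -[leLHS]real_normK ?num_real// lerXn2r ?nnegrE ?addr_ge0 ?ramp_ge0//.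
by rewrite (le_trans (ler_normB _ _))// lerD2r.
Qed.

Lemma sol_param_right a0 l0 s0 b e : 0 <= b -> 0 < e -> exists2 d : R, 0 < d &
  forall a l s, `|a - a0| < d -> `|l - l0| < d -> `|s - s0| < d ->
  forall t, 0 <= t <= b ->
    `|sol a l s t - sol a0 l0 s0 t| < e /\ `|sol' a l s t - sol' a0 l0 s0 t| < e.
Proof.
move=> b0 e0.
pose M := (ramp b + (`|a0| + 1)) ^+ 2 + (`|l0| + 1).
have [B B0 hB] := continuous_bounded_itv 0 b (is_deriv_continuous (sol_deriv a0 l0 s0)).
(* The difference of two solutions solves the unperturbed type of equation with a source at most
   [d K B]: [K] bounds the change of potential and energy per unit of [d <= 1], [B] the reference
   solution. [G] collects the resulting Gronwall factor. *)
pose K := 2 * `|a0| + 1 + 2 * ramp b + 1.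
have rb := ramp_ge0 b0.
have K0 : 0 <= K by rewrite /K; have := normr_ge0 a0; lra.
pose G := (1 + (K * B) ^+ 2 * b) * expR ((M + 2) * b).
have M0 : 0 <= M by rewrite /M addr_ge0 ?sqr_ge0 ?addr_ge0.
have G0 : 0 <= G by rewrite mulr_ge0 ?expR_ge0// addr_ge0// mulr_ge0// sqr_ge0.
exists (Num.min 1 (e / (G + 1))).
  by rewrite lt_min ltr01 divr_gt0//; lra.
set d := Num.min _ _ => a l s ha hl hs t tb.
have d1 : d <= 1 by rewrite ge_min lexx.
have de : d <= e / (G + 1) by rewrite ge_min lexx orbT.
have d0 : 0 < d by rewrite (le_lt_trans _ ha).
pose z x := sol a l s x - sol a0 l0 s0 x.
pose z1 x := sol' a l s x - sol' a0 l0 s0 x.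
pose f x := ((potential a x - l) - (potential a0 x - l0)) * sol a0 l0 s0 x.
have [dy dy'] := sol_solves a l s; have [dy0 dy0'] := sol_solves a0 l0 s0.
have dz : is_deriv z z1 by move=> x; rewrite /z; der.
have dz1 : is_deriv z1 (fun x => (potential a x - l) * z x + f x).
  by move=> x; rewrite /z1; der; rewrite /f /z; ring.
have an : `|a| <= `|a0| + 1.
  have -> : a = a0 + (a - a0) by ring.
  by rewrite (le_trans (ler_normD _ _))// lerD2l ltW// (lt_le_trans ha).
have ln : `|l| <= `|l0| + 1.
  have -> : l = l0 + (l - l0) by ring.
  by rewrite (le_trans (ler_normD _ _))// lerD2l ltW// (lt_le_trans hl).
have := @gronwall _ z z1 _ f 0 b M (d * K * B) dz dz1 _ t tb.
have Hb x : 0 <= x <= b -> `|potential a x - l| <= M /\ `|f x| <= d * K * B.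
  move=> /andP[x0 xb]; split.
    rewrite (le_trans (ler_normB _ _))// lerD//.
    rewrite ger0_norm ?sqr_ge0//.
    apply: le_trans (@potential_bound a x b _) _; first by rewrite ger0_norm.
    by rewrite lerXn2r ?nnegrE ?addr_ge0// lerD2l.
  rewrite /f normrM; apply: ler_pM => //; last by apply: hB; rewrite x0 xb.
  have -> : potential a x - l - (potential a0 x - l0) =
    (a - a0) * (a + a0 - 2 * ramp x) - (l - l0) by rewrite /potential; ring.
  apply: le_trans (ler_normB _ _) _; rewrite normrM.
  have -> : d * K = d * (2 * `|a0| + 1 + 2 * ramp b) + d by rewrite /K; ring.
  apply: lerD; last exact: ltW.
  apply: ler_pM => //; first exact: ltW.
  have := ramp_le x0 xb; have := ramp_ge0 x0 => h1 h2.
  apply: le_trans (ler_normB _ _) _; rewrite [`|2 * _|]ger0_norm; last exact: mulr_ge0.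
  have := ler_normD a a0; lra.
move=> /(_ Hb); rewrite subr0.
have -> : z 0 = 0 by rewrite /z !sol0 subrr.
have -> : z1 0 = s - s0 by rewrite /z1 !sol'0.
rewrite expr0n /= add0r.
have /andP[t0 tb'] := tb.
have s2 : (s - s0) ^+ 2 <= d ^+ 2.
  rewrite -[leLHS]real_normK ?num_real// lerXn2r// ?nnegrE; exact: ltW.
have E0 : 0 < expR ((M + 2) * t) by rewrite expR_gt0.
have H1 : ((s - s0) ^+ 2 + (d * K * B) ^+ 2 * t) * expR ((M + 2) * t) <= d ^+ 2 * G.
  rewrite /G mulrA; apply: ler_pM; rewrite ?expR_ge0//.
  - by rewrite addr_ge0 ?sqr_ge0// mulr_ge0 ?sqr_ge0.
  - rewrite [leRHS]mulrDr mulr1 mulrA -exprMn mulrA lerD// ler_wpM2l ?sqr_ge0//.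
  - by rewrite ler_expR ler_wpM2l// addr_ge0.
have H2 : d ^+ 2 * G < e ^+ 2.
  apply: (@le_lt_trans _ _ ((e / (G + 1)) ^+ 2 * G)).
    have en : 0 <= e / (G + 1) by rewrite divr_ge0 ?addr_ge0 ?(ltW e0).
    by rewrite ler_wpM2r// lerXn2r ?nnegrE ?(ltW d0).
  have G1 : 0 < G + 1 by lra.
  rewrite exprMn exprVn -mulrA -[ltRHS]mulr1 ltr_pM2l ?exprn_gt0//.
  rewrite mulrC ltr_pdivrMr ?exprn_gt0// mul1r; nra.
move=> H3; have := sqr_ge0 (z t); have := sqr_ge0 (z1 t) => h1 h2.
split; rewrite -(ltr_pXn2r (n := 2)) ?nnegrE ?(ltW e0)// real_normK ?num_real//;
  rewrite -/(z t) -/(z1 t); lra.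
Qed.

(** A condition on a compact interval, hence open in the parameters. If [x] lies beyond the turning
    points it nevertheless implies positivity on the whole right half-line. *)
Definition grows x a l s := exists2 t0 : R, x <= t0 &
  (forall t, 0 <= t <= t0 -> 0 < sol a l s t) /\ 0 < sol' a l s t0.

Lemma grows_gt0 x a l s : 0 <= x -> (forall t, x <= t -> l <= potential a t) ->
  grows x a l s -> forall t, 0 <= t -> 0 < sol a l s t.
Proof.
move=> x0 hx [t0 xt0 [pos g]] t t_ge0.
have [tt|/ltW tt] := leP t t0; first by apply: pos; rewrite t_ge0.
have [] // := growing_solution (sol_solves a l s) (a := t0) _ _ g tt.
- by move=> u t0u; rewrite subr_ge0 hx// (le_trans xt0).
- by apply: pos; rewrite lexx (le_trans x0).
Qed.

Lemma grows_open x a l s : 0 <= x -> grows x a l s -> exists2 d : R, 0 < d &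
  forall l' s', `|l' - l| < d -> `|s' - s| < d -> grows x a l' s'.
Proof.
move=> x0 [t0 xt0 [pos g]]; have t00 : 0 <= t0 by exact: le_trans xt0.
have [m m0 hm] := continuous_pos_lower (is_deriv_continuous (sol_deriv a l s)) t00 pos.
have e0 : 0 < Num.min m (sol' a l s t0) by rewrite lt_min m0.
have [d d0 hd] := sol_param_right a l s t00 e0.
exists d => // l' s' hl hs; exists t0 => //.
have aa : `|a - a| < d by rewrite subrr normr0.
split=> [t tt|].
  have [h _] := hd _ _ _ aa hl hs t tt; have := hm t tt.
  move: h; rewrite lt_min => /andP[h _]; have := ler_norm (- (sol a l' s' t - sol a l s t)).
  rewrite normrN; lra.
have t0t0 : 0 <= t0 <= t0 by rewrite t00 lexx.
have [_] := hd _ _ _ aa hl hs t0 t0t0.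
rewrite lt_min => /andP[_ h]; have := ler_norm (- (sol' a l' s' t0 - sol' a l s t0)).
rewrite normrN; lra.
Qed.

End Family.

(** * Reflection symmetry and existence of ground states *)

Section EvenFamily.
Context {R : realType} (k : nat).
Context (k_even : ~~ odd k).
Implicit Types (a b c d e l s t x A : R).
Local Notation potential := (potential k).
Local Notation sol := (sol k).
Local Notation sol' := (sol' k).
Local Notation ramp := (ramp k).
Local Notation grows := (grows k).

Lemma rampN t : ramp (- t) = - ramp t.
Proof. by rewrite /ramp exprNn -signr_odd /= k_even expr1 mulN1r mulNr. Qed.

Lemma potentialN a t : potential a (- t) = potential (- a) t.
Proof. by rewrite /potential rampN; ring. Qed.

(** [ramp] is odd, so both sides solve the same initial value problem. *)
Lemma sol_reflect a l s t :
  sol a l s (- t) = sol (- a) l (- s) t /\ sol' a l s (- t) = - sol' (- a) l (- s) t.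
Proof.
have s1 := solves_reflect (sol_solves k a l s).
have s2 : solves (fun t => potential a (- t) - l) (sol (- a) l (- s)) (sol' (- a) l (- s)).
  by apply: solves_ext (sol_solves k (- a) l (- s)) => u; rewrite potentialN.
have cQ : continuous (fun t => potential a (- t) - l).
  rewrite (_ : (fun t => _) = (fun t => potential (- a) t - l)).
    exact: potential_sub_continuous.
  by apply/funext => u; rewrite potentialN.
have := @solves_unique _ _ _ _ _ _ 0 cQ s1 s2.
rewrite oppr0 !sol0 !sol'0 => /(_ erefl erefl t)[-> h].
by rewrite -h opprK.
Qed.

Lemma sol_param a0 l0 s0 b e : 0 <= b -> 0 < e -> exists2 d : R, 0 < d &
  forall a l s, `|a - a0| < d -> `|l - l0| < d -> `|s - s0| < d ->
  forall t, `|t| <= b ->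
    `|sol a l s t - sol a0 l0 s0 t| < e /\ `|sol' a l s t - sol' a0 l0 s0 t| < e.
Proof.
move=> b0 e0.
have [d1 d10 h1] := sol_param_right k a0 l0 s0 b0 e0.
have [d2 d20 h2] := sol_param_right k (- a0) l0 (- s0) b0 e0.
exists (Num.min d1 d2); first by rewrite lt_min d10.
move=> a l s; rewrite !lt_min => /andP[a1 a2] /andP[l1 l2] /andP[s1 s2] t tb.
have [t0|t0] := leP 0 t.
  by apply: h1 => //; rewrite t0 -[t]ger0_norm.
have tN : 0 <= - t <= b by rewrite oppr_ge0 (ltW t0) -ltr0_norm//.
have a2' : `|- a - - a0| < d2 by rewrite -opprD normrN.
have s2' : `|- s - - s0| < d2 by rewrite -opprD normrN.
have [h3 h4] := h2 _ _ _ a2' l2 s2' _ tN.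
rewrite -[t]opprK.
have [-> ->] := sol_reflect a l s (- t); have [-> ->] := sol_reflect a0 l0 s0 (- t).
by split => //; rewrite -opprD normrN.
Qed.

(** The decay of a ground state is encoded by signs only. With a common threshold [x] these
    conditions pass to pointwise limits, and for a large potential they force exponential decay. *)
Definition ground a l s := (forall t, 0 <= sol a l s t) /\
  exists x, forall t, x <= t -> sol' a l s t <= 0 /\ 0 <= sol' a l s (- t).

Lemma sol_gt0 a l s : (forall t, 0 <= sol a l s t) -> forall t, 0 < sol a l s t.
Proof.
move=> h; apply: (@solves_ge0_gt0 _ _ _ _ 0 (@potential_sub_continuous _ k a l) (sol_solves k a l s) h).
by rewrite sol0.
Qed.

(** The potential is at most [M] on [[-1, 2]]; an energy above [M + 4] would make the solution
    oscillate there and change sign. *)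
Lemma energy_upper a l s : (forall t, 0 <= sol a l s t) -> l <= (ramp 2 + `|a|) ^+ 2 + 4.
Proof.
move=> h; set M := (_ ^+ 2); have [lM|lM] := leP l M; first by rewrite ler_wpDr.
have c0 : 0 <= l - M by rewrite subr_ge0 ltW.
suff : l - M <= 4 by lra.
apply: (oscillation_bound (sol_solves k a l s) c0); last by rewrite sol0.
move=> t t12; split => //; rewrite opprB lerD2r; apply: potential_bound.
by rewrite ler_norml; lra.
Qed.

(** Harnack's estimate on [[0, 1]], where [0 <= l] lets the potential alone bound the coefficient.
    The rate [c + 1] is used because it is positive. *)
Lemma slope_lower a l s : (forall t, 0 <= sol a l s t) -> 0 <= l ->
  - s <= ramp 2 + `|a| + 2.
Proof.
move=> h l0; set c := ramp 2 + `|a|.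
have c0 : 0 <= c by rewrite addr_ge0// ramp_ge0.
have c1 : 0 < c + 1 by rewrite ltr_wpDl.
have := harnack c1 (sol_solves k a l s) (a := 0); rewrite sol0 sol'0 mulr1.
have -> : c + 2 = c + 1 + 1 by ring.
apply=> t t01; split => //; rewrite lerBlDr (@le_trans _ _ (c ^+ 2))//.
  by apply: potential_bound; rewrite ler_norml; lra.
by nra.
Qed.

Lemma slope_bound a l s : (forall t, 0 <= sol a l s t) -> 0 <= l ->
  `|s| <= ramp 2 + `|a| + 2.
Proof.
move=> h l0; rewrite ler_norml; have := slope_lower h l0.
have := @slope_lower (- a) l (- s); rewrite opprK normrN => h2.
have : s <= ramp 2 + `|a| + 2.
  by apply: h2 => // t; have [<- _] := sol_reflect a l s t.
by lra.
Qed.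

(** Provides an admissible pair for the maximisation of the energy. From slope 0 the product [y y']
    is nonnegative on the right, so [y^2] stays at least 1. *)
Lemma zero_energy_ge0 a : forall t, 0 <= sol a 0 0 t.
Proof.
have H b t : 0 <= t -> 0 < sol b 0 0 t.
  move=> t0; have s1 := sol_solves k b 0 0; have [dy dy1] := s1.
  have pos x : 0 <= x -> 0 <= sol b 0 0 x * sol' b 0 0 x.
    move=> x0; have : sol b 0 0 0 * sol' b 0 0 0 <= sol b 0 0 x * sol' b 0 0 x.
      apply: (is_deriv_ge0_le (product_deriv s1) x0) => u _.
      by rewrite subr0; apply: addr_ge0; rewrite ?sqr_ge0//; apply: mulr_ge0; exact: sqr_ge0.
    by rewrite sol'0 mulr0.
  have sq x : 0 <= x -> 1 <= sol b 0 0 x ^+ 2.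
    move=> x0; have : sol b 0 0 0 ^+ 2 <= sol b 0 0 x ^+ 2.
      apply: (is_deriv_ge0_le (square_deriv dy) x0) => u /andP[u0 _].
      by rewrite mulr_ge0// pos// ltW.
    by rewrite sol0 expr1n.
  rewrite ltNge; apply/negP => yt.
  have := IVT t0 (is_deriv_within dy) (v := 0).
  case; first by rewrite ge_min le_max yt sol0 ler01 orbT.
  move=> c; rewrite in_itv /= => /andP[c0 _] yc.
  by have := sq _ c0; rewrite yc expr0n /= ler10.
move=> t; have [t0|t0] := leP 0 t; first exact/ltW/H.
rewrite -[t]opprK; have [-> _] := sol_reflect a 0 0 (- t).
by rewrite oppr0; apply/ltW/H; rewrite oppr_ge0 ltW.
Qed.

(* Growth is an open condition on the energy and the slope, so a solution that
   grows at both ends still does so at a larger energy. *)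
Lemma grows_both x L a l s : 0 <= x ->
  (forall t, x <= t -> L + 1 <= potential a t /\ L + 1 <= potential (- a) t) -> l <= L ->
  grows x a l s -> grows x (- a) l (- s) ->
  exists2 l' : R, l < l' & exists s', forall t, 0 <= sol a l' s' t.
Proof.
move=> x0 hx lL g1 g2.
have [d1 d10 h1] := grows_open x0 g1; have [d2 d20 h2] := grows_open x0 g2.
(* The energy rises by at most 1, so it stays below the bound [L + 1] of the potential beyond [x];
   the half makes [d] strictly smaller than both radii. *)
pose d := Num.min 1 (Num.min d1 d2 / 2).
have d0 : 0 < d by rewrite lt_min ltr01 divr_gt0// lt_min d10.
have dd1 : d < d1.
  have : d <= Num.min d1 d2 / 2 by rewrite ge_min lexx orbT.
  have : Num.min d1 d2 <= d1 by rewrite ge_min lexx.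
  lra.
have dd2 : d < d2.
  have : d <= Num.min d1 d2 / 2 by rewrite ge_min lexx orbT.
  have : Num.min d1 d2 <= d2 by rewrite ge_min lexx orbT.
  lra.
have dle1 : d <= 1 by rewrite ge_min lexx.
exists (l + d); first by rewrite ltrDl.
exists s.
have e : l + d - l = d by ring.
have G1 : grows x a (l + d) s by apply: h1; rewrite ?e ?subrr ?normr0 ?gtr0_norm.
have G2 : grows x (- a) (l + d) (- s) by apply: h2; rewrite ?e ?subrr ?normr0 ?gtr0_norm.
move=> t; have [t0|t0] := leP 0 t.
  apply/ltW/(grows_gt0 x0 _ G1) => // u /hx[]; lra.
rewrite -[t]opprK; have [-> _] := sol_reflect a (l + d) s (- t).
apply/ltW/(grows_gt0 x0 _ G2); last by rewrite oppr_ge0 ltW.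
by move=> u /hx[]; lra.
Qed.

(* If the solution grew on the right only, lowering its slope would make it grow
   at both ends. *)
Lemma max_not_grows x L a l s : 0 <= x ->
  (forall t, x <= t -> L + 1 <= potential a t /\ L + 1 <= potential (- a) t) -> l <= L ->
  (forall t, 0 <= sol a l s t) ->
  (forall l' s', (forall t, 0 <= sol a l' s' t) -> l' <= l) ->
  ~ grows x a l s.
Proof.
move=> x0 hx lL pos lmax g.
have nb s' : grows x a l s' -> ~ grows x (- a) l (- s').
  move=> g1 g2; have [l' ll' [s2 h]] := grows_both x0 hx lL g1 g2.
  by have := lmax _ _ h; rewrite leNgt ll'.
have posN t : 0 < sol (- a) l (- s) t.
  by have [<- _] := sol_reflect a l s t; exact: sol_gt0.
have dec t : x <= t -> sol' (- a) l (- s) t <= 0.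
  move=> xt; rewrite leNgt; apply/negP => h; apply: (nb s g).
  by exists t.
have [d d0 hd] := grows_open x0 g.
have g' : grows x a l (s - d / 2).
  apply: hd; rewrite ?subrr ?normr0//.
  have -> : s - d / 2 - s = - (d / 2) by ring.
  by rewrite normrN gtr0_norm ?divr_gt0//; lra.
apply: (nb _ g').
have [] := larger_slope_grows (sol_solves k (- a) l (- s)) (sol_solves k (- a) l (- (s - d / 2))) (a := x).
- by move=> t /hx[]; lra.
- exact: posN.
- exact: dec.
- exact: sol0.
- exact: sol0.
- by rewrite !sol'0; lra.
- exact: x0.
- move=> h1 [t xt h2]; exists t => //; split => // u /andP[u0 _]; exact: h1.
Qed.

Lemma ground_exists a : exists l s, ground a l s.
Proof.
pose L := (ramp 2 + `|a|) ^+ 2 + 4; pose S := ramp 2 + `|a| + 2.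
have L0 : 0 <= L by rewrite addr_ge0// sqr_ge0.
have S0 : 0 <= S by rewrite !addr_ge0// ramp_ge0.
have L10 : 0 <= L + 1 by rewrite addr_ge0.
have [x x0 hx] := potential_large k (normr_ge0 a) L10.
pose C : set (R * R) := `[0, L] `*` `[- S, S].
(* Positivity at each single time is a closed condition on the pair, by continuous dependence on the
   parameters. *)
pose K := C `&` \bigcap_(t in [set: R]) [set p | 0 <= sol a p.1 p.2 t].
have cC : compact C by apply: compact_setX; exact: segment_compact.
have cK : compact K.
  apply: (@subclosed_compact _ _ C) => //; last by move=> p [].
  - apply: closedI; first by apply: compact_closed cC; exact: norm_hausdorff.
    apply: closed_bigI => t _.
    apply: (closed_comp (f := fun p : R * R => sol a p.1 p.2 t) (D := [set x | 0 <= x])); last exact: closed_ge.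
    move=> p _; apply/cvgrPdist_lt => e e0.
    have [d d0 hd] := sol_param a p.1 p.2 (normr_ge0 t) e0.
    have nb := nbhsx_ballx p d d0.
    near=> q; rewrite distrC.
    have [h1 h2] : ball p d q by near: q; exact: nb.
    have [] // := hd a q.1 q.2 _ _ _ t (lexx _); first by rewrite subrr normr0.
      by rewrite distrC.
    by rewrite distrC.
have K0 : K !=set0.
  exists (0, 0); split; last by move=> t _ /=; exact: zero_energy_ge0.
  by split; rewrite /= in_itv /= ?lexx ?L0 ?oppr_le0 ?S0.
have [[l s] /set_mem[[/= lL sS] pos] lmax] := compact_EVT_max K0 cK
   (@continuous_subspaceT _ _ K (fun p : R * R => p.1) (fun p => cvg_fst)).
move: lL sS; rewrite !in_itv /= => /andP[l0 lL] sS.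
have {}pos t : 0 <= sol a l s t by exact: (pos t).
have {}lmax l' s' : (forall t, 0 <= sol a l' s' t) -> l' <= l.
  (* A priori bounds put pairs of nonnegative energy into the box; negative energies are below
     [l >= 0] anyway. *)
  move=> h; have [l'0|/ltW l'0] := leP 0 l'; last exact: le_trans l0.
  have : (l', s') \in K.
    apply/mem_set; split; last by move=> t _; exact: h.
    split; rewrite /= in_itv /=.
      by rewrite l'0; exact: energy_upper h.
    by rewrite -ler_norml; exact: slope_bound h l'0.
  by move=> /lmax.
have hx' t : x <= t -> L + 1 <= potential a t /\ L + 1 <= potential (- a) t.
  by move=> xt; split; apply: hx; rewrite ?normrN.
have hx'' t : x <= t -> L + 1 <= potential (- a) t /\ L + 1 <= potential (- - a) t.
  by rewrite opprK => /hx'[].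
have ng1 := max_not_grows x0 hx' lL pos lmax.
have ng2 : ~ grows x (- a) l (- s).
  apply: (max_not_grows x0 hx'' lL).
    by move=> t; have [<- _] := sol_reflect a l s t.
  move=> l' s' h; apply: (lmax l' (- s')) => t.
  by have := sol_reflect (- a) l' s' t; rewrite opprK => -[<- _].
exists l, s; split => //; exists x => t xt; split.
  rewrite leNgt; apply/negP => h; apply: ng1; exists t => //; split => // u _.
  exact: sol_gt0.
have [_ ->] := sol_reflect a l s t; rewrite oppr_ge0 leNgt; apply/negP => h.
apply: ng2; exists t => //; split => // u _.
by have [<- _] := sol_reflect a l s u; exact: sol_gt0.
Unshelve. all: by end_near. Qed.

End EvenFamily.

(** * Uniqueness, uniform decay and continuity of the ground state *)

Section GroundState.
Context {R : realType} (k : nat).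
Context (k_even : ~~ odd k).
Implicit Types (a b c d e l m s t x A : R).
Local Notation potential := (potential k).
Local Notation sol := (sol k).
Local Notation sol' := (sol' k).
Local Notation ramp := (ramp k).
Local Notation ground := (ground k).

Lemma ground_reflect a l s : ground a l s -> ground (- a) l (- s).
Proof.
move=> [h0 [x hx]]; split=> [t|]; first by have [<- _] := sol_reflect k_even a l s t.
exists x => t /hx[h1 h2]; have [_] := sol_reflect k_even a l s t.
have [_] := sol_reflect k_even a l s (- t); rewrite !opprK => e1 e2; rewrite e1 in h1; rewrite e2 in h2.
by rewrite -oppr_ge0 h2 -oppr_le0 h1.
Qed.

(** Replaces the unspecified threshold of [ground] by any one beyond the turning points: a positive
    slope there would persist forever. *)
Lemma ground_decreasing a l s x : 0 <= x -> ground a l s ->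
  (forall t, x <= t -> l <= potential a t) -> forall t, x <= t -> sol' a l s t <= 0.
Proof.
move=> x0 [h0 [x1 hx1]] hx t xt; rewrite leNgt; apply/negP => g.
have hQ u : t <= u -> 0 <= potential a u - l by move=> tu; rewrite subr_ge0 hx// (le_trans xt).
have H := growing_solution (sol_solves k a l s) hQ (sol_gt0 h0 t) g.
have /H[_] : t <= Num.max t x1 by rewrite le_max lexx.
have /hx1[] : x1 <= Num.max t x1 by rewrite le_max lexx orbT.
by move=> /le_lt_trans h _ /h; rewrite ltxx.
Qed.

(** With negative energy [y y'] would be strictly increasing on the line, but it is nonnegative far
    left and nonpositive far right. *)
Lemma ground_energy_ge0 a l s : ground a l s -> 0 <= l.
Proof.
move=> g; have [h0 [x hx]] := g; rewrite leNgt; apply/negP => l0.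
have x0 : 0 <= Num.max 0 x by rewrite le_max lexx.
have sy := sol_solves k a l s.
have dP := product_deriv sy.
have : sol a l s (- (Num.max 0 x + 1)) * sol' a l s (- (Num.max 0 x + 1)) <
    sol a l s (Num.max 0 x + 1) * sol' a l s (Num.max 0 x + 1).
  apply: (is_deriv_gt0_lt dP); first by lra.
  move=> t _; rewrite ltr_wpDl ?sqr_ge0// mulr_gt0 ?exprn_gt0 ?sol_gt0//.
  by rewrite subr_gt0 (lt_le_trans l0)// sqr_ge0.
have /hx[h1 h2] : x <= Num.max 0 x + 1.
  by rewrite (@le_trans _ _ (Num.max 0 x))// ?lerDl// le_max lexx orbT.
apply/negP; rewrite -leNgt.
have p1 := h0 (Num.max 0 x + 1); have p2 := h0 (- (Num.max 0 x + 1)).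
by rewrite (@le_trans _ _ 0)// ?mulr_ge0// mulr_ge0_le0.
Qed.

Lemma ground_deriv_small a l s : ground a l s ->
  forall e b, 0 < e -> exists2 x : R, b <= x & forall t, x <= t -> `|sol' a l s t| <= e.
Proof.
move=> g e b e0; have [h0 _] := g.
have l0 := ground_energy_ge0 g.
have [x x0 hx] := potential_large k (normr_ge0 a) (addr_ge0 l0 ler01).
have x0' : 0 <= Num.max b x by rewrite le_max x0 orbT.
have H t : Num.max b x <= t -> [/\ 1 <= potential a t - l, 0 <= sol a l s t & sol' a l s t <= 0].
  rewrite ge_max => /andP[bt xt]; split => //; first by have := hx a t (lexx _) xt; lra.
  by apply: (ground_decreasing x0 g _ xt) => u xu; have := hx a u (lexx _) xu; lra.
have [y hy hy2] := decaying_to0 (sol_solves k a l s) H e0.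
exists y; first by rewrite (le_trans _ hy)// le_max lexx.
by move=> t /hy2[].
Qed.

(* Two applications of Sturm's argument, to the right and to the left of a
   point where [v] is positive, give the Wronskian both signs. *)
Lemma no_lower_energy a l s m v v1 x : ground a l s -> m < l ->
  solves (fun t => potential a t - m) v v1 ->
  (forall t, x <= t -> v t * v1 t <= 0 /\ 0 <= v (- t) * v1 (- t)) ->
  forall t, v t <= 0.
Proof.
move=> g ml sv hx t0; rewrite leNgt; apply/negP => vt0.
have [h0 _] := g; have hpos := sol_gt0 h0.
have gN := ground_reflect g; have [h0N _] := gN; have hposN := sol_gt0 h0N.
have W1 : sol a l s t0 * v1 t0 - v t0 * sol' a l s t0 < 0.
  apply: (@sturm_right _ _ _ _ _ _ _ _ x (sol_solves k a l s) sv) => //.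
  - by move=> t; lra.
  - by move=> e; exact: ground_deriv_small g e x.
  - by move=> t /hx[].
have : sol (- a) l (- s) (- t0) * (- v1 (- - t0)) - v (- - t0) * sol' (- a) l (- s) (- t0) < 0.
  apply: (@sturm_right _ _ _ _ _ _ _ _ x (sol_solves k (- a) l (- s)) (solves_reflect sv)) => //.
  - by move=> t; rewrite potentialN//; lra.
  - by move=> e; exact: ground_deriv_small gN e x.
  - by move=> t /hx[_]; rewrite mulrN oppr_le0.
  - by rewrite opprK.
have [+ +] := sol_reflect k_even (- a) l (- s) t0; rewrite !opprK => -> ->; lra.
Qed.

(** A ground state of lower energy would be nonpositive by the Sturm argument, yet it equals 1 at 0.
    At equal energies, the solution of larger slope would eventually grow. *)
Lemma ground_unique a l s l' s' : ground a l s -> ground a l' s' -> l = l' /\ s = s'.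
Proof.
move=> g g'.
have le1 l1 s1 l2 s2 : ground a l1 s1 -> ground a l2 s2 -> l1 <= l2.
  move=> g1 g2; rewrite leNgt; apply/negP => l21.
  have [h0 [x hx]] := g2.
  have := no_lower_energy g1 l21 (sol_solves k a l2 s2) (x := x) _ 0.
  rewrite sol0 ler10 => H; suff: false by [].
  by apply: H => t /hx[h1 h2]; split; [exact: mulr_ge0_le0|exact: mulr_ge0].
have ll' : l = l' by apply/eqP; rewrite eq_le (le1 _ _ _ _ g g') (le1 _ _ _ _ g' g).
split => //; subst l'.
have le2 s1 s2 : ground a l s1 -> ground a l s2 -> s2 <= s1.
  move=> g1 g2; rewrite leNgt; apply/negP => s12.
  have l0 := ground_energy_ge0 g1.
  have [x x0 hx] := potential_large k (normr_ge0 a) (addr_ge0 l0 ler01).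
  have hx1 t : x <= t -> l <= potential a t.
    by move=> xt; have := hx a t (lexx _) xt; lra.
  have [h0 _] := g1.
  have [] := larger_slope_grows (sol_solves k a l s1) (sol_solves k a l s2) (a := x).
  - by move=> t xt; have := hx a t (lexx _) xt; lra.
  - exact: sol_gt0.
  - exact: ground_decreasing.
  - exact: sol0.
  - exact: sol0.
  - by rewrite !sol'0.
  - exact: x0.
  - by move=> _ [t xt]; rewrite ltNge (ground_decreasing x0 g2 hx1).
by apply/eqP; rewrite eq_le (le2 _ _ g g') (le2 _ _ g' g).
Qed.

Definition ground_data a : R * R := xget (0, 0) [set p | ground a p.1 p.2].
Definition lam a := (ground_data a).1.
Definition slope a := (ground_data a).2.
Definition efun a := sol a (lam a) (slope a).
Definition efun' a := sol' a (lam a) (slope a).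

Lemma efun_ground a : ground a (lam a) (slope a).
Proof.
have [l [s g]] := ground_exists k_even a.
exact: (@xgetI _ _ [set p : R * R | ground a p.1 p.2] (l, s) g).
Qed.

Lemma ground_lam a l s : ground a l s -> l = lam a /\ s = slope a.
Proof. by move=> g; exact: ground_unique g (efun_ground a). Qed.

Lemma lamN a : lam (- a) = lam a.
Proof. by have [] := ground_lam (ground_reflect (efun_ground a)). Qed.

Lemma slopeN a : slope (- a) = - slope a.
Proof. by have [] := ground_lam (ground_reflect (efun_ground a)). Qed.

Lemma efunN a t : efun a (- t) = efun (- a) t.
Proof. by rewrite /efun; have [-> _] := sol_reflect k_even a (lam a) (slope a) t; rewrite lamN slopeN. Qed.

Lemma efun'N a t : efun' a (- t) = - efun' (- a) t.
Proof. by rewrite /efun'; have [_ ->] := sol_reflect k_even a (lam a) (slope a) t; rewrite lamN slopeN. Qed.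

Lemma efun_gt0 a t : 0 < efun a t.
Proof. by have [h _] := efun_ground a; exact: sol_gt0. Qed.

Lemma efun_deriv a : is_deriv (efun a) (efun' a).
Proof. exact: sol_deriv. Qed.

Lemma efun'_deriv a : is_deriv (efun' a) (fun t => (potential a t - lam a) * efun a t).
Proof. exact: sol'_deriv. Qed.

Lemma efun_solves a : solves (fun t => potential a t - lam a) (efun a) (efun' a).
Proof. exact: sol_solves. Qed.

Definition lam_bound A := (ramp 2 + A) ^+ 2 + 4.
Definition slope_bd A := ramp 2 + A + 2.

Lemma lam_bounds a A : `|a| <= A -> 0 <= lam a <= lam_bound A.
Proof.
move=> aA; have g := efun_ground a; rewrite (ground_energy_ge0 g) /=.
have [h _] := g; apply: le_trans (energy_upper h) _.
have r2 : 0 <= ramp 2 := ramp_ge0 k (ler0n R 2).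
have A0 : 0 <= A by exact: le_trans aA.
by rewrite /lam_bound lerD2r lerXn2r ?nnegrE ?addr_ge0// lerD2l.
Qed.

Lemma slope_bounds a A : `|a| <= A -> `|slope a| <= slope_bd A.
Proof.
move=> aA; have g := efun_ground a; have [h _] := g.
apply: le_trans (slope_bound k_even h (ground_energy_ge0 g)) _.
by rewrite /slope_bd lerD2r lerD2l.
Qed.

(** Any rate [c] is available, because beyond some [x] common to all [|a| <= A] the potential
    exceeds the energy by [c^2]. Gronwall's bound [D] covers [[0, x + 1]]. *)
Lemma efun_decay_right A c : 0 <= A -> 0 < c -> exists2 C : R, 0 < C &
  forall a t, `|a| <= A -> 0 <= t ->
    efun a t <= C * expR (- c * t) /\ `|efun' a t| <= C * expR (- c * t).
Proof.
move=> A0 c0.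
have L0 : 0 <= lam_bound A by rewrite addr_ge0// sqr_ge0.
have [x x0 hx] := potential_large k A0 (addr_ge0 L0 (sqr_ge0 c)).
have c2 : 0 <= c ^+ 2 by exact: sqr_ge0.
pose M := (ramp (x + 1) + A) ^+ 2 + lam_bound A.
have M0 : 0 <= M by rewrite addr_ge0// sqr_ge0.
pose D := 1 + (1 + slope_bd A ^+ 2) * expR ((M + 2) * (x + 1)).
have x1 : 0 <= x + 1 by lra.
have D0 : 0 < D.
  by rewrite ltr_pwDl// mulr_ge0 ?expR_ge0// addr_ge0// sqr_ge0.
have near0 a t : `|a| <= A -> 0 <= t <= x + 1 -> efun a t <= D /\ `|efun' a t| <= D.
  move=> aA tt; have dz := efun_deriv a.
  have dz1 : is_deriv (efun' a) (fun t => (potential a t - lam a) * efun a t + 0).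
    by apply: is_deriv_ext (efun'_deriv a) => // u; rewrite addr0.
  have /andP[l0 lL] := lam_bounds aA.
  have := @gronwall _ _ _ _ _ 0 (x + 1) M 0 dz dz1 _ t tt.
  have /[swap] /[apply] : forall u, 0 <= u <= x + 1 -> `|potential a u - lam a| <= M /\ `|0 : R| <= 0.
    move=> u /andP[u0 ux]; rewrite normr0 lexx; split => //.
    apply: le_trans (ler_normB _ _) _; rewrite !ger0_norm ?sqr_ge0//.
    apply: lerD => //; apply: le_trans (@potential_bound _ _ a u (x + 1) _) _; first by rewrite ger0_norm.
    by rewrite lerXn2r ?nnegrE ?addr_ge0 ?ramp_ge0// lerD2l.
  rewrite expr0n /= mul0r addr0 /efun /efun' sol0 sol'0 subr0 expr1n => h.
  have : sol a (lam a) (slope a) t ^+ 2 + sol' a (lam a) (slope a) t ^+ 2 <= D - 1.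
    rewrite /D [1 + _]addrC addrK; apply: le_trans h _.
    apply: ler_pM; rewrite ?expR_ge0 ?addr_ge0 ?sqr_ge0//.
      rewrite lerD2l -[leLHS]real_normK ?num_real// lerXn2r ?nnegrE ?slope_bounds//.
      by apply: le_trans (slope_bounds aA).
    have /andP[_ tx] := tt; have M2 : 0 <= M + 2 by lra.
    by rewrite ler_expR ler_wpM2l.
  set p := sol _ _ _ _; set q := sol' _ _ _ _ => pq.
  have p2 := sqr_ge0 p; have q2 := sqr_ge0 q.
  split; first by have := sqr_ge0 (p - 1); rewrite sqrrB; lra.
  rewrite ler_norml; have := sqr_ge0 (q - 1); have := sqr_ge0 (q + 1); rewrite sqrrB sqrrD; lra.
(* Decay starts at [x], the derivative is bounded by the function one unit earlier, and one more
   unit is slack. *)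
exists (D * expR (c * (x + 2))); first by rewrite mulr_gt0 ?expR_gt0.
move=> a t aA t0; rewrite -mulrA -expRD.
have /andP[l0 lL] := lam_bounds aA.
have [tx|/ltW xt] := leP t (x + 1).
  have /(near0 _ _ aA)[h1 h2] : 0 <= t <= x + 1 by rewrite t0.
  have e1 : 1 <= expR (c * (x + 2) + - c * t).
    have : 0 <= c * (x + 2 - t) by apply: mulr_ge0; [exact: ltW|lra].
    by move=> h; rewrite -[leLHS]expR0 ler_expR; lra.
  split; [apply: le_trans h1 _|apply: le_trans h2 _]; by rewrite ler_peMr// ltW.
have H u : x <= u -> [/\ c ^+ 2 <= potential a u - lam a, 0 <= efun a u & efun' a u <= 0].
  move=> xu; have h := hx a u aA xu; split; [lra|exact/ltW/efun_gt0|].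
  apply: (ground_decreasing x0 (efun_ground a) _ xu) => r xr.
  by have := hx a r aA xr; lra.
have H' u : x <= u -> [/\ 0 <= potential a u - lam a, 0 <= efun a u & efun' a u <= 0].
  by move=> /H[h1 h2 h3]; split => //; exact: le_trans h1.
have B u : x <= u -> efun a u <= D * expR (- c * (u - x)).
  move=> xu; apply: le_trans (decaying_bound c0 (sol_solves k a _ _) H xu) _.
  rewrite ler_wpM2r ?expR_ge0//.
  by have [] // := near0 a x aA; rewrite x0; lra.
have B' u : t - 1 <= u -> efun a u <= D * expR (c * (x + 2) + - c * t).
  move=> tu; have xu : x <= u by lra.
  apply: le_trans (B _ xu) _; rewrite ler_wpM2l ?(ltW D0)// ler_expR.
  have -> : c * (x + 2) + - c * t = - c * (t - 2 - x) by ring.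
  rewrite !mulNr lerN2 ler_wpM2l//; [exact: ltW|lra].
split; first by apply: B'; lra.
by apply: le_trans (decaying_deriv_bound (sol_solves k a _ _) H' xt) _; apply: B'.
Qed.

Lemma efun_decay A c : 0 <= A -> 0 < c -> exists2 C : R, 0 < C &
  forall a t, `|a| <= A ->
    efun a t <= C * expR (- c * `|t|) /\ `|efun' a t| <= C * expR (- c * `|t|).
Proof.
move=> A0 c0; have [C C0 hC] := efun_decay_right A0 c0; exists C => // a t aA.
have [t0|t0] := ger0P t; first exact: hC.
rewrite -[t in efun a t]opprK -[t in efun' a t]opprK efunN efun'N normrN.
by apply: hC; rewrite ?normrN// oppr_ge0 ltW.
Qed.

(** Compactness and uniqueness: near [a0] the pairs lie in a compact box, and the signs defining
    [ground], with their common threshold, pass to every cluster point. That point is thus the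
    ground pair at [a0]. *)
Lemma ground_data_continuous : continuous ground_data.
Proof.
move=> a0; pose A := `|a0| + 1.
have A0 : 0 <= A by rewrite addr_ge0.
have aA a : `|a - a0| < 1 -> `|a| <= A.
  move=> h; have -> : a = a0 + (a - a0) by ring.
  by rewrite (le_trans (ler_normD _ _))// lerD2l ltW.
have a0A : `|a0| <= A by rewrite lerDl.
have L0 : 0 <= lam_bound A by rewrite addr_ge0// sqr_ge0.
have [x x0 hx] := potential_large k A0 L0.
(* The margin 1 makes [V] a neighbourhood of [ground_data a0]. *)
pose V : set (R * R) := `[-1, lam_bound A + 1] `*` `[- slope_bd A - 1, slope_bd A + 1].
have cV : compact V by apply: compact_setX; exact: segment_compact.
have inV a : `|a| <= A -> V (ground_data a).
  move=> h; have /andP[l0 lL] := lam_bounds h; have := slope_bounds h; rewrite ler_norml => sS.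
  split; rewrite /= in_itv /=; rewrite -/(lam a) -/(slope a); lra.
have nearA : \forall a \near a0, `|a - a0| < 1.
  by have := nbhsx_ballx a0 1 ltr01; apply: filterS => a; rewrite /ball /= distrC.
have nV : nbhs (ground_data a0) V.
  have /andP[l0 lL] := lam_bounds a0A; have := slope_bounds a0A; rewrite ler_norml => sS.
  apply/nbhs_ballP; exists 1 => //= q [/= h1 h2]; move: h1 h2; rewrite /ball /=.
  rewrite -/(lam a0) -/(slope a0) => h1 h2.
  have := ler_norm (lam a0 - q.1); have := ler_norm (- (lam a0 - q.1)).
  have := ler_norm (slope a0 - q.2); have := ler_norm (- (slope a0 - q.2)).
  rewrite !normrN => n1 n2 n3 n4; split; rewrite /= in_itv /=; lra.
have FV : (nbhs (ground_data @ a0)) V.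
  by rewrite /= nbhs_filterE; apply: filterS nearA => a /aA/inV.
have clusterE p : cluster (ground_data @ a0) p -> p = ground_data a0.
  move=> cp.
  have approx t e : 0 < e -> exists2 a : R, `|a| <= A &
      `|efun a t - sol a0 p.1 p.2 t| < e /\ `|efun' a t - sol' a0 p.1 p.2 t| < e.
    move=> e0; have [d d0 hd] := sol_param k_even a0 p.1 p.2 (normr_ge0 t) e0.
    pose B := [set q | exists2 a : R, `|a - a0| < Num.min 1 d & q = ground_data a].
    have m0 : 0 < Num.min 1 d by rewrite lt_min ltr01.
    have FB : (ground_data @ a0) B.
      have : \forall a \near a0, `|a - a0| < Num.min 1 d.
        by have := nbhsx_ballx a0 _ m0; apply: filterS => a; rewrite /ball /= distrC.
      by apply: filterS => a h; exists a.
    have [q [[a ha ->] [h1 h2]]] := cp B (ball p d) FB (nbhsx_ballx p d d0).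
    move: ha; rewrite lt_min => /andP[ha1 ha2].
    exists a; first exact: aA.
    by apply: hd => //; rewrite distrC; [exact: h1|exact: h2].
  have gp : ground a0 p.1 p.2.
    split=> [t|]; first rewrite leNgt; first apply/negP => h.
      have [|a _ [+ _]] := approx t (- sol a0 p.1 p.2 t); first by rewrite oppr_gt0.
      have := efun_gt0 a t; have := ler_norm (efun a t - sol a0 p.1 p.2 t); lra.
    have dec a t : `|a| <= A -> x <= t -> efun' a t <= 0.
      move=> h; apply: (ground_decreasing x0 (efun_ground a)) => u xu.
      by apply: le_trans (hx a u h xu); have /andP[] := lam_bounds h.
    exists x => t xt; split; rewrite leNgt; apply/negP => h.
      have [|a h1 [_]] := approx t (sol' a0 p.1 p.2 t); first by [].
      have := dec a t h1 xt; have := ler_norm (- (efun' a t - sol' a0 p.1 p.2 t)).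
      rewrite normrN; lra.
    have [|a h1 [_]] := approx (- t) (- sol' a0 p.1 p.2 (- t)); first by rewrite oppr_gt0.
    rewrite efun'N; have := dec (- a) t; rewrite normrN => /(_ h1 xt).
    have := ler_norm (- efun' (- a) t - sol' a0 p.1 p.2 (- t)); lra.
  have [e1 e2] := ground_lam gp; rewrite [p]surjective_pairing e1 e2.
  by rewrite -surjective_pairing.
have hR : hausdorff_space (R * R)%type by exact: norm_hausdorff.
have PF : ProperFilter (ground_data @ a0) by apply: fmap_proper_filter; exact: nbhs_pfilter.
apply: (@compact_cluster_set1 _ _ _ V) => //.
apply/seteqP; split=> [p /clusterE -> //|p -> ].
have [q [_ cq]] := cV _ PF FV.
by rewrite -(clusterE _ cq).
Qed.

Lemma efun_continuous t : continuous (efun ^~ t).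
Proof.
move=> a; apply/cvgrPdist_lt => e e0.
have [d d0 hd] := sol_param k_even a (lam a) (slope a) (normr_ge0 t) e0.
have n1 := nbhsx_ballx a d d0.
have n2 := @ground_data_continuous a _ (nbhsx_ballx (ground_data a) d d0).
near=> b; rewrite distrC.
have [h1 h2] : ball (ground_data a) d (ground_data b) by near: b; exact: n2.
have h3 : ball a d b by near: b; exact: n1.
have h3' : `|b - a| < d by rewrite distrC; exact: h3.
have h1' : `|lam b - lam a| < d by rewrite distrC; exact: h1.
have h2' : `|slope b - slope a| < d by rewrite distrC; exact: h2.
by have [h _] := hd b (lam b) (slope b) h3' h1' h2' t (lexx _); exact: h.
Unshelve. all: by end_near. Qed.

End GroundState.

(** * Integrals over the line *)

Section Integration.
Context {R : realType}.
Implicit Types (f g F : R -> R) (a b c e t x l C : R).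
Local Notation mu := (@lebesgue_measure R).

Lemma integrable_oneDsqrV : mu.-integrable setT (EFin \o (fun t : R => (oneDsqr t)^-1)).
Proof.
have cf : continuous (fun t : R => (oneDsqr t)^-1) := @continuous_oneDsqrV R.
have f0 t : 0 <= (oneDsqr t)^-1 by rewrite invr_ge0 (le_trans ler01)// oneDsqr_ge1.
apply/integrableP; split.
  by apply/measurable_EFinP; exact: continuous_measurable_fun.
under eq_integral => t _ do rewrite /= ger0_norm//.
rewrite ge0_symfun_integralT//; last by move=> t; rewrite /= /oneDsqr sqrrN.
have -> : [set x : R | 0 <= x] = `[0, +oo[%classic.
  by apply/seteqP; split => t /=; rewrite in_itv /= andbT.
by rewrite integral0y_oneDsqr -EFinM ltry.
Qed.

(** One fixed integrable majorant, [1 / (1 + t^2)], serves for all uses of dominated convergence;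
    exponential bounds are converted to it. *)
Definition dominated C f := forall t, `|f t| <= C * (oneDsqr t)^-1.

Lemma integrable_dominated f C D : measurable D -> measurable_fun setT f ->
  dominated C f -> mu.-integrable D (EFin \o f).
Proof.
move=> mD cf hf; apply: (@integrableS _ _ _ mu setT) => //.
apply: (@le_integrable _ _ _ mu setT measurableT _ (EFin \o (fun t => C * (oneDsqr t)^-1))) => //.
- by apply/measurable_EFinP.
- by move=> t _ /=; rewrite lee_fin (le_trans (hf t))// ler_norm.
- exact: (integrableZl measurableT C integrable_oneDsqrV).
Qed.

Lemma measurable_patch f D : measurable D -> measurable_fun setT f ->
  measurable_fun setT (f \_ D).
Proof.
move=> mD mf; apply/(measurable_restrictT f mD).
exact: (measurable_funS measurableT).
Qed.

Lemma cvg_Rintegral_seq (f_ : nat -> R -> R) f C D : measurable D ->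
  (forall n, measurable_fun setT (f_ n)) ->
  (forall t, D t -> f_ n t @[n --> \oo] --> f t) ->
  (forall n, dominated C (f_ n)) ->
  \int[mu]_(x in D) f_ n x @[n --> \oo] --> \int[mu]_(x in D) f x.
Proof.
move=> mD cf ff hf.
have iC : mu.-integrable D (EFin \o (fun t => C * (oneDsqr t)^-1)).
  apply: (@integrableS _ _ _ mu setT) => //.
  exact: (integrableZl measurableT C integrable_oneDsqrV).
have mf n : measurable_fun D (EFin \o f_ n).
  by apply/measurable_EFinP; exact: (measurable_funS measurableT).
have mf' : measurable_fun D (EFin \o f).
  apply/measurable_EFinP; apply: (@measurable_fun_cvg _ _ _ D f_) => // n.
  exact: (measurable_funS measurableT).
have ff' t : D t -> (f_ n t)%:E @[n --> \oo] --> (f t)%:E.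
  by move=> Dt; apply: cvg_EFin; [exact: nearW|exact: ff].
have ae1 : {ae mu, forall t, D t -> (fun n => EFin \o f_ n) ^~ t @ \oo --> (EFin \o f) t}.
  by apply: aeW => t; exact: ff'.
have ae2 : {ae mu, forall t n, D t -> (`|(EFin \o f_ n) t| <= (EFin \o (fun t => (C * (oneDsqr t)^-1)%R)) t)%E}.
  by apply: aeW => t n _; rewrite /= lee_fin; exact: hf.
have [ifi _ cv] := @dominated_convergence _ _ _ mu D mD (fun n => EFin \o f_ n) (EFin \o f)
   (EFin \o (fun t => C * (oneDsqr t)^-1)) mf mf' ae1 iC ae2.
apply: fine_cvg; rewrite fineK//.
by apply: integrable_fin_num.
Qed.

Lemma cvg_Rintegral (f : R -> R -> R) a0 C e D : measurable D -> 0 < e ->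
  (forall a, `|a - a0| < e -> continuous (f a) /\ dominated C (f a)) ->
  (forall t, f a t @[a --> a0] --> f a0 t) ->
  \int[mu]_(x in D) f a x @[a --> a0] --> \int[mu]_(x in D) f a0 x.
Proof.
move=> mD e0 hf ff; apply/(@cvg_nbhsP _ R^o) => w wa.
(* The bounds hold only within [e] of [a0], so the sequence is shifted to a rank from which it stays
   there. *)
have /cvgrPdist_lt /(_ _ e0)[N _ hN] := wa.
rewrite -(cvg_shiftn N); apply: (@cvg_Rintegral_seq (fun n => f (w (n + N)%N)) _ C) => //.
- move=> n; apply: continuous_measurable_fun.
  by have [] := hf (w (n + N)%N) _; first by rewrite distrC; apply: hN; exact: leq_addl.
- move=> t _; move/(@cvg_nbhsP _ R^o): (ff t) => /(_ w wa).
  by rewrite -(cvg_shiftn N).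
- move=> n; have [] := hf (w (n + N)%N) _ => //.
  by rewrite distrC; apply: hN; exact: leq_addl.
Qed.

Lemma Rintegral_itv F f a b : is_deriv F f -> continuous f -> a <= b ->
  mu.-integrable `[a, b] (EFin \o f) /\ \int[mu]_(x in `[a, b]) f x = F b - F a.
Proof.
move=> dF cf; split.
  apply: continuous_compact_integrable; first exact: segment_compact.
  exact: continuous_subspaceT.
move: H; rewrite le_eqVlt => /predU1P[->|ab].
  by rewrite set_itv1 Rintegral_set1 subrr.
rewrite /Rintegral (@continuous_FTC2 _ f F)//.
- exact: continuous_subspaceT.
- have cF := is_deriv_continuous dF; split.
  + by move=> x _; have [] := dF x.
  + exact/cvg_at_right_filter/cF.
  + exact/cvg_at_left_filter/cF.
- by move=> x _; rewrite derive1E; have [_ ->] := dF x.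
Qed.

Definition vanishes f := forall e, 0 < e -> exists b : R, forall t, b <= t -> `|f t| <= e.

Lemma vanishes_cvg f : vanishes f -> f t @[t --> +oo] --> 0.
Proof.
move=> vf; apply/cvgrPdist_le => e /vf[b hb]; near=> t.
rewrite sub0r normrN; apply: hb; near: t; apply: nbhs_pinfty_ge; exact: num_real.
Unshelve. all: by end_near. Qed.

Lemma cvg_vanishes f : f t @[t --> +oo] --> 0 -> vanishes f.
Proof.
move=> /cvgrPdist_le h e /h[b [_ hb]]; exists (b + 1) => t bt.
have : b < t by lra.
by move=> /hb; rewrite sub0r normrN.
Qed.

Lemma Rintegral_tail F f C a : is_deriv F f -> continuous f -> dominated C f ->
  vanishes F -> \int[mu]_(x in `[a, +oo[) f x = - F a.
Proof.
move=> dF cf hf /vanishes_cvg vF.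
have mf := continuous_measurable_fun cf.
have h1 : \int[mu]_(x in `[a, +oo[) (f \_ `[a, a + n%:R]) x @[n --> \oo] --> \int[mu]_(x in `[a, +oo[) f x.
  apply: (@cvg_Rintegral_seq (fun n => f \_ `[a, a + n%:R]) _ C) => //.
  - move=> n; exact: measurable_patch.
  - move=> t /=; rewrite in_itv /= andbT => at_; apply: cvg_near_cst; near=> n.
    rewrite patchE ifT//; apply/mem_set; rewrite /= in_itv /= at_ /= -lerBlDl.
    by near: n; exact: nbhs_infty_ger.
  - move=> n t; rewrite patchE; case: ifP => _; first exact: hf.
    by rewrite normr0 (le_trans _ (hf t)).
have h2 : \int[mu]_(x in `[a, +oo[) (f \_ `[a, a + n%:R]) x @[n --> \oo] --> - F a.
  have -> : (fun n => \int[mu]_(x in `[a, +oo[) (f \_ `[a, a + n%:R]) x) = (fun n : nat => F (a + n%:R) - F a).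
    apply/funext => n; rewrite -Rintegral_mkcondr.
    have an : a <= a + n%:R by rewrite lerDl.
    have [_ <-] := Rintegral_itv dF cf an.
    congr (Rintegral _ _ _); apply/seteqP; split => t /=; rewrite !in_itv /= ?andbT.
      by case.
    by move=> /andP[h3 h4]; rewrite h3 h4.
  have hF : F (a + n%:R) @[n --> \oo] --> (0 : R).
    move/cvg_pinftyP: vF; apply.
    apply/cvgryPge => A; near=> n; rewrite -lerBlDl.
    by near: n; exact: nbhs_infty_ger.
  by rewrite -[X in _ --> X]add0r; exact: cvgB hF (cvg_cst _).
exact: (cvg_unique _ h1 h2).
Unshelve. all: by end_near. Qed.

Lemma Rintegral_setT_eq0 F f C : is_deriv F f -> continuous f -> dominated C f ->
  vanishes F -> vanishes (fun t => F (- t)) -> \int[mu]_x f x = 0.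
Proof.
move=> dF cf hf /vanishes_cvg vF /vanishes_cvg vF'.
have mf := continuous_measurable_fun cf.
have h1 : \int[mu]_x (f \_ `[- n%:R, n%:R]) x @[n --> \oo] --> \int[mu]_x f x.
  apply: (@cvg_Rintegral_seq (fun n => f \_ `[- n%:R, n%:R]) _ C) => //.
  - move=> n; exact: measurable_patch.
  - move=> t _; apply: cvg_near_cst; near=> n.
    rewrite patchE ifT//; apply/mem_set; rewrite /= in_itv /= -ler_norml.
    by near: n; exact: nbhs_infty_ger.
  - move=> n t; rewrite patchE; case: ifP => _; first exact: hf.
    by rewrite normr0 (le_trans _ (hf t)).
have yn : (n%:R : R) @[n --> \oo] --> +oo.
  by apply/cvgryPge => A; near=> n; near: n; exact: nbhs_infty_ger.
have h2 : \int[mu]_x (f \_ `[- n%:R, n%:R]) x @[n --> \oo] --> (0 - 0 : R).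
  have -> : (fun n => \int[mu]_x (f \_ `[- n%:R, n%:R]) x) = (fun n : nat => F (n%:R) - F (- n%:R)).
    apply/funext => n; rewrite -Rintegral_mkcond.
    have an : - n%:R <= n%:R :> R by rewrite lerNl (le_trans _ (ler0n _ _))// oppr_le0.
    by have [_ <-] := Rintegral_itv dF cf an.
  apply: cvgB; first by move/cvg_pinftyP: vF; apply.
  by move/cvg_pinftyP: vF'; apply.
by rewrite (cvg_unique _ h1 h2)// subr0.
Unshelve. all: by end_near. Qed.

Lemma tail_antiderivative f C : continuous f -> dominated C f ->
  exists2 F, is_deriv F (fun t => - f t) & vanishes F.
Proof.
move=> cf hf; have mf := continuous_measurable_fun cf.
have intf D : measurable D -> mu.-integrable D (EFin \o f).
  by move=> mD; exact: integrable_dominated hf.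
pose G x := \int[mu]_(t in `]-oo, x]) f t.
have dG : is_deriv G f.
  move=> x; have x1 : x < x + 1 by lra.
  have [h1 h2] := @continuous_FTC1 R f (BInfty _ true) x (x + 1) x1 (intf _ (measurable_itv _)) (ltNyr x) (cf x).
  by split; [exact: h1|rewrite -derive1E].
(* The tail integral, written so that the fundamental theorem applies to [G]. *)
exists (fun t => \int[mu]_x f x - G t).
  by move=> t; der; ring.
apply: cvg_vanishes; rewrite -[X in _ --> X](subrr (\int[mu]_x f x)).
apply: cvgB; first exact: cvg_cst.
apply/cvg_pinftyP => w wy.
have -> : (fun n => G (w n)) = (fun n => \int[mu]_x (f \_ `]-oo, w n]) x).
  by apply/funext => n; rewrite /G Rintegral_mkcond.
apply: (@cvg_Rintegral_seq (fun n => f \_ `]-oo, w n]) _ C) => //.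
- move=> n; exact: measurable_patch.
- move=> t _; apply: cvg_near_cst; near=> n.
  rewrite patchE ifT//; apply/mem_set; rewrite /= in_itv /=.
  by near: n; move/cvgryPge : wy; apply.
- move=> n t; rewrite patchE; case: ifP => _; first exact: hf.
  by rewrite normr0 (le_trans _ (hf t)).
Unshelve. all: by end_near. Qed.

(** From the quadratic Taylor term, [1 + t^2 / 2 <= exp |t|]. *)
Lemma expRN_dominated t : expR (- `|t|) <= 2 * (oneDsqr t)^-1.
Proof.
rewrite ler_pdivlMr ?(lt_le_trans ltr01 (oneDsqr_ge1 t))// expRN mulrC ler_pdivrMr ?expR_gt0//.
have := @expR_ge1Dxn R `|t| 1 (normr_ge0 t); rewrite real_normK ?num_real// /oneDsqr => h.
have : (2`!%:R : R) = 2 by [].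
move=> e2; rewrite e2 in h; lra.
Qed.

End Integration.

(** * Identification of the lowest eigenvalue *)

Section Spectrum.
Context {R : realType}.
Implicit Types (a b c e l m t x M : R).
Local Notation mu := (@lebesgue_measure R).

Lemma ae_imp (P Q : R -> Prop) : (forall t, P t -> Q t) ->
  {ae mu, forall t, P t} -> {ae mu, forall t, Q t}.
Proof. by move=> PQ; exact: (@filterS _ _ (ae_filter_ringOfSetsType _)). Qed.

Lemma near_ge c x : c < x -> \forall y \near x, c <= y.
Proof.
move=> cx; apply/nbhs_ballP; exists (x - c); first by rewrite /= subr_gt0.
by move=> y; rewrite /ball /= => h; have := ler_norm (x - y); lra.
Qed.

Lemma square_dominated_Lfun2 (f : R -> R) C : continuous f ->
  dominated C (fun t => f t ^+ 2) -> f \in Lfun mu 2%:E.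
Proof.
move=> cf hf; have mf := continuous_measurable_fun cf.
rewrite inE /=; apply/andP; split; rewrite inE//=.
rewrite /finite_norm unlock poweR_lty//.
have : mu.-integrable setT (EFin \o (fun t => f t ^+ 2)).
  by apply: integrable_dominated hf => //; exact: measurable_funX.
move=> /integrableP[_]; congr (_ < _)%E; apply: eq_integral => t _ /=.
by rewrite normrX powR_mulrn.
Qed.

(** On a window of length [n] the integral of [v^2] is at least [c n], which exceeds the total for
    large [n]. The window may move with [n], so that both tails can be treated. *)
Lemma Lfun2_not_bounded_below (v : R -> R) c (p : nat -> R) : v \in Lfun mu 2%:E ->
  0 < c -> (forall n t, p n <= t <= p n + n%:R -> c <= v t ^+ 2) -> False.
Proof.
move=> /Lfun2_integrable_sqr iv c0 hc.
have v2 (A : set R) : measurable A -> mu.-integrable A (EFin \o (fun t => v t ^+ 2)).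
  by move=> mA; apply: (integrableS measurableT).
pose M := \int[mu]_x (v x ^+ 2).
have bound n : c * n%:R <= M.
  have mI : measurable `[p n, p n + n%:R] by exact: measurable_itv.
  have : \int[mu]_(x in `[p n, p n + n%:R]) c <= \int[mu]_(x in `[p n, p n + n%:R]) (v x ^+ 2).
    apply: le_Rintegral => //.
    - apply: continuous_compact_integrable; first exact: segment_compact.
      by apply: continuous_subspaceT => x; exact: cst_continuous.
    - exact: v2.
    - by move=> t; rewrite /= in_itv /= => /hc.
  have mE : fine (mu `[p n, p n + n%:R]%classic) = n%:R.
    rewrite lebesgue_measure_itv /= lte_fin ltrDl; case: ifPn => [_|].
      by rewrite -EFinB /= [p n + _]addrC addrK.
    by rewrite -leNgt => n0; apply/eqP; rewrite eq_le n0 ler0n.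
  rewrite Rintegral_cst// mE => /le_trans; apply.
  rewrite /M /Rintegral; apply: fine_le; [exact/integrable_fin_num/v2|exact/integrable_fin_num/v2|].
  apply: ge0_subset_integral => //.
    by apply: (measurable_int mu); exact: v2.
  by move=> x _; rewrite lee_fin sqr_ge0.
have := bound (Num.truncn (M / c)).+1.
rewrite leNgt => /negP; apply; rewrite -ltr_pdivrMl// mulrC.
exact: truncnS_gt.
Qed.

(** Beyond [t0] the derivative of [v^2] is at least [2 d], so one unit of time gains [2 d]. *)
Lemma square_growth Q (v v1 : R -> R) x t0 : solves Q v v1 -> (forall t, x <= t -> 0 <= Q t) ->
  x <= t0 -> 0 < v t0 * v1 t0 ->
  forall t, t0 + 1 <= t -> 2 * (v t0 * v1 t0) <= v t ^+ 2.
Proof.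
move=> sv Q0 xt0; set d := v t0 * v1 t0 => d0 t t0t.
have [dv dv1] := sv.
have vv1 u : t0 <= u -> d <= v u * v1 u.
  move=> t0u; apply: (is_deriv_ge0_le (product_deriv sv) t0u) => r /andP[t0r _].
  apply: addr_ge0; first exact: sqr_ge0.
  by apply: mulr_ge0; [apply: Q0; lra|exact: sqr_ge0].
have dh : is_deriv (fun t => v t ^+ 2 - 2 * d * t) (fun t => 2 * (v t * v1 t) - 2 * d).
  by have ds := square_deriv dv => u; der; rewrite /=; ring.
have t0t' : t0 <= t by lra.
have : v t0 ^+ 2 - 2 * d * t0 <= v t ^+ 2 - 2 * d * t.
  apply: (is_deriv_ge0_le dh t0t') => u /andP[t0u _].
  by have := vv1 u (ltW t0u); lra.
have := sqr_ge0 (v t0); nra.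
Qed.

(** Translates square integrability into the sign conditions that the Sturm argument takes at
    infinity. *)
Lemma Lfun2_tails Q (v v1 : R -> R) x : v \in Lfun mu 2%:E -> solves Q v v1 ->
  (forall t, x <= t -> 0 <= Q t /\ 0 <= Q (- t)) ->
  forall t, x <= t -> v t * v1 t <= 0 /\ 0 <= v (- t) * v1 (- t).
Proof.
move=> v2 sv hQ t xt; split; rewrite leNgt; apply/negP => h.
  have H := square_growth sv (fun u xu => (hQ u xu).1) xt h.
  apply: (@Lfun2_not_bounded_below v (2 * (v t * v1 t)) (fun=> t + 1)) => //.
    by rewrite mulr_gt0.
  by move=> n u /andP[h1 _]; exact: H.
have h' : 0 < v (- t) * - v1 (- t) by rewrite mulrN oppr_gt0.
have H := square_growth (solves_reflect sv) (fun u xu => (hQ u xu).2) xt h'.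
apply: (@Lfun2_not_bounded_below v (2 * (v (- t) * - v1 (- t))) (fun n => - (t + 1) - n%:R)) => //.
  by rewrite mulr_gt0.
by move=> n u /andP[h1 h2]; have := H (- u); rewrite opprK; apply; lra.
Qed.

Lemma real_ac_continuous (g f : R -> R) : real_ac_derivative g f -> continuous g.
Proof.
move=> gf x; have x1 : x - 1 < x + 1 by lra.
have [fi _] := gf _ _ (ltW x1).
have /continuous_within_itvP := parameterized_integral_continuous (ltW x1) fi.
move=> /(_ x1)[+ _ _] => /(_ x); rewrite in_itv /= ltrDl ltr01 ltrBlDr ltrDl ltr01 => /(_ isT) cF.
have : {for x, continuous (fun y => g (x - 1) + parameterized_integral mu (x - 1) y f)}.
  by apply: cvgD; [exact: cvg_cst|exact: cF].
rewrite /continuous_at /prop_for /= => h.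
have e y : x - 1 <= y -> g (x - 1) + parameterized_integral mu (x - 1) y f = g y.
  by move=> /gf[_]; rewrite /parameterized_integral => <-; ring.
rewrite e in h; last lra.
apply: cvg_trans h; apply: near_eq_cvg; near=> y; apply: e.
by near: y; apply: near_ge; lra.
Unshelve. all: by end_near. Qed.

Lemma real_ac_deriv (g f h : R -> R) : real_ac_derivative g f -> continuous h ->
  {ae mu, forall t, f t = h t} -> is_deriv g h.
Proof.
move=> gf ch fh x; have x1 : x < x + 1 by lra.
have x0 : x - 1 < x by lra.
have ih : mu.-integrable `[x - 1, x + 1] (EFin \o h).
  by apply: continuous_compact_integrable; [exact: segment_compact|exact: continuous_subspaceT].
have [h1 h2] := continuous_FTC1_closed x1 ih x0 (ch x).
have dF : is_derive x 1 (fun y => \int[mu]_(t in `[x - 1, y]) h t) (h x).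
  by split; [exact: h1|rewrite -derive1E].
have dG : is_derive x 1 (fun y => g (x - 1) + \int[mu]_(t in `[x - 1, y]) h t) (h x).
  have := fderiv_add (fderiv_cst (g (x - 1)) x) dF; rewrite add0r; exact.
apply: near_eq_is_derive dG; near=> y.
have xy : x - 1 <= y by near: y; apply: near_ge; lra.
have [fi gy] := gf _ _ xy.
have -> : \int[mu]_(t in `[x - 1, y]) h t = \int[mu]_(t in `[x - 1, y]) f t.
  rewrite /Rintegral; congr fine; apply: ae_eq_integral => //.
  - by apply/measurable_EFinP; apply: (measurable_funS measurableT) => //; exact: continuous_measurable_fun.
  - exact: (measurable_int mu).
  - by move: fh; apply: ae_imp => t /= e _; rewrite e.
by rewrite -gy addrC subrK.
Unshelve. all: by end_near. Qed.

(** Regularity bootstrap: [v] and [v1] are continuous as indefinite integrals, and the equation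
    identifies [v2] almost everywhere with a continuous function, so [v1] is differentiable
    everywhere. *)
Lemma real_eigenfunction_solves (V v v1 v2 : R -> R) m : continuous V ->
  real_ac_derivative v v1 -> real_ac_derivative v1 v2 ->
  {ae mu, forall t, m * v t = - v2 t + V t * v t} ->
  solves (fun t => V t - m) v v1.
Proof.
move=> cV h1 h2 h3; have cv := real_ac_continuous h1; have cv1 := real_ac_continuous h2.
split; first by apply: real_ac_deriv h1 cv1 _; exact: aeW.
apply: real_ac_deriv h2 _ _.
  move=> t; apply: cvgM; last exact: cv.
  by apply: cvgB; [exact: cV|exact: cvg_cst].
by move: h3; apply: ae_imp => t e; rewrite mulrBl e; ring.
Qed.

Lemma is_deriv_real_ac (g f : R -> R) : is_deriv g f -> continuous f -> real_ac_derivative g f.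
Proof. by move=> dg cf a b ab; have [h1 ->] := Rintegral_itv dg cf ab. Qed.

Lemma not_ae_false (P : R -> Prop) : (forall t, ~ P t) -> ~ {ae mu, forall t, P t}.
Proof.
move=> nP [N [mN N0 /= sN]].
have : (mu `[0%R, 1%R]%classic <= mu N)%E.
  apply: (le_measure mu); rewrite ?inE//.
  by move=> t _; apply: sN => /=; exact: nP.
rewrite N0 lebesgue_measure_itv /= lte_fin ltr01 -EFinB subr0.
by rewrite lee_fin ler10.
Qed.

End Spectrum.

(** * From shooting energies to [lambda1] *)

Section LowestEigenvalue.
Context {R : realType} (k : nat).
Context (k_even : ~~ odd k).
Implicit Types (a b c e l m t x M : R).
Local Notation mu := (@lebesgue_measure R).
Local Notation potential := (@potential R k).

Lemma potential_continuous a : continuous (potential a).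
Proof. exact: is_deriv_continuous (potential_deriv k a). Qed.

(** The Sturm argument applies to both [v] and [- v]. *)
Lemma real_eigenfunction_eq0 a m (v v1 : R -> R) : m < lam k a -> v \in Lfun mu 2%:E ->
  solves (fun t => potential a t - m) v v1 -> forall t, v t = 0.
Proof.
move=> ml v2 sv.
have [x x0 hx] := potential_large k (normr_ge0 a) (normr_ge0 m).
have hQ t : x <= t -> 0 <= potential a t - m /\ 0 <= potential a (- t) - m.
  move=> xt; have := hx a t (lexx _) xt; have := hx (- a) t.
  rewrite normrN => /(_ (lexx _) xt); rewrite potentialN//; have := ler_norm m; lra.
have tails := Lfun2_tails v2 sv hQ.
have g := efun_ground k_even a.
have le0 := no_lower_energy k_even g ml sv tails.
have svN : solves (fun t => potential a t - m) (fun t => - v t) (fun t => - v1 t).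
  by have [dv dv1] := sv; split => t; der; ring.
have le0N t : - v t <= 0.
  by apply: (no_lower_energy k_even g ml svN (x := x)) => u xu; rewrite !mulrNN; exact: tails.
by move=> t; apply/eqP; rewrite eq_le le0 -oppr_le0 le0N.
Qed.

(** Potential and eigenvalue are real, so the real and imaginary parts of an eigenfunction solve the
    equation separately. *)
Lemma eigenvalue_ge a m : is_eigenvalue (frakQ k a) m -> lam k a <= m.
Proof.
move=> [u unz [[uR uI] _ [u1 [u2 [[acR acI] [ac1R ac1I] eq]]]]].
rewrite leNgt; apply/negP => ml; apply: unz; apply: aeW => t.
have sR := @real_eigenfunction_solves _ _ _ _ _ m (@potential_continuous a) acR ac1R _.
have sI := @real_eigenfunction_solves _ _ _ _ _ m (@potential_continuous a) acI ac1I _.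
have hR : forall t, complex.Re (u t) = 0.
  apply: (real_eigenfunction_eq0 ml uR); apply: sR.
  move: eq; apply: ae_imp => r; rewrite /potential /ramp.
  case: (u r) => p q; case: (u2 r) => p2 q2 /= /eqP.
  by rewrite eq_complex /= !mul0r !subr0 => /andP[/eqP -> _].
have hI : forall t, complex.Im (u t) = 0.
  apply: (real_eigenfunction_eq0 ml uI); apply: sI.
  move: eq; apply: ae_imp => r; rewrite /potential /ramp.
  case: (u r) => p q; case: (u2 r) => p2 q2 /= /eqP.
  by rewrite eq_complex /= !mul0r !addr0 => /andP[_ /eqP ->].
by move: (hR t) (hI t); case: (u t) => p q /= -> ->.
Qed.

Lemma efun_sq_dominated a : exists2 C : R, 0 < C & dominated C (fun t => efun k a t ^+ 2).
Proof.
have [C C0 hC] := efun_decay k_even (normr_ge0 a) (ltr01 : 0 < 1 :> R).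
exists (C * C * 2); first by rewrite !mulr_gt0.
move=> t; have [h _] := hC a t (lexx _).
have u0 := ltW (efun_gt0 k_even a t).
have CC : 0 <= C * C by rewrite mulr_ge0// (ltW C0).
rewrite ger0_norm ?sqr_ge0//; apply: (@le_trans _ _ (C * C * expR (- `|t|))); last first.
  by rewrite -[leRHS]mulrA ler_wpM2l ?expRN_dominated.
rewrite expr2; apply: (@le_trans _ _ (C * expR (- 1 * `|t|) * (C * expR (- 1 * `|t|)))).
  by apply: ler_pM.
rewrite mulrACA mulN1r; apply: ler_wpM2l => //.
by rewrite ler_piMr ?expR_ge0// -expR0 ler_expR oppr_le0.
Qed.

Lemma lam_eigenvalue a : is_eigenvalue (frakQ k a) (lam k a).
Proof.
have du := efun_deriv k a; have du' := efun'_deriv k a.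
have cu := is_deriv_continuous du; have cu' := is_deriv_continuous du'.
have cu2 : continuous (fun t => (potential a t - lam k a) * efun k a t).
  move=> t; apply: cvgM; last exact: cu.
  exact: potential_sub_continuous.
have [C C0 hC] := efun_sq_dominated a.
have L2 : efun k a \in Lfun mu 2%:E := square_dominated_Lfun2 cu hC.
have L20 : (fun=> 0 : R) \in Lfun mu 2%:E.
  apply: (@square_dominated_Lfun2 _ _ 0); first by move=> t; exact: cst_continuous.
  by move=> t; rewrite mul0r expr0n normr0.
have L2l : (fun t => lam k a * efun k a t) \in Lfun mu 2%:E.
  apply: (@square_dominated_Lfun2 _ _ (lam k a ^+ 2 * C)).
    by move=> t; apply: cvgM; [exact: cvg_cst|exact: cu].
  by move=> t; rewrite exprMn normrM -mulrA ger0_norm ?sqr_ge0// ler_wpM2l ?sqr_ge0.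
have c0 : continuous (fun _ : R => 0 : R) by move=> t; exact: cvg_cst.
have ac0 : real_ac_derivative (fun=> 0 : R) (fun=> 0 : R).
  by apply: is_deriv_real_ac => // t; exact: fderiv_cst.
exists (fun t => (efun k a t)%:C%C).
  by apply: not_ae_false => t [e]; have := efun_gt0 k_even a t; rewrite e ltxx.
split.
- by split.
- split; rewrite /=.
    have -> : (fun t => lam k a * efun k a t - 0 * 0) = (fun t => lam k a * efun k a t).
      by apply/funext => t; rewrite mulr0 subr0.
    exact: L2l.
  have -> : (fun t => lam k a * 0 + 0 * efun k a t) = (fun=> 0).
    by apply/funext => t; rewrite mulr0 mul0r addr0.
  exact: L20.
- exists (fun t => (efun' k a t)%:C%C), (fun t => ((potential a t - lam k a) * efun k a t)%:C%C).
  split.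
  + by split => //=; exact: is_deriv_real_ac.
  + by split => //=; exact: is_deriv_real_ac.
  + apply: aeW => t; apply/eqP; rewrite eq_complex /= /potential /ramp.
    by apply/andP; split; apply/eqP; ring.
Qed.

Lemma lambda1E a : lambda1 k a = lam k a.
Proof.
have low : is_lowest_eigenvalue (frakQ k a) (lam k a).
  by split; [exact: lam_eigenvalue|exact: eigenvalue_ge].
have [h1 h2] : is_lowest_eigenvalue (frakQ k a) (lambda1 k a).
  exact: (@xgetI _ _ [set l | is_lowest_eigenvalue (frakQ k a) l] _ low).
by apply/eqP; rewrite eq_le h2 ?eigenvalue_ge//; exact: lam_eigenvalue.
Qed.

End LowestEigenvalue.

(** * The minimum at 0 *)

Section ExpDominated.
Context {R : realType}.
Implicit Types (f g : R -> R) (a b c e t x C : R).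
Local Notation mu := (@lebesgue_measure R).

(** Unlike [dominated], this also controls boundary terms: it implies integrability and vanishing at
    both ends, and it is stable under products. *)
Definition exp_dominated C f := forall t, `|f t| <= C * expR (- `|t|).

Lemma exp_dominatedW C f : exp_dominated C f -> dominated (C * 2) f.
Proof.
move=> hf t; have C0 : 0 <= C.
  by have := le_trans (normr_ge0 _) (hf t); rewrite pmulr_lge0 ?expR_gt0.
by rewrite (le_trans (hf t))// -mulrA ler_wpM2l// expRN_dominated.
Qed.

Lemma exp_dominated_vanishes C f : exp_dominated C f -> vanishes f.
Proof.
move=> hf e e0; exists (Num.max 0 (C / e)) => t; rewrite ge_max => /andP[t0 Ct].
rewrite (le_trans (hf t))// ger0_norm// expRN ler_pdivrMr ?expR_gt0//.
move: Ct; rewrite ler_pdivrMr// mulrC => /le_trans; apply.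
by rewrite ler_wpM2l ?(ltW e0)// (le_trans _ (expR_ge1Dx t))// lerDr.
Qed.

Lemma exp_dominated_reflect C f : exp_dominated C f -> exp_dominated C (fun t => f (- t)).
Proof. by move=> hf t; have := hf (- t); rewrite normrN. Qed.

Lemma expRN_le1 t : expR (- `|t|) <= 1.
Proof. by rewrite -[leRHS]expR0 ler_expR oppr_le0. Qed.

Lemma vanishes_nonincreasing_ge0 f f1 a : is_deriv f f1 -> vanishes f ->
  (forall t, a < t -> f1 t <= 0) -> 0 <= f a.
Proof.
move=> df vf f10; rewrite leNgt; apply/negP => fa.
have e0 : 0 < - f a / 2 by lra.
have [b hb] := vf _ e0.
have h1 : b <= Num.max a b by rewrite le_max lexx orbT.
have h2 : a <= Num.max a b by rewrite le_max lexx.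
have := hb _ h1; have : f (Num.max a b) <= f a.
  by apply: (is_deriv_le0_le df h2) => t /andP[at_ _]; exact: f10.
have := ler_norm (- f (Num.max a b)); rewrite normrN; lra.
Qed.

Lemma vanishes_decreasing_gt0 f f1 a : is_deriv f f1 -> vanishes f ->
  (forall t, a < t -> f1 t < 0) -> 0 < f a.
Proof.
move=> df vf f10; apply: (@le_lt_trans _ _ (f (a + 1))).
  apply: (vanishes_nonincreasing_ge0 df vf) => t at_; apply/ltW/f10; lra.
by apply: (is_deriv_lt0_lt df); [lra|move=> t /andP[at_ _]; exact: f10].
Qed.

Lemma Rintegral_gt0 f C : continuous f -> dominated C f -> (forall t, 0 < f t) ->
  0 < \int[mu]_x f x.
Proof.
move=> cf hf f0; have mf := continuous_measurable_fun cf.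
have intf (A : set R) : measurable A -> mu.-integrable A (EFin \o f).
  by move=> mA; exact: integrable_dominated hf.
have [m m0 hm] := continuous_pos_lower cf ler01 (fun t _ => f0 t).
apply: (lt_le_trans m0); apply: (@le_trans _ _ (\int[mu]_(x in `[0, 1]) f x)).
  have : \int[mu]_(x in `[0, 1]) m <= \int[mu]_(x in `[0, 1]) f x.
    apply: le_Rintegral => //.
    - apply: continuous_compact_integrable; first exact: segment_compact.
      by apply: continuous_subspaceT => x; exact: cst_continuous.
    - exact: intf.
  have mE : fine (mu `[0, 1]%classic) = 1 by rewrite lebesgue_measure_itv /= lte_fin ltr01 -EFinB subr0.
  by rewrite Rintegral_cst// mE mulr1.
rewrite /Rintegral; apply: fine_le; [exact/integrable_fin_num/intf|exact/integrable_fin_num/intf|].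
apply: ge0_subset_integral => //; first by apply: (measurable_int mu); exact: intf.
by move=> x _; rewrite lee_fin ltW.
Qed.

End ExpDominated.

(* The derivative of [v v1 + om v^2] with [om = - y1/y - a sg]. *)
Lemma jacobi_deriv {R : realType} (Q0 Q p y y1 v v1 sg : R -> R) (a : R) :
  solves Q0 y y1 -> solves Q v v1 -> (forall t, y t != 0) ->
  is_deriv sg (fun t => - 2 * p t - 2 * sg t * (y1 t / y t)) ->
  is_deriv (fun t => v t * v1 t + (- (y1 t / y t) - a * sg t) * v t ^+ 2)
    (fun t => (v1 t + (- (y1 t / y t) - a * sg t) * v t) ^+ 2 +
      v t ^+ 2 * (Q t - Q0 t + 2 * a * p t - a ^+ 2 * sg t ^+ 2)).
Proof.
move=> [dy dy1] [dv dv1] y0 dsg t; der; first exact: y0.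
by rewrite /=; field; exact: y0.
Qed.

(** * The ground state at parameter 0 and strict minimality *)

Section GroundZero.
Context {R : realType} (k : nat).
Context (k_gt0 : (0 < k)%N) (k_even : ~~ odd k).
Implicit Types (a b c e l t x A C K : R).
Local Notation mu := (@lebesgue_measure R).
Local Notation potential := (@potential R k).
Local Notation ramp := (@ramp R k).
Local Notation efun := (@efun R k).
Local Notation efun' := (@efun' R k).
Local Notation lam := (@lam R k).
Local Notation u := (efun 0).
Local Notation u' := (efun' 0).

Lemma ramp_exp_bound : exists2 K : R, 1 <= K & forall t, `|ramp t| * expR (- `|t|) <= K.
Proof.
(* From the term of degree [k + 1] in the exponential series. *)
exists (k.+1`!%:R); first by rewrite ler1n fact_gt0.
move=> t; rewrite expRN ler_pdivrMr ?expR_gt0//.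
have := @expR_ge1Dxn R `|t| k (normr_ge0 t) => h.
have h1 : `|t| ^+ k.+1 / k.+1`!%:R <= expR `|t| by lra.
rewrite ler_pdivrMr ?ltr0n ?fact_gt0// mulrC in h1; apply: le_trans h1.
rewrite /ramp normrM normrX ler_piMr ?exprn_ge0// ger0_norm ?invr_ge0//.
by rewrite invf_le1// ler1n.
Qed.

(** Rate 4 leaves spare factors [exp (- |t|)]: one absorbs [ramp], another the logarithmic
    derivative of [u]. *)
Lemma efun_decay4 A : 0 <= A -> exists2 C : R, 0 < C & forall a t, `|a| <= A ->
  efun a t <= C * expR (- `|t|) ^+ 4 /\ `|efun' a t| <= C * expR (- `|t|) ^+ 4.
Proof.
move=> A0; have [C C0 hC] := efun_decay k_even A0 (ltr0n R 4); exists C => // a t aA.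
have -> : expR (- `|t|) ^+ 4 = expR (- 4 * `|t|).
  by rewrite -expRM_natl; congr expR; ring.
exact: hC.
Qed.

Lemma u_even t : u (- t) = u t. Proof. by rewrite (efunN k_even) oppr0. Qed.
Lemma u'_odd t : u' (- t) = - u' t. Proof. by rewrite (efun'N k_even) oppr0. Qed.
Lemma u'0 : u' 0 = 0. Proof. by have := u'_odd 0; rewrite oppr0; lra. Qed.
Lemma u_gt0 t : 0 < u t. Proof. exact: efun_gt0. Qed.

(* With [q = - u' - ramp u], one has [q' = ramp q + (l - t^k) u], so that
   [q exp (- P)], [P' = ramp], first increases from 0 and then decreases to 0. *)
Lemma log_slope_gt_ramp t : 0 < t -> ramp t * u t < - u' t.
Proof.
move=> t0; pose q t := - u' t - ramp t * u t.
pose P (t : R) := t ^+ k.+2 / (k.+1%:R * k.+2%:R).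
have dP : is_deriv P ramp.
  move=> x; rewrite /P; der; rewrite mulr0 addr0 mulr1 /= /ramp invfM mulrCA !mulrA.
  by rewrite mulrAC mulfK ?pnatr_eq0// mulrC.
have du := @efun_deriv R k 0; have du' := @efun'_deriv R k 0; have dr := @ramp_deriv R k.
pose h t := q t * expR (- P t).
have dh : is_deriv h (fun t => (lam 0 - t ^+ k) * u t * expR (- P t)).
  by move=> x; rewrite /h /q; der; rewrite /potential; ring.
have h0 : h 0 = 0 by rewrite /h /q u'0 /ramp expr0n /= !mul0r !oppr0 addr0 mul0r.
have P0 x : 0 <= x -> 0 <= P x by move=> x0; rewrite /P divr_ge0 ?exprn_ge0 ?mulr_ge0.
have vh : vanishes h.
  have [C C0 hC] := efun_decay4 (lexx 0); have [K K1 hK] := ramp_exp_bound.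
  have hq : exp_dominated (C * (1 + K)) q.
    move=> x; have [] := hC 0 x; first by rewrite normr0.
    have := hK x; set E := expR _ => hK' h1 h2; have E1 : E <= 1 := expRN_le1 x.
    have E0 : 0 < E by exact: expR_gt0.
    apply: le_trans (ler_normB _ _) _; rewrite normrN normrM [`|u x|]ger0_norm ?(ltW (u_gt0 x))//.
    have e3 : E ^+ 3 <= 1 by rewrite exprn_ile1 ?(ltW E0).
    have e2 : E ^+ 2 <= 1 by rewrite exprn_ile1 ?(ltW E0).
    have a1 : C * E ^+ 4 <= C * E.
      by rewrite ler_wpM2l ?(ltW C0)// exprS ler_piMr ?(ltW E0).
    have a2 : `|ramp x| * u x <= C * K * E.
      apply: (@le_trans _ _ (`|ramp x| * (C * E ^+ 4))); first by rewrite ler_wpM2l.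
      rewrite (_ : `|ramp x| * (C * E ^+ 4) = C * ((`|ramp x| * E) * (E ^+ 2 * E))); last by ring.
      rewrite -[leRHS]mulrA ler_wpM2l ?(ltW C0)//; apply: ler_pM => //.
      - by rewrite mulr_ge0// ltW.
      - by rewrite mulr_ge0 ?exprn_ge0 ?(ltW E0).
      - by rewrite ler_piMl ?(ltW E0).
    lra.
  move=> e /(exp_dominated_vanishes hq)[b hb]; exists (Num.max 0 b) => x.
  rewrite ge_max => /andP[x0 bx]; rewrite /h normrM [`|expR _|]ger0_norm ?expR_ge0//.
  apply: le_trans (hb x bx); rewrite ler_piMr//.
  by rewrite -[leRHS]expR0 ler_expR oppr_le0 P0.
suff : 0 < h t by rewrite /h pmulr_lgt0 ?expR_gt0// /q subr_gt0.
have [tl|lt_] := ltP (t ^+ k) (lam 0).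
  rewrite -h0; apply: (is_deriv_gt0_lt dh t0) => x /andP[x0 xt].
  rewrite !mulr_gt0 ?expR_gt0 ?u_gt0// subr_gt0 (le_lt_trans _ tl)//.
  by rewrite lerXn2r ?nnegrE ?(ltW x0) ?(ltW t0) ?(ltW xt).
apply: (vanishes_decreasing_gt0 dh vh) => x tx.
rewrite -mulrA nmulr_rlt0 ?mulr_gt0 ?expR_gt0 ?u_gt0// subr_lt0 (le_lt_trans lt_)//.
by rewrite ltrXn2r ?nnegrE ?(ltW t0) ?ltW// -lt0n.
Qed.

Lemma u'_lt0 t : 0 < t -> u' t < 0.
Proof.
move=> t0; have := log_slope_gt_ramp t0.
have := mulr_ge0 (ramp_ge0 k (ltW t0)) (ltW (u_gt0 t)); lra.
Qed.

(** Growth control on [u' / u], needed for the boundary term of Jacobi's substitution to vanish at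
    infinity. Harnack's estimate on [[t, t + 1]] gives [- u' / u <= ramp (t + 1) + 2]. *)
Lemma log_slope_bound : exists2 K : R, 0 < K & forall t, `|u' t| * expR (- `|t|) <= K * u t.
Proof.
have [K K1 hK] := ramp_exp_bound.
have l0 : 0 <= lam 0 by have := @lam_bounds R k k_even 0 0; rewrite normr0 => /(_ (lexx _))/andP[].
(* The factor [expR 1] pays for evaluating [ramp] at [t + 1] against the weight at [t]. *)
pose K2 := K * expR 1 + 2.
have K20 : 0 < K2 by rewrite ltr_wpDl// mulr_ge0 ?expR_ge0// (le_trans ler01).
have right t : 0 <= t -> `|u' t| * expR (- `|t|) <= K2 * u t.
  move=> t0; have t1 : 0 <= t + 1 by lra.
  have rt := ramp_ge0 k t1.
  have c0 : 0 < ramp (t + 1) + 1 by rewrite ltr_wpDl.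
  have := @harnack R _ u u' t _ c0 (@efun_solves R k 0).
  have /[swap] /[apply] : forall s, t <= s <= t + 1 ->
      potential 0 s - lam 0 <= (ramp (t + 1) + 1) ^+ 2 /\ 0 <= u s.
    move=> s /andP[ts st]; have s0 : 0 <= s by lra.
    split; last exact/ltW/u_gt0.
    rewrite /potential subr0 lerBlDr (@le_trans _ _ (ramp (t + 1) ^+ 2))//.
      by rewrite lerXn2r ?nnegrE ?ramp_ge0// ramp_le.
    by rewrite ler_wpDr// lerXn2r ?nnegrE ?(ltW c0)// lerDl.
  move=> h; have u't : u' t <= 0.
    by move: t0; rewrite le_eqVlt => /predU1P[<-|/u'_lt0/ltW//]; rewrite u'0.
  rewrite (ler0_norm u't) (ger0_norm t0).
  have := hK (t + 1); rewrite (ger0_norm t1) (ger0_norm rt) opprD expRD.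
  rewrite [expR (- 1)]expRN mulrA ler_pdivrMr ?expR_gt0// => hr.
  have E0 := expR_gt0 (- t); have E1 := expRN_le1 t; rewrite (ger0_norm t0) in E1.
  have ut := u_gt0 t.
  apply: (@le_trans _ _ ((ramp (t + 1) + 1 + 1) * u t * expR (- t))).
    by rewrite ler_wpM2r// ltW.
  rewrite mulrAC ler_wpM2r ?(ltW ut)// /K2; lra.
exists K2 => // t; have [t0|t0] := leP 0 t; first exact: right.
by have := right (- t); rewrite u_even u'_odd !normrN; apply; lra.
Qed.

Lemma ramp_u2_dominated : exists C : R, dominated C (fun t => ramp t * u t ^+ 2).
Proof.
have [C C0 hC] := efun_decay4 (lexx 0); have [K K1 hK] := ramp_exp_bound.
exists (K * C ^+ 2 * 2); apply: exp_dominatedW => t.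
have [] := hC 0 t; first by rewrite normr0.
have := hK t; set E := expR _ => hK' h1 _; have E1 : E <= 1 := expRN_le1 t.
have E0 : 0 < E by exact: expR_gt0.
rewrite normrM [`|u t ^+ 2|]ger0_norm ?sqr_ge0//.
apply: (@le_trans _ _ (`|ramp t| * (C * E ^+ 4) ^+ 2)).
  by rewrite ler_wpM2l// lerXn2r ?nnegrE ?(ltW (u_gt0 t)) ?mulr_ge0 ?exprn_ge0 ?(ltW C0) ?(ltW E0).
have -> : `|ramp t| * (C * E ^+ 4) ^+ 2 = (`|ramp t| * E) * C ^+ 2 * (E ^+ 6 * E) by ring.
apply: ler_pM; rewrite ?mulr_ge0 ?exprn_ge0 ?(ltW E0) ?(ltW C0)//.
  by rewrite ler_wpM2r ?sqr_ge0.
by rewrite ler_piMl ?(ltW E0)// exprn_ile1// ltW.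
Qed.

Lemma ramp_u2_continuous : continuous (fun t => ramp t * u t ^+ 2).
Proof.
have du := @efun_deriv R k 0; have dr := @ramp_deriv R k.
have : is_deriv (fun t => ramp t * u t ^+ 2)
   (fun t => t ^+ k * u t ^+ 2 + ramp t * (2 * u t * u' t)).
  by move=> t; der; rewrite /=; ring.
exact: is_deriv_continuous.
Qed.

(* [F t] is the integral of [ramp u^2] over [t, +oo[. *)
Lemma moment_exists : exists F : R -> R, [/\ is_deriv F (fun t => - (ramp t * u t ^+ 2)),
  vanishes F, forall t, F (- t) = F t & forall t, 0 <= 2 * F t < u t ^+ 2].
Proof.
have [C hC] := ramp_u2_dominated.
have [F dF vF] := tail_antiderivative ramp_u2_continuous hC.
have Feven t : F (- t) = F t.
  have dd : is_deriv (fun t => F (- t) - F t) (fun=> 0).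
    by move=> x; der; rewrite u_even rampN//; ring.
  by apply/eqP; rewrite -subr_eq0 (is_deriv0_cst t 0 dd)// oppr0 subrr.
have du := @efun_deriv R k 0.
have right t : 0 <= t -> 0 <= 2 * F t < u t ^+ 2.
  move=> t0; rewrite mulr_ge0//=; last first.
    apply: (vanishes_nonincreasing_ge0 dF vF) => x tx.
    by rewrite oppr_le0 mulr_ge0 ?sqr_ge0// ramp_ge0//; lra.
  (* The derivative is negative on the right by [log_slope_gt_ramp], and the function vanishes at
     infinity, hence it is positive. *)
  have dD : is_deriv (fun t => u t ^+ 2 - 2 * F t) (fun t => 2 * (u t * (u' t + ramp t * u t))).
    by move=> x; der; rewrite /=; ring.
  rewrite -subr_gt0; apply: (vanishes_decreasing_gt0 dD) => [e e0|x tx].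
    have e4 : 0 < e / 4 by lra.
    have [b hb] := vF _ e4.
    have [C2 C20 hC2] := efun_decay4 (lexx 0).
    have ed : exp_dominated (C2 ^+ 2) (fun t => u t ^+ 2).
      move=> x; have [] := hC2 0 x; first by rewrite normr0.
      set E := expR _ => h1 _; have E1 : E <= 1 := expRN_le1 x.
      have E0 : 0 < E by exact: expR_gt0.
      rewrite ger0_norm ?sqr_ge0//; apply: (@le_trans _ _ ((C2 * E ^+ 4) ^+ 2)).
        by rewrite lerXn2r ?nnegrE ?(ltW (u_gt0 x)) ?mulr_ge0 ?exprn_ge0 ?(ltW C20) ?(ltW E0).
      have -> : (C2 * E ^+ 4) ^+ 2 = C2 ^+ 2 * (E ^+ 7 * E) by ring.
      by rewrite ler_wpM2l ?sqr_ge0// ler_piMl ?(ltW E0)// exprn_ile1// ltW.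
    have [b' hb'] := exp_dominated_vanishes ed e4.
    exists (Num.max b b') => x; rewrite ge_max => /andP[/hb h1 /hb' h2].
    have F2 : `|2 * F x| = 2 * `|F x| by rewrite normrM ger0_norm.
    by apply: le_trans (ler_normB _ _) _; lra.
  have x0 : 0 < x by lra.
  have := log_slope_gt_ramp x0 => h.
  rewrite pmulr_rlt0// pmulr_rlt0 ?u_gt0//; lra.
exists F; split => // t; have [t0|t0] := leP 0 t; first exact: right.
by have := right (- t); rewrite Feven u_even; apply; lra.
Qed.

(** [sg] is the first-order correction in [a] to the Riccati solution [- u' / u]: its linear
    equation cancels the term [- 2 a ramp] of the potential. The integrating factor of that equation
    is [u^2]. *)
Lemma sigma_exists : exists2 sg : R -> R,
  is_deriv sg (fun t => - 2 * ramp t - 2 * sg t * (u' t / u t)) &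
  [/\ forall t, 0 <= sg t < 1, is_deriv (fun t => sg t * u t ^+ 2) (fun t => - 2 * (ramp t * u t ^+ 2)),
   vanishes (fun t => sg t * u t ^+ 2) & forall t, sg (- t) = sg t].
Proof.
have [F [dF vF Feven hF]] := moment_exists.
have du := @efun_deriv R k 0.
have u0 t : u t != 0 by rewrite gt_eqF ?u_gt0.
have sgE t : 2 * F t / u t ^+ 2 * u t ^+ 2 = 2 * F t by rewrite divfK ?sqrf_eq0.
exists (fun t => 2 * F t / u t ^+ 2).
  move=> t; der; first by rewrite sqrf_eq0.
  by rewrite /=; field; exact: u0.
split.
- move=> t; have /andP[h1 h2] := hF t; rewrite divr_ge0 ?sqr_ge0//=.
  by rewrite ltr_pdivrMr ?mul1r// exprn_gt0// u_gt0.
- apply: is_deriv_ext (_ : is_deriv (fun t => 2 * F t) (fun t => - 2 * (ramp t * u t ^+ 2))).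
  + by move=> t; rewrite sgE.
  + by [].
  + by move=> t; der; ring.
- move=> e e0; have e2 : 0 < e / 2 by lra.
  have [b hb] := vF _ e2; exists b => t bt; rewrite sgE normrM ger0_norm//.
  by have := hb t bt; lra.
- by move=> t; rewrite Feven u_even.
Qed.

(* Jacobi's substitution with [omega = - u'/u - a sigma], which satisfies
   [omega' - omega^2 + potential a = lam 0 + a^2 (1 - sigma^2)]. *)
Lemma lam0_lt a : a != 0 -> lam 0 < lam a.
Proof.
move=> a0; rewrite ltNge; apply/negP => lam_le.
have [sg dsg [hsg _ _ _]] := sigma_exists.
have du := @efun_deriv R k 0; have du' := @efun'_deriv R k 0.
have dv := efun_deriv k a; have dv' := efun'_deriv k a.
have u0 t : u t != 0 by rewrite gt_eqF ?u_gt0.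
pose om t := - (u' t / u t) - a * sg t.
(* The boundary term of the quadratic form identity. Under [lam a <= lam 0] its derivative is a
   square plus a positive function. *)
pose B t := efun a t * efun' a t + om t * efun a t ^+ 2.
pose B1 t := (efun' a t + om t * efun a t) ^+ 2 +
  efun a t ^+ 2 * (lam 0 - lam a + a ^+ 2 * (1 - sg t ^+ 2)).
have dB : is_deriv B B1.
  apply: is_deriv_ext (jacobi_deriv a (@efun_solves R k 0) (efun_solves k a) u0 dsg) => // t.
  by rewrite /B1 /om /potential; ring.
have B1_gt0 t : 0 < B1 t.
  rewrite ltr_wpDl ?sqr_ge0// mulr_gt0 ?exprn_gt0 ?efun_gt0//.
  rewrite ltr_wpDl ?subr_ge0// mulr_gt0 ?exprn_even_gt0// subr_gt0.
  by have /andP[h1 h2] := hsg t; rewrite expr_lt1.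
have dom : exists C, exp_dominated C B.
  have [C C0 hC] := efun_decay4 (normr_ge0 a).
  have [K K0 hK] := log_slope_bound.
  exists (C ^+ 2 * (1 + K + `|a|)) => t.
  have [] := hC a t (lexx _); have := hK t; set E := expR _ => hKt hv hv'.
  have E1 : E <= 1 := expRN_le1 t; have E0 : 0 < E by exact: expR_gt0.
  have v0 := efun_gt0 k_even a t.
  have v2 : efun a t ^+ 2 <= C ^+ 2 * E ^+ 8.
    have -> : C ^+ 2 * E ^+ 8 = (C * E ^+ 4) ^+ 2 by ring.
    by rewrite lerXn2r ?nnegrE ?(ltW v0) ?mulr_ge0 ?exprn_ge0 ?(ltW C0) ?(ltW E0).
  have vv' : `|efun a t * efun' a t| <= C ^+ 2 * E ^+ 8.
    have -> : C ^+ 2 * E ^+ 8 = (C * E ^+ 4) * (C * E ^+ 4) by ring.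
    by rewrite normrM (gtr0_norm v0); apply: ler_pM => //; exact: ltW.
  have E8 n : C ^+ 2 * (E ^+ n * E) <= C ^+ 2 * E.
    by rewrite ler_wpM2l ?sqr_ge0// ler_piMl ?(ltW E0)// exprn_ile1// ltW.
  have sg1 : `|sg t| <= 1 by have /andP[h1 h2] := hsg t; rewrite ger0_norm// ltW.
  have omE : `|om t| * E <= K + `|a|.
    apply: (@le_trans _ _ ((`|u' t / u t| + `|a * sg t|) * E)).
      by rewrite ler_wpM2r ?(ltW E0)// /om (le_trans (ler_normB _ _))// normrN.
    rewrite mulrDl; apply: lerD.
      rewrite normrM normfV [`|u t|]gtr0_norm ?u_gt0// mulrAC ler_pdivrMr ?u_gt0//.
    rewrite normrM -mulrA -[leRHS]mulr1 ler_wpM2l// -[leRHS]mulr1.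
    by apply: ler_pM => //; exact: ltW.
  have omv : `|om t * efun a t ^+ 2| <= (K + `|a|) * (C ^+ 2 * E).
    rewrite normrM [`|efun a t ^+ 2|]ger0_norm ?sqr_ge0//.
    apply: (@le_trans _ _ (`|om t| * (C ^+ 2 * E ^+ 8))); first by rewrite ler_wpM2l.
    have -> : `|om t| * (C ^+ 2 * E ^+ 8) = (`|om t| * E) * (C ^+ 2 * (E ^+ 6 * E)) by ring.
    apply: ler_pM; [|apply: mulr_ge0; first exact: sqr_ge0|exact: omE|exact: E8].
      by rewrite mulr_ge0// ltW.
    by rewrite mulr_ge0 ?exprn_ge0 ?(ltW E0).
  apply: le_trans (ler_normD _ _) _.
  have := E8 7%N; rewrite -exprSr; lra.
have [C hC] := dom.
(* [B] increases strictly and vanishes at both ends, which gives [B 0] contradictory signs. *)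
have B0 : 0 <= - B 0.
  apply: (vanishes_nonincreasing_ge0 (is_deriv_opp dB)) => [e e0|t _]; last by rewrite oppr_le0 ltW.
  by have [b hb] := exp_dominated_vanishes hC e0; exists b => t /hb; rewrite normrN.
have B0' : 0 < B 0.
  have := @vanishes_decreasing_gt0 _ _ _ 0 (is_deriv_reflect dB)
     (exp_dominated_vanishes (exp_dominated_reflect hC)).
  by rewrite oppr0; apply => t _; rewrite oppr_lt0.
lra.
Qed.

End GroundZero.

(** * Derivatives of the lowest eigenvalue *)

Section RintegralLinear.
Context {R : realType}.
Implicit Types (f g : R -> R) (a b c t x C D : R).
Local Notation mu := (@lebesgue_measure R).

Lemma exp_dominatedM C D f g : exp_dominated C f -> exp_dominated D g ->
  exp_dominated (C * D) (fun t => f t * g t).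
Proof.
move=> hf hg t; have E0 : 0 < expR (- `|t|) := expR_gt0 _.
have D0 : 0 <= D by have := le_trans (normr_ge0 _) (hg t); rewrite pmulr_lge0.
rewrite normrM mulrAC; apply: ler_pM => //.
by rewrite (le_trans (hg t))// ler_piMr// expRN_le1.
Qed.

Lemma exp_dominatedD C D f g : exp_dominated C f -> exp_dominated D g ->
  exp_dominated (C + D) (fun t => f t + g t).
Proof. by move=> hf hg t; rewrite (le_trans (ler_normD _ _))// mulrDl lerD. Qed.

Lemma exp_dominatedZ C c f : exp_dominated C f -> exp_dominated (`|c| * C) (fun t => c * f t).
Proof. by move=> hf t; rewrite normrM -mulrA ler_wpM2l. Qed.

Lemma exp_dominated_le C D f : C <= D -> exp_dominated C f -> exp_dominated D f.
Proof. by move=> CD hf t; rewrite (le_trans (hf t))// ler_wpM2r// expR_ge0. Qed.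

Lemma Rintegral_linear c d f g C D : continuous f -> continuous g ->
  exp_dominated C f -> exp_dominated D g ->
  \int[mu]_x (c * f x + d * g x) = c * \int[mu]_x f x + d * \int[mu]_x g x.
Proof.
move=> cf cg hf hg.
have int c' (h : R -> R) C' : continuous h -> exp_dominated C' h ->
    mu.-integrable setT (EFin \o (fun x => c' * h x)).
  move=> ch hh; apply: (integrable_dominated measurableT _ (exp_dominatedW (exp_dominatedZ c' hh))).
  by apply: measurable_funM => //; exact: continuous_measurable_fun.
have int1 (h : R -> R) C' : continuous h -> exp_dominated C' h -> mu.-integrable setT (EFin \o h).
  move=> ch hh; have := int 1 h C' ch hh; congr (mu.-integrable _ (EFin \o _)).
  by apply/funext => x; rewrite mul1r.
rewrite RintegralD//; [|exact: int cf hf|exact: int cg hg].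
by rewrite !RintegralZl//; [exact: int1 cg hg|exact: int1 cf hf].
Qed.

Lemma is_deriv_scale c f f1 : is_deriv f f1 -> is_deriv (fun t => c * f t) (fun t => c * f1 t).
Proof. by move=> df t; der; rewrite mul0r add0r. Qed.

(** Integrated over the line, this expresses the moment of [p v^2] through the Wronskian of [y] and
    [v], which is small when [v] is close to [y]. *)
Lemma weighted_square_deriv (Q0 Q p y y1 v v1 sg : R -> R) :
  solves Q0 y y1 -> solves Q v v1 -> (forall t, y t != 0) ->
  is_deriv sg (fun t => - 2 * p t - 2 * sg t * (y1 t / y t)) ->
  is_deriv (fun t => sg t * v t ^+ 2)
    (fun t => - 2 * (p t * (v t * v t)) + 2 * (sg t * (v t / y t) * (y t * v1 t - v t * y1 t))).
Proof.
move=> [dy dy1] [dv dv1] y0 dsg t; der.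
by rewrite /=; field; exact: y0.
Qed.

End RintegralLinear.

(** * Difference quotients of the energy *)

Section SecondDerivative.
Context {R : realType} (k : nat).
Context (k_gt0 : (0 < k)%N) (k_even : ~~ odd k).
Implicit Types (a b c d e l t x z A C D K : R).
Local Notation mu := (@lebesgue_measure R).
Local Notation potential := (@potential R k).
Local Notation ramp := (@ramp R k).
Local Notation efun := (@efun R k).
Local Notation efun' := (@efun' R k).
Local Notation lam := (@lam R k).
Local Notation u := (efun 0).
Local Notation u' := (efun' 0).

Lemma efun_cont a : continuous (efun a).
Proof. exact: is_deriv_continuous (@efun_deriv R k a). Qed.

Lemma efun_exp_dominated A : 0 <= A -> exists2 C : R, 0 < C & forall a, `|a| <= A ->
  [/\ exp_dominated C (efun a), exp_dominated C (efun' a) &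
      exp_dominated C (fun t => ramp t * efun a t)].
Proof.
move=> A0; have [C C0 hC] := efun_decay4 k_even A0; have [K K1 hK] := @ramp_exp_bound R k.
have K0 : 0 < K by rewrite (lt_le_trans ltr01).
exists (C * K); first by rewrite mulr_gt0.
move=> a aA; have CK : C <= C * K by rewrite ler_peMr// ltW.
have key t : C * expR (- `|t|) ^+ 4 <= C * expR (- `|t|).
  by rewrite ler_wpM2l ?(ltW C0)// exprS ler_piMr ?expR_ge0// exprn_ile1 ?expR_ge0// expRN_le1.
split.
- apply: (exp_dominated_le CK) => t; have [h _] := hC a t aA.
  by rewrite gtr0_norm ?efun_gt0// (le_trans h).
- by apply: (exp_dominated_le CK) => t; have [_ h] := hC a t aA; rewrite (le_trans h).
- move=> t; have [h _] := hC a t aA; have := hK t; set E := expR _ => hKt.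
  have E0 : 0 < E by exact: expR_gt0.
  rewrite normrM [`|efun a t|]gtr0_norm ?efun_gt0//.
  apply: (@le_trans _ _ (`|ramp t| * (C * E ^+ 4))); first by rewrite ler_wpM2l.
  have -> : `|ramp t| * (C * E ^+ 4) = C * ((`|ramp t| * E) * (E ^+ 2 * E)) by ring.
  rewrite -[leRHS]mulrA ler_wpM2l ?(ltW C0)//; apply: ler_pM => //.
  + by rewrite mulr_ge0// ltW.
  + by rewrite mulr_ge0 ?exprn_ge0 ?(ltW E0).
  + by rewrite ler_piMl ?(ltW E0)// exprn_ile1 ?(ltW E0)// expRN_le1.
Qed.

(** Two parameters, because the Wronskian identity pairs ground states of different operators. *)
Definition mass a b := \int[mu]_t (efun a t * efun b t).
Definition moment a b := \int[mu]_t (ramp t * (efun a t * efun b t)).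

Lemma pair_continuous a b : continuous (fun t => efun a t * efun b t).
Proof. by move=> t; apply: cvgM; exact: efun_cont. Qed.

Lemma ramp_pair_continuous a b : continuous (fun t => ramp t * (efun a t * efun b t)).
Proof. by move=> t; apply: cvgM; [exact: ramp_continuous|exact: pair_continuous]. Qed.

Lemma pair_exp_dominated A : 0 <= A -> exists2 C : R, 0 < C & forall a b, `|a| <= A -> `|b| <= A ->
  exp_dominated C (fun t => efun a t * efun b t) /\
  exp_dominated C (fun t => ramp t * (efun a t * efun b t)).
Proof.
move=> A0; have [C C0 hC] := efun_exp_dominated A0.
exists (C * C); first by rewrite mulr_gt0.
move=> a b aA bA; have [h1 _ h2] := hC a aA; have [h3 _ _] := hC b bA.
split; first exact: exp_dominatedM.
by move=> t; have := exp_dominatedM h2 h3 t; rewrite mulrA.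
Qed.

Lemma pair_exp_dominated2 a b : exists2 C : R, 0 < C &
  [/\ exp_dominated C (fun t => efun a t * efun b t),
      exp_dominated C (fun t => ramp t * (efun a t * efun b t)) &
      exp_dominated C (fun t => efun a t * efun' b t)].
Proof.
have A0 : 0 <= `|a| + `|b| by rewrite addr_ge0.
have aA : `|a| <= `|a| + `|b| by rewrite lerDl.
have bA : `|b| <= `|a| + `|b| by rewrite lerDr.
have [C C0 hC] := efun_exp_dominated A0.
exists (C * C); first by rewrite mulr_gt0.
have [h1 _ h2] := hC a aA; have [h3 h4 _] := hC b bA.
split; [exact: exp_dominatedM| |exact: exp_dominatedM].
by move=> t; have := exp_dominatedM h2 h3 t; rewrite mulrA.
Qed.

Lemma mass_gt0 a b : 0 < mass a b.
Proof.
have [C C0 [h _ _]] := pair_exp_dominated2 a b.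
apply: Rintegral_gt0 (@pair_continuous a b) (exp_dominatedW h) _ => t.
by rewrite mulr_gt0// efun_gt0.
Qed.

Lemma wronskian_exp_dominated a b : exists2 C : R, 0 < C &
  exp_dominated C (fun t => efun a t * efun' b t - efun b t * efun' a t).
Proof.
have [C C0 [_ _ h1]] := pair_exp_dominated2 a b.
have [D D0 [_ _ h2]] := pair_exp_dominated2 b a.
exists (C + D); first by rewrite addr_gt0.
by move=> t; rewrite (le_trans (ler_normB _ _))// mulrDl lerD.
Qed.

Lemma efun_wronskian_deriv a b :
  is_deriv (fun t => efun a t * efun' b t - efun b t * efun' a t)
    (fun t => ((b - a) * (a + b) - (lam b - lam a)) * (efun a t * efun b t) +
      (- 2 * (b - a)) * (ramp t * (efun a t * efun b t))).
Proof.
apply: is_deriv_ext (wronskian_deriv (@efun_solves R k a) (@efun_solves R k b)) => // t.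
by rewrite /potential; ring.
Qed.

(** The derivative of the Wronskian integrates to 0, and the potentials differ by
    [(b - a) (a + b - 2 ramp)]. *)
Lemma lam_difference a b :
  (lam b - lam a) * mass a b = (b - a) * ((a + b) * mass a b - 2 * moment a b).
Proof.
have [C C0 [h1 h2 _]] := pair_exp_dominated2 a b.
have [D D0 hD] := wronskian_exp_dominated a b.
have := Rintegral_setT_eq0 (efun_wronskian_deriv a b) _
  (exp_dominatedW (exp_dominatedD (exp_dominatedZ _ h1) (exp_dominatedZ _ h2)))
  (exp_dominated_vanishes hD) (exp_dominated_vanishes (exp_dominated_reflect hD)).
rewrite (Rintegral_linear _ _ (@pair_continuous a b) (@ramp_pair_continuous a b) h1 h2).
rewrite -/(mass a b) -/(moment a b) => H.
have {}H : ((b - a) * (a + b) - (lam b - lam a)) * mass a b + - 2 * (b - a) * moment a b = 0.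
  apply: H => t; apply: cvgD; (apply: cvgM; first exact: cvg_cst).
    exact: pair_continuous.
  exact: ramp_pair_continuous.
by rewrite -[LHS]addr0 -H; ring.
Qed.

(** Stated along two paths [p] and [q], to cover both a fixed first parameter and the diagonal. *)
Lemma mass_moment_cvg (p q : R -> R) z0 : {for z0, continuous p} -> {for z0, continuous q} ->
  mass (p z) (q z) @[z --> z0] --> mass (p z0) (q z0) /\
  moment (p z) (q z) @[z --> z0] --> moment (p z0) (q z0).
Proof.
move=> cp cq.
pose A := Num.max `|p z0| `|q z0| + 1.
have A0 : 0 <= A by rewrite addr_ge0// le_max normr_ge0.
have bnd (r : R -> R) : {for z0, continuous r} -> `|r z0| + 1 <= A ->
    exists2 e : R, 0 < e & forall z, `|z - z0| < e -> `|r z| <= A.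
  move=> /cvgrPdist_lt /(_ _ ltr01) /nbhs_ballP[e /= e0 he] rA; exists e => // z ze.
  have : ball z0 e z by rewrite /ball /= distrC.
  move=> /he /= h; have -> : r z = r z0 - (r z0 - r z) by ring.
  by rewrite (le_trans (ler_normB _ _))// (le_trans _ rA)// lerD2l ltW.
have pA : `|p z0| + 1 <= A by rewrite lerD2r le_max lexx.
have qA : `|q z0| + 1 <= A by rewrite lerD2r le_max lexx orbT.
have [e1 e10 h1] := bnd p cp pA; have [e2 e20 h2] := bnd q cq qA.
have [C C0 hC] := pair_exp_dominated A0.
have e0 : 0 < Num.min e1 e2 by rewrite lt_min e10.
have cvg t : efun (p z) t * efun (q z) t @[z --> z0] --> efun (p z0) t * efun (q z0) t.
  by apply: cvgM; apply: (continuous_comp _ (@efun_continuous R k k_even t _)).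
split.
- apply: (cvg_Rintegral (C := C * 2) measurableT e0) => [z|//].
  rewrite lt_min => /andP[ze1 ze2]; split; first exact: pair_continuous.
  by apply: exp_dominatedW; apply: (hC _ _ (h1 z ze1) (h2 z ze2)).1.
- apply: (cvg_Rintegral (C := C * 2) measurableT e0) => [z|t]; last by apply: cvgM (cvg t); exact: cvg_cst.
  rewrite lt_min => /andP[ze1 ze2]; split; first exact: ramp_pair_continuous.
  by apply: exp_dominatedW; apply: (hC _ _ (h1 z ze1) (h2 z ze2)).2.
Qed.

(* Divided difference of [lam]; on the diagonal, the Feynman-Hellmann formula. *)
Definition dlam a b := (a + b) - 2 * moment a b / mass a b.

Lemma lam_diff_dlam a b : lam b - lam a = (b - a) * dlam a b.
Proof.
have m0 := lt0r_neq0 (mass_gt0 a b).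
by apply: (mulIf m0); rewrite lam_difference /dlam; field.
Qed.

Lemma dlam_cvg (p q : R -> R) z0 : {for z0, continuous p} -> {for z0, continuous q} ->
  dlam (p z) (q z) @[z --> z0] --> dlam (p z0) (q z0).
Proof.
move=> cp cq; have [h1 h2] := mass_moment_cvg cp cq.
apply: cvgB; first exact: cvgD.
apply: cvgM; first by apply: cvgM => //; exact: cvg_cst.
by apply: cvgV => //; exact: lt0r_neq0 (mass_gt0 _ _).
Qed.

(** [lam_diff_dlam] is exact, so [dlam a] is the slope function of Caratheodory's criterion and only
    its continuity at [a] is at stake. *)
Lemma lam_is_derive a : is_derive a 1 lam (dlam a a).
Proof.
apply/is_derive1_caratheodory; exists (dlam a); split => //.
- by move=> z; rewrite lam_diff_dlam mulrC.
- by apply: (@dlam_cvg (cst a) id) => //; exact: cst_continuous.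
Qed.

Lemma dlam0_continuous : {for 0, continuous (dlam 0)}.
Proof. by apply: (@dlam_cvg (cst 0) id) => //; exact: cst_continuous. Qed.

Context (sg : R -> R).
Context (sg_deriv : is_deriv sg (fun t => - 2 * ramp t - 2 * sg t * (u' t / u t)))
  (sg_bound : forall t, 0 <= sg t < 1)
  (sg_u2_deriv : is_deriv (fun t => sg t * u t ^+ 2) (fun t => - 2 * (ramp t * u t ^+ 2)))
  (sg_even : forall t, sg (- t) = sg t).

Lemma sg_dominated C f : exp_dominated C f -> exp_dominated C (fun t => sg t * f t).
Proof.
move=> hf t; have /andP[s0 s1] := sg_bound t.
by rewrite normrM (ger0_norm s0) (le_trans _ (hf t))// ler_piMl// ltW.
Qed.

Lemma sg_pair_dominated a b : exists2 C : R, 0 < C &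
  exp_dominated C (fun t => sg t * (efun a t * efun b t)).
Proof. by have [C C0 [h _ _]] := pair_exp_dominated2 a b; exists C => //; exact: sg_dominated. Qed.

(** The integrand is the derivative of [- sg u^2 / 2], which vanishes at both ends. *)
Lemma moment00 : moment 0 0 = 0.
Proof.
have [C C0 [_ h _]] := pair_exp_dominated2 0 0.
have [D D0 hD] := sg_pair_dominated 0 0.
have dF : is_deriv (fun t => - (1 / 2) * (sg t * (u t * u t))) (fun t => ramp t * (u t * u t)).
  by apply: is_deriv_ext (is_deriv_scale (- (1 / 2)) sg_u2_deriv) => t; rewrite expr2//; field.
have hF := exp_dominatedZ (- (1 / 2)) hD.
exact: (Rintegral_setT_eq0 dF (@ramp_pair_continuous 0 0) (exp_dominatedW h)
  (exp_dominated_vanishes hF) (exp_dominated_vanishes (exp_dominated_reflect hF))).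
Qed.

Lemma dlam00 : dlam 0 0 = 0.
Proof. by rewrite /dlam moment00 mulr0 mul0r addr0 subr0. Qed.

(* Wronskian of [u] and [efun z], divided by [z]; [quot_cvg] justifies the value
   at [z = 0]. *)
Definition quot z t :=
  if z == 0 then sg t * u t ^+ 2 else (u t * efun' z t - efun z t * u' t) / z.

(** Minus the derivative of [quot z], with the division by [z] carried out: nothing in it is
    singular at [z = 0]. *)
Definition quot' z t := (2 * ramp t - z + dlam 0 z) * (u t * efun z t).

Lemma quotE z t : u t * efun' z t - efun z t * u' t = z * quot z t.
Proof.
rewrite /quot; case: eqVneq => [->|z0]; last by rewrite mulrCA divff// mulr1.
by rewrite mul0r mulrC subrr.
Qed.

Lemma quot_deriv z : is_deriv (quot z) (fun t => - quot' z t).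
Proof.
have [->|z0] := eqVneq z 0.
  apply: is_deriv_ext sg_u2_deriv => t; first by rewrite /quot eqxx.
  by rewrite /quot' dlam00; ring.
apply: is_deriv_ext (is_deriv_scale z^-1 (efun_wronskian_deriv 0 z)) => t.
  by rewrite /quot (negbTE z0) mulrC.
have -> : (z - 0) * (0 + z) - (lam z - lam 0) = z * (z - dlam 0 z).
  by rewrite lam_diff_dlam; ring.
by rewrite /quot'; field.
Qed.

Lemma quot_exp_dominated z : exists2 C : R, 0 < C & exp_dominated C (quot z).
Proof.
have [->|z0] := eqVneq z 0.
  have [C C0 h] := sg_pair_dominated 0 0; exists C => // t.
  by have := h t; rewrite /quot eqxx expr2.
have [C C0 h] := wronskian_exp_dominated 0 z.
exists (`|z^-1| * C); first by rewrite mulr_gt0// normr_gt0 invr_eq0.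
by move=> t; have := exp_dominatedZ z^-1 h t; rewrite /quot (negbTE z0) mulrC [X in `|X|]mulrC.
Qed.

Lemma quotN z t : quot z (- t) = quot (- z) t.
Proof.
rewrite /quot oppr_eq0; case: eqVneq => [_|z0]; first by rewrite sg_even (u_even k_even).
rewrite (u_even k_even) (u'_odd k_even) (efunN k_even) (efun'N k_even) invrN; ring.
Qed.

Lemma dlam0N z : dlam 0 (- z) = - dlam 0 z.
Proof.
have [->|z0] := eqVneq z 0; first by rewrite oppr0 dlam00 oppr0.
apply: (mulfI z0); have := lam_diff_dlam 0 (- z); have := lam_diff_dlam 0 z.
by rewrite (lamN k_even) => -> /eqP; rewrite !subr0 mulNr mulrN -eqr_oppLR => /eqP <-.
Qed.

Lemma dlam0_near : exists2 e : R, 0 < e & forall z, `|z| < e -> `|z| <= 1 /\ `|dlam 0 z| <= 1.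
Proof.
have /cvgrPdist_lt /(_ _ ltr01) /nbhs_ballP[e /= e0 he] := dlam0_continuous.
exists (Num.min e 1); first by rewrite lt_min e0 ltr01.
move=> z; rewrite lt_min => /andP[ze z1]; split; first exact: ltW.
have : ball (0 : R) e z by rewrite /ball /= sub0r normrN.
by move=> /he /=; rewrite dlam00 sub0r normrN => /ltW.
Qed.

Lemma quot'_coef_dominated A D : 0 <= A -> 0 <= D -> exists2 C : R, 0 < C &
  forall z, `|z| <= A -> `|dlam 0 z| <= D ->
    exp_dominated C (fun t => (2 * ramp t - z + dlam 0 z) * efun z t).
Proof.
move=> A0 D0; have [C C0 hC] := efun_exp_dominated A0.
exists ((2 + A + D) * C); first by rewrite mulr_gt0//; lra.
move=> z zA zD t; have [h1 _ h2] := hC z zA.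
have -> : (2 * ramp t - z + dlam 0 z) * efun z t =
    2 * (ramp t * efun z t) + (- z * efun z t + dlam 0 z * efun z t) by ring.
have -> : (2 + A + D) * C * expR (- `|t|) =
    2 * (C * expR (- `|t|)) + (A * (C * expR (- `|t|)) + D * (C * expR (- `|t|))) by ring.
rewrite (le_trans (ler_normD _ _))// lerD//.
  by rewrite normrM ger0_norm// ler_wpM2l.
rewrite (le_trans (ler_normD _ _))// lerD//; rewrite normrM ?normrN; exact: ler_pM.
Qed.

Lemma vanishes_mul_expRN f : vanishes f -> vanishes (fun t => f t * expR (- t)).
Proof.
move=> vf e /vf[b hb]; exists (Num.max b 0) => t; rewrite ge_max => /andP[bt t0].
rewrite normrM (le_trans _ (hb t bt))// ler_piMr//.
by have := expRN_le1 t; rewrite ger0_norm ?expR_ge0// ger0_norm.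
Qed.

(** The bound must involve [u] itself, as [quot] is later divided by [u]. On the right,
    [C u exp (- t)] is compared with [quot] and [- quot]: both differences vanish at infinity and
    are nonincreasing, because [u' < 0] and [|quot'| <= C u exp (- t)]. *)
Lemma quot_bound A D : 0 <= A -> 0 <= D -> exists2 C : R, 0 < C &
  forall z, `|z| <= A -> `|dlam 0 z| <= D -> forall t, `|quot z t| <= C * u t.
Proof.
move=> A0 D0; have [C C0 hC] := quot'_coef_dominated A0 D0.
exists C => // z zA zD t; wlog t0 : z t zA zD / 0 <= t => [hw|].
  have [t0|t0] := leP 0 t; first exact: hw.
  have <- : quot (- z) (- t) = quot z t by rewrite quotN opprK.
  rewrite -(u_even k_even); apply: hw; rewrite ?normrN ?dlam0N ?normrN//.
  by rewrite oppr_ge0 ltW.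
have du := @efun_deriv R k 0; have dq := quot_deriv z.
have vu : vanishes u.
  have [B B0 /(_ 0)] := efun_exp_dominated (lexx (0 : R)); rewrite normr0 => /(_ (lexx _))[hB _ _].
  exact: exp_dominated_vanishes hB.
have [B' B'0 hB'] := quot_exp_dominated z.
(* The two signs of [s] give the upper and the lower bound. *)
have key (s : R) : `|s| = 1 -> 0 <= C * (u t * expR (- t)) - s * quot z t.
  move=> s1.
  have dH : is_deriv (fun x => C * (u x * expR (- x)) - s * quot z x)
      (fun x => C * ((u' x - u x) * expR (- x)) + s * quot' z x).
    by move=> x; der; ring.
  apply: (vanishes_nonincreasing_ge0 dH).
    apply: cvg_vanishes; have -> : nbhs (0 : R) = nbhs (C * 0 - s * 0 : R) by congr nbhs; ring.
    apply: cvgB; (apply: cvgM; first exact: cvg_cst); apply: vanishes_cvg.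
      exact: vanishes_mul_expRN.
    exact: exp_dominated_vanishes hB'.
  move=> x tx; have x0 : 0 < x by lra.
  have h1 := hC z zA zD x; have h2 := u'_lt0 k_gt0 k_even x0; have h3 := u_gt0 k_even x.
  have : s * quot' z x <= C * (u x * expR (- x)).
    rewrite (le_trans (ler_norm _))// normrM s1 mul1r /quot' mulrCA normrM (gtr0_norm h3).
    by rewrite [leRHS]mulrCA ler_wpM2l ?(ltW h3)//; move: h1; rewrite (gtr0_norm x0).
  have : C * (u' x * expR (- x)) <= 0.
    by rewrite pmulr_rle0// pmulr_lle0 ?expR_gt0// ltW.
  rewrite mulrBl mulrBr; lra.
have := key 1 (normr1 _); have := key (-1) (normrN1 _).
have : C * (u t * expR (- t)) <= C * u t.
  rewrite ler_wpM2l ?(ltW C0)// ler_piMr ?(ltW (u_gt0 k_even t))//.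
  by have := expRN_le1 t; rewrite ger0_norm.
by rewrite ler_norml => *; apply/andP; split; lra.
Qed.

Lemma quot'_continuous z : continuous (quot' z).
Proof.
move=> t; apply: cvgM; last exact: pair_continuous.
apply: cvgD; last exact: cvg_cst.
apply: cvgB; last exact: cvg_cst.
by apply: cvgM; [exact: cvg_cst|exact: ramp_continuous].
Qed.

Lemma quot'_dominated A D : 0 <= A -> 0 <= D -> exists2 C : R, 0 < C &
  forall z, `|z| <= A -> `|dlam 0 z| <= D -> exp_dominated C (quot' z).
Proof.
move=> A0 D0; have [C C0 hC] := quot'_coef_dominated A0 D0.
have [B B0 /(_ 0)] := efun_exp_dominated (lexx (0 : R)); rewrite normr0 => /(_ (lexx _))[hB _ _].
exists (C * B) => [|z zA zD t]; first by rewrite mulr_gt0.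
by have := exp_dominatedM (hC z zA zD) hB t; rewrite /quot' -mulrA [efun z t * _]mulrC.
Qed.

(** As a tail integral of [quot'], the quotient inherits continuity at [z = 0] by dominated
    convergence. *)
Lemma quot_cvg t : quot z t @[z --> 0] --> quot 0 t.
Proof.
have tailE z : quot z t = - \int[mu]_(x in `[t, +oo[) - quot' z x.
  have [C C0 hC] := quot'_dominated (normr_ge0 z) (normr_ge0 (dlam 0 z)).
  have [B B0 hB] := quot_exp_dominated z.
  rewrite (@Rintegral_tail _ (quot z) _ (C * 2) t) ?opprK//; first exact: quot_deriv.
  - by move=> x; apply: cvgN; exact: quot'_continuous.
  - by apply: exp_dominatedW => x; rewrite normrN; exact: hC.
  - exact: exp_dominated_vanishes hB.
have [e e0 he] := dlam0_near; have [C C0 hC] := quot'_dominated ler01 ler01.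
rewrite tailE (_ : quot ^~ t = fun z => - \int[mu]_(x in `[t, +oo[) - quot' z x); last first.
  by apply/funext.
apply: cvgN; apply: (@cvg_Rintegral _ (fun z x => - quot' z x) 0 (C * 2) e) => //.
  move=> z; rewrite subr0 => /he[z1 d1]; split.
    by move=> x; apply: cvgN; exact: quot'_continuous.
  by apply: exp_dominatedW => x; rewrite normrN; exact: hC.
move=> x; apply: cvgN; apply: cvgM.
  apply: cvgD; last exact: dlam0_continuous.
  by apply: cvgB; [exact: cvg_cst|exact: cvg_id].
by apply: cvgM; [exact: cvg_cst|exact: efun_continuous].
Qed.

Lemma u_neq0 t : u t != 0.
Proof. exact: lt0r_neq0 (u_gt0 k_even t). Qed.

Lemma sg_continuous : continuous sg.
Proof. exact: is_deriv_continuous sg_deriv. Qed.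

Lemma quot_continuous z : continuous (quot z).
Proof. exact: is_deriv_continuous (quot_deriv z). Qed.

Definition moment_quot z := \int[mu]_t (sg t * (efun z t / u t) * quot z t).

Lemma moment_quot_continuous z : continuous (fun t => sg t * (efun z t / u t) * quot z t).
Proof.
move=> t; apply: cvgM; last exact: quot_continuous.
apply: cvgM; first exact: sg_continuous.
by apply: cvgM; [exact: efun_cont|apply: cvgV; [exact: u_neq0|exact: efun_cont]].
Qed.

(** The factor [u] of [quot_bound] cancels the denominator, leaving the decay of [efun z]. *)
Lemma moment_quot_dominated A D : 0 <= A -> 0 <= D -> exists2 C : R, 0 < C &
  forall z, `|z| <= A -> `|dlam 0 z| <= D ->
    exp_dominated C (fun t => sg t * (efun z t / u t) * quot z t).
Proof.
move=> A0 D0; have [C C0 hC] := quot_bound A0 D0; have [B B0 hB] := efun_exp_dominated A0.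
exists (C * B) => [|z zA zD]; first by rewrite mulr_gt0.
suff h : exp_dominated (C * B) (fun t => (efun z t / u t) * quot z t).
  by move=> t; have := sg_dominated h t; rewrite mulrA.
have [hz _ _] := hB z zA; move=> t; rewrite normrM normf_div (gtr0_norm (u_gt0 k_even t)).
apply: (@le_trans _ _ (`|efun z t| / u t * (C * u t))).
  by rewrite ler_wpM2l ?hC// divr_ge0// ltW// u_gt0.
have -> : `|efun z t| / u t * (C * u t) = C * `|efun z t| by field; exact: u_neq0.
by rewrite -mulrA ler_wpM2l// ltW.
Qed.

(** The derivative of [sg (efun z)^2] integrates to 0; its Wronskian term carries the factor [z]. *)
Lemma moment_quotE z : moment z z = z * moment_quot z.
Proof.
have [C C0 [_ hC _]] := pair_exp_dominated2 z z.
have [D D0 hD] := moment_quot_dominated (normr_ge0 z) (normr_ge0 (dlam 0 z)).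
have {}hD := hD z (lexx _) (lexx _).
have dF : is_deriv (fun t => sg t * efun z t ^+ 2) (fun t => - 2 * (ramp t * (efun z t * efun z t)) +
    (2 * z) * (sg t * (efun z t / u t) * quot z t)).
  apply: is_deriv_ext (weighted_square_deriv (@efun_solves R k 0) (@efun_solves R k z) u_neq0 sg_deriv) => // t.
  by rewrite quotE; ring.
have [B B0 hB] := sg_pair_dominated z z.
have vF : exp_dominated B (fun t => sg t * efun z t ^+ 2) by move=> t; rewrite expr2.
have := Rintegral_setT_eq0 dF _
  (exp_dominatedW (exp_dominatedD (exp_dominatedZ _ hC) (exp_dominatedZ _ hD)))
  (exp_dominated_vanishes vF) (exp_dominated_vanishes (exp_dominated_reflect vF)).
rewrite (Rintegral_linear _ _ (@ramp_pair_continuous z z) (@moment_quot_continuous z) hC hD).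
rewrite -/(moment z z) -/(moment_quot z) => H.
have : - 2 * moment z z + 2 * z * moment_quot z = 0; last by lra.
apply: H => t; apply: cvgD; (apply: cvgM; first exact: cvg_cst).
  exact: ramp_pair_continuous.
exact: moment_quot_continuous.
Qed.

Lemma moment_quot_cvg : moment_quot z @[z --> 0] --> moment_quot 0.
Proof.
have [e e0 he] := dlam0_near; have [C C0 hC] := moment_quot_dominated ler01 ler01.
apply: (cvg_Rintegral (C := C * 2) measurableT e0) => [z|t].
  rewrite subr0 => /he[z1 d1]; split; first exact: moment_quot_continuous.
  exact: exp_dominatedW (hC z z1 d1).
apply: cvgM; last exact: quot_cvg.
by apply: cvgM; [exact: cvg_cst|apply: cvgM; [exact: efun_continuous|exact: cvg_cst]].
Qed.

(** At [z = 0] the integrands are [sg^2 u^2] and [u^2], and [sg^2 < 1] pointwise. *)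
Lemma moment_quot0_lt : moment_quot 0 < mass 0 0.
Proof.
have [C C0 [hC _ _]] := pair_exp_dominated2 0 0.
have [D D0 hD] := moment_quot_dominated (lexx (0 : R)) (lexx (0 : R)).
have {}hD := hD 0; rewrite dlam00 normr0 in hD; have {}hD := hD (lexx _) (lexx _).
have hd := exp_dominatedD (exp_dominatedZ 1 hC) (exp_dominatedZ (-1) hD).
rewrite -subr_gt0 -[X in X - _]mul1r -mulN1r.
rewrite -(Rintegral_linear _ _ (@pair_continuous 0 0) (@moment_quot_continuous 0) hC hD).
apply: (Rintegral_gt0 _ (exp_dominatedW hd)) => t.
  apply: cvgD; (apply: cvgM; first exact: cvg_cst).
    exact: pair_continuous.
  exact: moment_quot_continuous.
rewrite /quot eqxx divff ?u_neq0// mulr1 mul1r mulN1r subr_gt0.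
have /andP[s0 s1] := sg_bound t.
have -> : sg t * (sg t * u t ^+ 2) = (sg t * sg t) * (u t * u t) by ring.
rewrite gtr_pMl ?mulr_gt0 ?u_gt0//.
by rewrite (le_lt_trans _ s1)// ler_piMr// ltW.
Qed.

(** By [moment_quotE], [dlam z z] is exactly [z] times a function continuous at 0, so Caratheodory's
    criterion applies without differentiating the ground state in [z]. *)
Lemma dlam_diag_is_derive :
  is_derive (0 : R) 1 (fun z : R => dlam z z) (2 - 2 * moment_quot 0 / mass 0 0).
Proof.
have m0 z : mass z z != 0 by exact: lt0r_neq0 (mass_gt0 z z).
apply/is_derive1_caratheodory; exists (fun z => 2 - 2 * moment_quot z / mass z z); split => //.
- by move=> z; rewrite /dlam moment00 moment_quotE subr0; field; rewrite !m0.
- have idc : {for (0 : R), continuous (@id R)} by [].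
  have [cm _] := mass_moment_cvg idc idc.
  apply: cvgB; first exact: cvg_cst.
  apply: cvgM; first by apply: cvgM; [exact: cvg_cst|exact: moment_quot_cvg].
  by apply: cvgV.
Qed.

Lemma dlam_diag_slope_gt0 : 0 < 2 - 2 * moment_quot 0 / mass 0 0.
Proof.
have m0 := mass_gt0 0 0; have := moment_quot0_lt.
by rewrite -mulrA -[in X in _ -> 0 < X - _](mulr1 2) -mulrBr pmulr_rgt0// subr_gt0 ltr_pdivrMr// mul1r.
Qed.

End SecondDerivative.

Lemma lam_second_derivative (R : realType) (k : nat) : (0 < k)%N -> ~~ odd k ->
  exists2 d : R, 0 < d & is_derive (0 : R) 1 (fun z : R => dlam k z z) d.
Proof.
move=> k_gt0 k_even; have [sg sg_deriv [h1 h2 _ h3]] := @sigma_exists R k k_gt0 k_even.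
exists (2 - 2 * moment_quot k sg 0 / mass k 0 0).
  exact: dlam_diag_slope_gt0.
exact: dlam_diag_is_derive.
Qed.

Theorem theorem1p1 (R : realType) (k : nat) (hk : (2 <= k)%N)
    (hk_even : ~~ odd k) :
  (forall alpha : R, alpha != 0 -> lambda1 k 0 < lambda1 k alpha) /\
  [/\ \forall alpha \near (0 : R), derivable (@lambda1 R k) alpha 1,
      derivable (@lambda1 R k)^`()%classic (0 : R) 1
    & 0 < (@lambda1 R k)^`(2)%classic (0 : R)].
Proof.
have k_gt0 : (0 < k)%N by exact: ltnW.
have -> : @lambda1 R k = lam k by apply/funext => a; exact: lambda1E.
(* The first derivative is the diagonal of [dlam] on the whole line, so the second derivative at 0
   is that of the diagonal. *)
have dE : (@lam R k)^`()%classic = (fun z : R => dlam k z z).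
  by apply/funext => a; rewrite derive1E; have [_ ->] := lam_is_derive hk_even a.
have [d d0 [dd dE2]] := lam_second_derivative R k_gt0 hk_even.
split; first by move=> a; exact: lam0_lt.
split.
- by apply/nbhs_ballP; exists 1 => /= [|a _]; [|have [] := lam_is_derive hk_even a].
- by rewrite dE.
- by rewrite derive1nS derive1n1 dE derive1E dE2.
Qed.
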